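(* Let $A\subset\mathbb R^n$ be quasicompact, and let $f=\psi+U^\vartheta+U^\omega$ be an external field on $\overline A$ satisfying $\psi\in\Phi(\overline A)$, $\vartheta\in\mathcal E$, $\omega\in\mathfrak M$ bounded with $\inf_{x\in S(\omega),\,y\in A}|x-y|>0$, and $c_*(\{x\in A:\psi(x)<\infty\})>0$. Then there exists $\lambda_{A,f}\in\breve{\mathcal E}^+_f(A)$ with $I_f(\lambda_{A,f})=w_f(A)$.
   Context: Fix $n\ge 2$ and $0<\alpha<n$. $\mathfrak M$ is the space of real-valued (signed) Radon measures $\mu$ on $\mathbb R^n$, always assumed to satisfy $\int_{|y|>1}|y|^{\alpha-n}\,d|\mu|(y)<\infty$; $\mathfrak M^+$ is the cone of positive ones; $\mu$ is bounded if $|\mu|(\mathbb R^n)<\infty$; $S(\mu)$ is the support. $U^\mu(x)=\int|x-y|^{\alpha-n}\,d\mu(y)$, $I(\mu)=\iint|x-y|^{\alpha-n}\,d\mu(x)\,d\mu(y)$; $\mathcal E$ is the space of all $\mu\in\mathfrak M$ of finite energy $I(\mu)$. For $A\subset\mathbb R^n$: $\mathfrak M^+(A)$ is the set of $\mu\in\mathfrak M^+$ concentrated on $A$ (i.e. $\mathbb R^n\setminus A$ is $\mu$-negligible); $\mathcal E^+(A)=\mathcal E\cap\mathfrak M^+(A)$; $\breve{\mathcal E}^+(A)=\{\mu\in\mathcal E^+(A):\mu(\mathbb R^n)=1\}$. Inner capacity: $c_*(A)=1/\inf\{I(\mu):\mu\in\breve{\mathcal E}^+(A)\}$ (with $\inf\varnothing=+\infty$,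 $1/(+\infty)=0$); outer capacity $c^*(A)=\inf\{c_*(G):G\supset A\text{ open}\}$. $A$ is quasicompact if $\inf\{c^*(A\bigtriangleup K):K\subset\mathbb R^n\text{ compact}\}=0$, $\bigtriangleup$ being the symmetric difference. For closed $F$, $\Phi(F)$ is the class of lower semicontinuous functions $g:F\to(-\infty,\infty]$ that are $\ge0$ unless $F$ is compact. For $\omega=0$ the distance from $S(\omega)=\varnothing$ to $A$ is $+\infty$. The field $f$ is well defined on $\overline A$ outside a set of zero outer capacity. $\mathcal E^+_f(A)$ is the set of $\mu\in\mathcal E^+(A)$ for which $f$ is $\mu$-integrable, $\breve{\mathcal E}^+_f(A)=\mathcal E^+_f(A)\cap\breve{\mathcal E}^+(A)$, $I_f(\mu)=I(\mu)+2\int f\,d\mu$, and $w_f(A)=\inf_{\mu\in\breve{\mathcal E}^+_f(A)}I_f(\mu)$. *)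

(* Defs.v *)
From HB Require Import structures.
From mathcomp Require Import all_boot all_order all_algebra.
From mathcomp Require Import all_classical all_reals all_analysis.

Set Implicit Arguments.
Unset Strict Implicit.
Unset Printing Implicit Defensive.

Import Order.TTheory GRing.Theory Num.Theory.
Import numFieldNormedType.Exports.

Local Open Scope classical_set_scope.
Local Open Scope ring_scope.

(* R^n is 'rV[R]_n. Its topology is the usual one, but the library norm on
   'rV[R]_n is the sup norm, so the Euclidean norm is defined here. *)
Definition enorm {R : realType} {n : nat} (x : 'rV[R]_n) : R :=
  Num.sqrt (\sum_(i < n) x ord0 i ^+ 2).

(* R^n with its Borel sigma-algebra (a type convertible to 'rV[R]_n). *)
Notation borelRV R n := (g_sigma_algebraType (@open 'rV[R]_n)).

(* A signed Radon measure is encoded by its Jordan decomposition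
   mu = mu^+ - mu^-. Both parts may have infinite mass, so that mu itself need
   not be a set function on all Borel sets (it is not a charge). On R^n a
   positive Radon measure is a Borel measure that is finite on compact sets
   (regularity is then automatic). *)
Record signed_radon (R : realType) (n : nat) := SignedRadon {
  rpos : {measure set (borelRV R n) -> \bar R} ;
  rneg : {measure set (borelRV R n) -> \bar R} ;
  rpos_compact : forall K : set 'rV[R]_n, compact K -> (rpos K < +oo)%E ;
  rneg_compact : forall K : set 'rV[R]_n, compact K -> (rneg K < +oo)%E ;
  rpos_rneg_singular : exists P : set (borelRV R n),
    [/\ measurable P, rpos (~` P) = 0%E & rneg P = 0%E] }.

Section riesz.
Context {R : realType} {n : nat}.
Implicit Types (mu : signed_radon R n) (x y : 'rV[R]_n) (A F : set 'rV[R]_n)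
  (f : 'rV[R]_n -> \bar R) (alpha : R).
Local Open Scope ereal_scope.

Definition tvar mu : {measure set (borelRV R n) -> \bar R} :=
  measure_add (rpos mu) (rneg mu).

Definition sintegral mu (D : set (borelRV R n)) f : \bar R :=
  \int[rpos mu]_(x in D) f x - \int[rneg mu]_(x in D) f x.

Definition mass mu : \bar R := rpos mu setT - rneg mu setT.

Definition bounded_measure mu : Prop := tvar mu setT < +oo.

Definition supp mu : set 'rV[R]_n :=
  [set x | forall V : set 'rV[R]_n, open V -> V x -> 0 < tvar mu V].

Definition concentrated mu A : Prop := (tvar mu).-negligible (~` A).

(* The diagonal is treated apart because the library sets 0 `^ a = 0 for every
   a != 0, whereas the kernel is +oo there (alpha < n). *)
Definition riesz_kernel alpha x y : \bar R :=
  if x == y then +oo else (enorm (x - y) `^ (alpha - n%:R))%:E.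

Definition potential alpha mu x : \bar R :=
  sintegral mu setT (riesz_kernel alpha x).

Definition mutual_energy alpha (m1 m2 : {measure set (borelRV R n) -> \bar R})
    : \bar R :=
  \int[m1]_x \int[m2]_y riesz_kernel alpha x y.

(* The integral of the kernel against mu (x) mu, whose positive part is
   mu^+ (x) mu^+ + mu^- (x) mu^- and whose negative part is
   mu^+ (x) mu^- + mu^- (x) mu^+. It is a fin_num iff both parts give finite
   integrals, i.e. iff I(mu) is well defined and finite. *)
Definition energy alpha mu : \bar R :=
  (mutual_energy alpha (rpos mu) (rpos mu) +
   mutual_energy alpha (rneg mu) (rneg mu)) -
  (mutual_energy alpha (rpos mu) (rneg mu) +
   mutual_energy alpha (rneg mu) (rpos mu)).

(* In the usual notation: M (with its standing growth condition at infinity),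
   M^+, E, E^+(A), and the set of mu in E^+(A) with mu(R^n) = 1. The variants
   coneEf and unitEf below carry the index f. *)
Definition spaceM alpha : set (signed_radon R n) :=
  [set mu | \int[tvar mu]_(y in [set y : borelRV R n | (1 < enorm y)%R])
              (enorm y `^ (alpha - n%:R))%:E < +oo].

Definition coneM alpha : set (signed_radon R n) :=
  [set mu | spaceM alpha mu /\ rneg mu setT = 0].

Definition spaceE alpha : set (signed_radon R n) :=
  [set mu | spaceM alpha mu /\ energy alpha mu \is a fin_num].

Definition coneE alpha A : set (signed_radon R n) :=
  [set mu | [/\ spaceE alpha mu, coneM alpha mu & concentrated mu A]].

Definition unitE alpha A : set (signed_radon R n) :=
  [set mu | coneE alpha A mu /\ mass mu = 1].

(* In \bar R, inf of the empty set is +oo, +oo^-1 = 0 and 0^-1 = +oo. *)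
Definition inner_cap alpha A : \bar R :=
  (ereal_inf [set energy alpha mu | mu in unitE alpha A])^-1.

Definition outer_cap alpha A : \bar R :=
  ereal_inf [set inner_cap alpha G | G in [set G | open G /\ A `<=` G]].

(* `+` is the symmetric difference of sets. *)
Definition quasicompact alpha A : Prop :=
  ereal_inf [set outer_cap alpha (A `+` K) | K in [set K | compact K]] = 0.

(* Functions on F are total functions whose values off F are irrelevant; lower
   semicontinuity is for the relative topology of F (in [subspace F] the points
   off F are isolated). *)
Definition classPhi F : set ('rV[R]_n -> \bar R) :=
  [set g | [/\ lower_semicontinuous (g : subspace F -> \bar R),
               (forall x, F x -> g x != -oo) &
               (~ compact F -> forall x, F x -> 0 <= g x)]].

(* Where the sum is not defined (an undefined potential or oo - oo), the
   conventions of \bar R give the value -oo. This happens only on a set of zero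
   outer capacity, which is negligible for measures of finite energy. *)
Definition external_field alpha (psi : 'rV[R]_n -> \bar R)
    (theta omega : signed_radon R n) : 'rV[R]_n -> \bar R :=
  fun x => psi x + potential alpha theta x + potential alpha omega x.

Definition coneEf alpha f A : set (signed_radon R n) :=
  [set mu | coneE alpha A mu /\
    (tvar mu).-integrable (closure A : set (borelRV R n)) f].

Definition unitEf alpha f A : set (signed_radon R n) :=
  coneEf alpha f A `&` unitE alpha A.

(* I_f(mu), for mu concentrated on A and f defined on the closure of A. *)
Definition energyf alpha f A mu : \bar R :=
  energy alpha mu + 2%:E * sintegral mu (closure A) f.

Definition wf alpha f A : \bar R :=
  ereal_inf [set energyf alpha f A mu | mu in unitEf alpha f A].

End riesz.

(* Main.v *)
(** A direct-method proof that avoids positive definiteness of the Riesz kernel.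
    Normalised measures mu_k on A minimising I_f have bounded energy, and
    mu(G)^2 <= c_*(G) I(mu) together with quasicompactness makes them tight, with
    every weak limit again carried by A. A limit lambda is taken along an
    ultrafilter. Energies and integrals of lower semicontinuous functions are
    lower semicontinuous; the only terms needing an upper estimate are the mutual
    energies of mu_k with the negative parts of theta and omega. For omega the
    kernel is bounded at positive distance. For theta, cutting R^n into cubes gives
    I(mu, nu) <= N (e I(mu) + I(nu) / e) for every e > 0, also for the kernel
    restricted to its large values; hence the singular part and the mass of theta
    near infinity contribute little uniformly in k, and what is left is an
    integral of a bounded continuous function. *)

(* The set A need not be closed, so a weak limit of measures on A could leave A as well as lose mass
   at infinity. Both are excluded by one open set G of small capacity covering the symmetric
   difference of A and K: together with the complement of K it is an open set containing the
   complement of A. The infimum of I_f is not known beforehand to exceed -oo, so minimality is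
   checked against each competitor separately. The classical route treats theta by strong
   convergence in the pre-Hilbert space of measures of finite energy, which needs a positive
   definite energy. The substitute is an inequality for indicator kernels: pairs at distance below l
   lie in cells of side l/(n+1) with boundedly many relative positions, and pairs in a common cell
   are again at distance below l. As l is the same on both sides, the inequality integrates over the
   superlevel sets of any radially decreasing kernel; this is why integrals are compared through
   superlevel sets throughout. The constant N is worse than that of Cauchy-Schwarz, but the free
   parameter e absorbs it. *)
From HB Require Import structures.
From mathcomp Require Import all_boot all_order all_algebra.
From mathcomp Require Import all_classical all_reals all_analysis.
From mathcomp Require finmap.
From mathcomp Require Import measurable_realfun zify ring lra.
Require Import Defs.
Set Implicit Arguments.
Unset Strict Implicit.
Unset Printing Implicit Defensive.
Import Order.TTheory GRing.Theory Num.Theory.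
Import numFieldNormedType.Exports.
Local Open Scope classical_set_scope.
Local Open Scope ring_scope.

(** * Integrals compared through superlevel sets *)

Section layer_cake.
Context {R : realType}.
Local Open Scope ereal_scope.

Lemma lee_of_lt_fin (a b : \bar R) : (forall s : R, s%:E < a -> s%:E <= b) -> a <= b.
Proof.
move=> H; case: a H => [a||] H; last by rewrite leNye.
- apply/lee_subgt0Pr => e e0; apply: H; rewrite lte_fin; by rewrite ltrBlDr ltrDl.
- case: b H => [b||]// H.
  + by have := H (b + 1)%R (ltry _); rewrite lee_fin gerDl ler10.
  + by have := H 0%R (ltry _).
Qed.

(* a <= liminf_F b; only real s are used because a may be +oo. *)
Definition liminf_ge {I : Type} (F : set_system I) (a : \bar R) (b : I -> \bar R) :=
  forall s : R, s%:E < a -> \forall i \near F, s%:E < b i.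

Lemma liminf_geD {I : Type} (F : set_system I) {FF : Filter F} a a' b b' :
  0 <= a -> 0 <= a' -> (forall i, 0 <= b i) -> (forall i, 0 <= b' i) ->
  liminf_ge F a b -> liminf_ge F a' b' -> liminf_ge F (a + a') (fun i => b i + b' i).
Proof.
move=> a0 a'0 b0 b'0 ab ab' s.
case: a a0 ab => [a||]//= a0 ab; last first.
  move=> _; near=> i; have : s%:E < b i by near: i; apply: ab; rewrite ltry.
  by move=> /lt_le_trans; apply; rewrite leeDl.
case: a' a'0 ab' => [a'||]//= a'0 ab'; last first.
  move=> _; near=> i; have : s%:E < b' i by near: i; apply: ab'; rewrite ltry.
  by move=> /lt_le_trans; apply; rewrite leeDr.
rewrite -EFinD lte_fin => saa'.
pose e := ((a + a' - s) / 2)%R.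
have e0 : (0 < e)%R by rewrite /e divr_gt0// subr_gt0.
near=> i.
have -> : s = ((a - e) + (a' - e))%R by rewrite /e; field.
rewrite EFinD lteD//; near: i.
- by apply: ab; rewrite lte_fin ltrBlDr ltrDl.
- by apply: ab'; rewrite lte_fin ltrBlDr ltrDl.
Unshelve. all: by end_near. Qed.

Lemma liminf_geZ {I : Type} (F : set_system I) {FF : Filter F} (k : R) a b :
  (0 < k)%R -> liminf_ge F a b -> liminf_ge F (k%:E * a) (fun i => k%:E * b i).
Proof.
move=> k0 ab s ska.
have E x : (s%:E < k%:E * x) = ((k^-1 * s)%:E < x).
  by rewrite -lte_pdivrMl// EFinM.
rewrite E in ska; apply: filterS (ab _ ska) => i; by rewrite E.
Qed.

Lemma liminf_ge_sum {I : Type} (F : set_system I) {FF : Filter F} (a : nat -> \bar R)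
    (b : nat -> I -> \bar R) N :
  (forall j, 0 <= a j) -> (forall j i, 0 <= b j i) ->
  (forall j, liminf_ge F (a j) (b j)) ->
  liminf_ge F (\sum_(j < N) a j) (fun i => \sum_(j < N) b j i).
Proof.
move=> a0 b0 ab; elim: N => [|N IH].
  move=> s; rewrite big_ord0 => s0; near=> i; by rewrite big_ord0.
rewrite big_ord_recr/=.
rewrite (_ : (fun i => _) = (fun i => \sum_(j < N) b j i + b N i)); last first.
  by apply/funext => i; rewrite big_ord_recr.
by apply: liminf_geD => // [|i]; apply: sume_ge0.
Unshelve. all: by end_near. Qed.

(* A step function below y that depends only on which levels t > 0 satisfy t < y. *)
Definition stair (e : R) (N : nat) (y : \bar R) : R :=
  (\sum_(i < N) e * ((i.+1%:R * e)%:E < y)%E%:R)%R.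

Lemma stair_ge0 e N y : (0 <= e)%R -> (0 <= stair e N y)%R.
Proof. by move=> e0; apply: sumr_ge0 => i _; rewrite mulr_ge0. Qed.

Lemma stair_le_size e N y : (0 <= e)%R -> (stair e N y <= N%:R * e)%R.
Proof.
move=> e0; rewrite -[N in leRHS]card_ord -sum1_card natr_sum mulr_suml.
by apply: ler_sum => i _; rewrite mul1r ler_piMr// lern1; case: (_ < _).
Qed.

Lemma stair_le e N y : (0 <= e)%R -> 0 <= y -> (stair e N y)%:E <= y.
Proof.
move=> e0; case: y => [y||]// y0; last by rewrite leey.
rewrite lee_fin; elim: N => [|N IH]; first by rewrite /stair big_ord0.
rewrite /stair big_ord_recr/= -/(stair e N y%:E) lte_fin.
case: ltP => [h|_]; last by rewrite mulr0 addr0.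
rewrite mulr1; apply: le_trans (ltW h).
by rewrite -natr1 mulrDl mul1r lerD2r stair_le_size.
Qed.

Lemma stair_ge e N (y : R) : (0 < e)%R -> (y <= N%:R * e)%R -> (y - e <= stair e N y%:E)%R.
Proof.
move=> e0; elim: N => [|N IH] yN.
  by rewrite mul0r in yN; rewrite /stair big_ord0 subr_le0 (le_trans yN)// ltW.
rewrite /stair big_ord_recr/= -/(stair e N y%:E) lte_fin ltNge yN/= mulr0 addr0.
case: (leP y (N%:R * e)%R) => [|h]; first exact: IH.
have -> : stair e N y%:E = (N%:R * e)%R.
  rewrite /stair -[N in RHS]card_ord -sum1_card natr_sum mulr_suml.
  apply: eq_bigr => i _; rewrite lte_fin (le_lt_trans _ h) ?mulr1 ?mul1r//.
  by rewrite ler_pM2r// ler_nat ltn_ord.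
by move: yN; rewrite -natr1 mulrDl mul1r lerBlDr.
Qed.

Lemma stair_pinfty e N : stair e N +oo = (N%:R * e)%R.
Proof.
rewrite /stair -[N in RHS]card_ord -sum1_card natr_sum mulr_suml.
by apply: eq_bigr => i _; rewrite ltry mulr1 mul1r.
Qed.

(** An old level (i+1)e is the even level (2i+2)(e/2) of the finer stair, and the odd level just
    below it is passed whenever the old one is; so each old increment e is recovered as two
    halves. *)
Lemma stair_half e N y : (0 < e)%R -> (stair e N y <= stair (e / 2) (N * 2) y)%R.
Proof.
move=> e0; elim: N => [|N IH]; first by rewrite /stair !big_ord0.
rewrite mulSn -[(2 + N * 2)%N]/((N * 2).+2)%N /stair !big_ord_recr/= -!/(stair _ _ _).
rewrite -addrA lerD//.
have -> : ((N * 2).+2%:R * (e / 2) = N.+1%:R * e)%R.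
  by rewrite -[(N * 2).+2]/(2 + N * 2)%N -mulSn natrM; field.
case: (boolP (_ < y)) => [h|_]; last by rewrite mulr0 addr_ge0// mulr_ge0// divr_ge0// ltW.
have -> : ((N * 2).+1%:R * (e / 2))%:E < y.
  apply: le_lt_trans h; rewrite lee_fin.
  have -> : (N.+1%:R * e = (N * 2).+2%:R * (e / 2))%R.
    by rewrite -[(N * 2).+2]/(2 + N * 2)%N -mulSn natrM; field.
  by rewrite ler_pM2r ?divr_gt0// ler_nat.
by rewrite !mulr1; lra.
Qed.

(** With step 2^-j and 4^j steps the stair becomes finer while its top 2^j grows, so that it
    increases to every y in [0, +oo]. *)
Definition dstair (j : nat) : \bar R -> R := stair (2^-1 ^+ j) (4 ^ j).

Lemma dstair_ge0 j y : (0 <= dstair j y)%R.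
Proof. by apply: stair_ge0; rewrite exprn_ge0// invr_ge0. Qed.

Lemma dstair_nd y : {homo dstair^~ y : i j / (i <= j)%N >-> (i <= j)%R}.
Proof.
apply: homo_leq => [j//|j i k|j]; first exact: le_trans.
apply: (le_trans (stair_half _ _ _)); first by rewrite exprn_gt0// invr_gt0.
rewrite /dstair exprSr expnSr /stair.
have h : (4 ^ j * 2 <= 4 ^ j * 4)%N by rewrite leq_mul2l orbT.
rewrite (big_ord_widen _ (fun i => 2^-1 ^+ j / 2 * ((i.+1%:R * (2^-1 ^+ j / 2))%:E < y)%E%:R)%R h).
rewrite [leRHS](bigID (fun i : 'I_(4 ^ j * 4) => i < 4 ^ j * 2)%N)/= lerDl.
by apply: sumr_ge0 => i _; rewrite mulr_ge0// mulr_ge0// ?exprn_ge0// invr_ge0.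
Qed.

Lemma dstair_cvg y : 0 <= y -> (dstair j y)%:E @[j --> \oo] --> y.
Proof.
have H2 j : (0 < 2^-1 ^+ j :> R)%R by rewrite exprn_gt0// invr_gt0.
have E4 j : ((4 ^ j)%N%:R * 2^-1 ^+ j = 2 ^+ j :> R)%R.
  rewrite natrX -exprMn; congr (_ ^+ _)%R; by field.
case: y => [y||]// y0.
- apply/fine_cvgP; split; first exact: nearW.
  apply: (@squeeze_cvgr _ _ _ _ (fun j => y - 2^-1 ^+ j)%R (fun=> y)); last exact: cvg_cst.
  + near=> j; apply/andP; split; last by rewrite -lee_fin; apply: stair_le; rewrite // ltW.
    apply: stair_ge => //; rewrite E4.
    near: j. exists (Num.Def.trunc y).+1 => // j /= yj.
    apply: ltW; apply: lt_le_trans (Num.Theory.truncnS_gt _) _.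
    apply: (@le_trans _ _ j%:R); first by rewrite ler_nat.
    by rewrite -natrX ler_nat ltnW// ltn_expl.
  + rewrite -[X in _ --> X]subr0; apply: cvgB; first exact: cvg_cst.
    by apply: cvg_expr; rewrite ger0_norm ?invr_ge0// invf_lt1// ltr1n.
- rewrite (_ : (fun j => _) = (fun j => (2 ^+ j)%:E)); last first.
    by apply/funext => j; rewrite /dstair stair_pinfty E4.
  apply/cvgeryP. apply/cvgryPge => A; near=> j.
  near: j. exists (Num.Def.trunc A).+1 => // j /= yj.
  apply: ltW; apply: lt_le_trans (Num.Theory.truncnS_gt _) _.
  apply: (@le_trans _ _ j%:R); first by rewrite ler_nat.
  by rewrite -natrX ler_nat ltnW// ltn_expl.
Unshelve. all: by end_near. Qed.

Context {d} {T : measurableType d}.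

Lemma measurable_superlevel (f : T -> \bar R) (t : \bar R) :
  measurable_fun setT f -> measurable [set x | t < f x].
Proof.
move=> mf; rewrite -[X in measurable X]setTI.
exact: emeasurable_fun_o_infty.
Qed.

Lemma dstair_indic (f : T -> \bar R) j x : (dstair j (f x))%:E =
  \sum_(i < 4 ^ j) (2^-1 ^+ j)%:E * (\1_[set x : T | ((i.+1%:R * 2^-1 ^+ j)%:E < f x)%E] x)%:E.
Proof.
rewrite /dstair /stair -sumEFin; apply: eq_bigr => i _; rewrite EFinM indicE.
by congr (_ * (_%:R)%:E); congr nat_of_bool; apply/idP/idP; rewrite inE.
Qed.

Lemma measurable_dstair (f : T -> \bar R) j : measurable_fun setT f ->
  measurable_fun setT (fun x => (dstair j (f x))%:E).
Proof.
move=> mf; rewrite (_ : (fun x => _) = fun x => \sum_(i < 4 ^ j) (2^-1 ^+ j)%:E *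
    (\1_[set x : T | ((i.+1%:R * 2^-1 ^+ j)%:E < f x)%E] x)%:E); last first.
  by apply/funext => x; rewrite dstair_indic.
apply: emeasurable_sum => i; apply: measurable_funeM; apply/measurable_EFinP.
by apply: measurable_indic; exact: measurable_superlevel.
Qed.

Lemma integral_dstair (m : {measure set T -> \bar R}) (f : T -> \bar R) j :
  measurable_fun setT f ->
  \int[m]_x (dstair j (f x))%:E =
  \sum_(i < 4 ^ j) (2^-1 ^+ j)%:E * m [set x | (i.+1%:R * 2^-1 ^+ j)%:E < f x].
Proof.
move=> mf; under eq_integral do rewrite dstair_indic.
have mi i : measurable_fun setT (fun x => (2^-1 ^+ j)%:E *
   (\1_[set x : T | (((i : 'I_(4 ^ j)).+1%:R * 2^-1 ^+ j)%:E < f x)%E] x)%:E).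
  apply: measurable_funeM; apply/measurable_EFinP.
  by apply: measurable_indic; exact: measurable_superlevel.
rewrite ge0_integral_sum//.
apply: eq_bigr => i _; rewrite ge0_integralZl//.
- by rewrite integral_indic ?setIT//; exact: measurable_superlevel.
- by apply/measurable_EFinP/measurable_indic; exact: measurable_superlevel.
Qed.

Lemma cvg_integral_dstair (m : {measure set T -> \bar R}) (f : T -> \bar R) :
  measurable_fun setT f -> (forall x, 0 <= f x) ->
  \int[m]_x (dstair j (f x))%:E @[j --> \oo] --> \int[m]_x f x.
Proof.
move=> mf f0.
have -> : \int[m]_x f x = \int[m]_x limn (fun j => (dstair j (f x))%:E).
  by apply: eq_integral => x _; apply/esym/cvg_lim => //; exact: dstair_cvg.
apply: (@cvg_monotone_convergence _ T R m setT measurableT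
  (fun j x => (dstair j (f x))%:E)) => //.
- by move=> j; exact: measurable_dstair.
- by move=> j x _; rewrite lee_fin dstair_ge0.
- by move=> x _ i j ij; rewrite lee_fin dstair_nd.
Qed.

End layer_cake.

Section integral_superlevels.
Context {R : realType} {d d'} {T : measurableType d} {T' : measurableType d'}.
Local Open Scope ereal_scope.

(** A stair integral, which is a finite combination of masses of superlevel sets, already exceeds s,
    and lower limits pass to finite sums. Only these masses are compared, so the measures may live
    on different spaces and the functions may vary with the index. *)
Lemma liminf_integral {I : Type} (F : set_system I) {FF : Filter F}
    (m : {measure set T -> \bar R}) (m' : I -> {measure set T' -> \bar R})
    (f : T -> \bar R) (f' : I -> T' -> \bar R) :
  measurable_fun setT f -> (forall x, 0 <= f x) ->
  (forall i, measurable_fun setT (f' i)) -> (forall i x, 0 <= f' i x) ->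
  (forall t : R, (0 < t)%R ->
    liminf_ge F (m [set x | t%:E < f x]) (fun i => m' i [set x | t%:E < f' i x])) ->
  liminf_ge F (\int[m]_x f x) (fun i => \int[m' i]_x f' i x).
Proof.
move=> mf f0 mf' f'0 H s sf.
have H2 j : (0 < 2^-1 ^+ j :> R)%R by rewrite exprn_gt0// invr_gt0.
have [j sj] : exists j, s%:E < \int[m]_x (dstair j (f x))%:E.
  have : \forall j \near \oo, s%:E < \int[m]_x (dstair j (f x))%:E.
    have N : nbhs (\int[m]_x f x) [set y | s%:E < y].
      by apply: open_nbhs_nbhs; split => //; exact: open_ereal_gt_ereal.
    by have /(_ _ N) := @cvg_integral_dstair _ _ _ m _ mf f0.
  by case=> j _ /(_ j) /(_ (leqnn j)) ?; exists j.
move: sj; rewrite integral_dstair// => sj.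
have g0 : 0 <= (2^-1 ^+ j)%:E :> \bar R by rewrite lee_fin ltW.
have S : \forall k \near F, s%:E < \sum_(i < 4 ^ j) (2^-1 ^+ j)%:E *
    m' k [set x | (i.+1%:R * 2^-1 ^+ j)%:E < f' k x].
  apply: (@liminf_ge_sum R I F _
    (fun i => (2^-1 ^+ j)%:E * m [set x | (i.+1%:R * 2^-1 ^+ j)%:E < f x])
    (fun i k => (2^-1 ^+ j)%:E * m' k [set x | (i.+1%:R * 2^-1 ^+ j)%:E < f' k x])) sj.
  - by move=> i; rewrite mule_ge0.
  - by move=> i k; rewrite mule_ge0.
  - by move=> i; apply: liminf_geZ => //; apply: H; rewrite mulr_gt0.
apply: filterS S => k.
rewrite -integral_dstair// => /lt_le_trans; apply.
apply: ge0_le_integral => //.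
- by move=> x _; rewrite lee_fin dstair_ge0.
- exact: measurable_dstair.
- by move=> x _; apply: stair_le; rewrite // ltW.
Qed.

Lemma le_integral_superlevel (m : {measure set T -> \bar R}) (m' : {measure set T' -> \bar R})
    (f : T -> \bar R) (f' : T' -> \bar R) :
  measurable_fun setT f -> (forall x, 0 <= f x) ->
  measurable_fun setT f' -> (forall x, 0 <= f' x) ->
  (forall t : R, (0 < t)%R -> m [set x | t%:E < f x] <= m' [set x | t%:E < f' x]) ->
  \int[m]_x f x <= \int[m']_x f' x.
Proof.
move=> mf f0 mf' f'0 H.
(* Along the principal filter of a single point a lower limit is a plain inequality. *)
have := @liminf_integral unit (globally [set tt]) (globally_filter _) m (fun=> m') f (fun=> f') mf f0 (fun=> mf') (fun=> f'0).
move=> L; apply: lee_of_lt_fin => s sf.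
have S : globally [set tt] (fun=> s%:E < \int[m']_x f' x).
  apply: L => // t t0 r rf; by move=> _ _; exact: lt_le_trans rf (H _ t0).
exact/ltW/(S tt).
Qed.

End integral_superlevels.

(** * Weak limits along an ultrafilter *)

Section borel.
Context {R : realType} {n : nat}.
Implicit Types A K G : set 'rV[R]_n.

Lemma open_borel G : open G -> measurable (G : set (borelRV R n)).
Proof. by move=> oG; apply: sub_sigma_algebra. Qed.

Lemma closed_borel K : closed K -> measurable (K : set (borelRV R n)).
Proof.
move=> cK; rewrite -[K]setCK; apply: measurableC; apply: open_borel.
by rewrite openC.
Qed.

Lemma compact_borel K : compact K -> measurable (K : set (borelRV R n)).
Proof. by move=> cK; apply: closed_borel; apply: compact_closed => //; exact: norm_hausdorff. Qed.

End borel.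

(** * From a finitely additive content to a Borel measure *)

Section inner_regularization.
Context {R : realType} {n : nat} (M : set (borelRV R n) -> R).
Hypothesis M0 : M set0 = 0.
Hypothesis M_le : forall A B, measurable A -> measurable B -> A `<=` B -> M A <= M B.
Hypothesis M_D : forall A B, measurable A -> measurable B -> A `&` B = set0 ->
  M (A `|` B) = M A + M B.
Local Open Scope ereal_scope.

(** The two classical steps from a content on compact sets to a regular Borel measure: supremum over
    compact subsets for open sets, then infimum over open supersets. They restore countable
    additivity, which [M] lacks. *)
Definition inner_content (G : set 'rV[R]_n) : \bar R :=
  ereal_sup [set (M K)%:E | K in [set K : set 'rV[R]_n | compact K /\ K `<=` G]].

Definition outer_of_content (E : set 'rV[R]_n) : \bar R :=
  ereal_inf [set inner_content G | G in [set G | open G /\ E `<=` G]].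

Lemma inner_content_ge (K G : set 'rV[R]_n) : compact K -> K `<=` G -> (M K)%:E <= inner_content G.
Proof. by move=> cK KG; apply: ereal_sup_ubound; exists K. Qed.

Lemma inner_content_ge0 G : 0 <= inner_content G.
Proof.
have : (M set0)%:E <= inner_content G by apply: inner_content_ge => //; exact: compact0.
by rewrite M0.
Qed.

Lemma le_inner_content G H : G `<=` H -> inner_content G <= inner_content H.
Proof.
move=> GH; apply: le_ereal_sup => _ [K [cK KG] <-]; exists K => //; split => //.
exact: subset_trans GH.
Qed.

Lemma outer_of_open G : open G -> outer_of_content G = inner_content G.
Proof.
move=> oG; apply/eqP; rewrite eq_le; apply/andP; split.
  by apply: ereal_inf_lbound; exists G => //; split.
by apply: le_ereal_inf_tmp => _ [H [oH GH] <-]; exact: le_inner_content.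
Qed.

Lemma outer_of_content0 : outer_of_content set0 = 0.
Proof.
rewrite outer_of_open; last exact: open0.
apply/eqP; rewrite eq_le inner_content_ge0 andbT.
by apply: ge_ereal_sup => _ [K [cK K0] <-]; move: K0; rewrite subset0 => ->; rewrite M0.
Qed.

Lemma outer_of_content_ge0 E : 0 <= outer_of_content E.
Proof. by apply: le_ereal_inf_tmp => _ [H [oH GH] <-]; exact: inner_content_ge0. Qed.

Lemma le_outer_of_content : {homo outer_of_content : A B / A `<=` B >-> A <= B}.
Proof.
move=> A B AB; apply: le_ereal_inf => _ [G [oG BG] <-]; exists G => //; split => //.
exact: subset_trans BG.
Qed.

Let M_subadd (K : (set 'rV[R]_n) ^nat) (N : nat) : (forall i, compact (K i)) ->
  (M (\bigcup_(i < N) K i) <= \sum_(i < N) M (K i))%R.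
Proof.
move=> cK; elim: N => [|N IH]; first by rewrite bigcup_mkord !big_ord0 M0.
rewrite big_ord_recr/= bigcup_mkord big_ord_recr/= -bigcup_mkord.
set U := \bigcup_(i < N) K i.
have mU : measurable (U : set (borelRV R n)).
  by apply: bigcup_measurable => i _; exact: compact_borel.
have mK := compact_borel (cK N).
have -> : U `|` K N = U `|` (K N `\` U) by rewrite setDE setUIr setUv setIT.
rewrite M_D//; [|exact: measurableD|by rewrite setDIK].
by rewrite lerD// M_le//; exact: measurableD.
Qed.

Lemma ball_inside_closed (G : set 'rV[R]_n) (r : R) : closed [set x | ball x r `<=` G].
Proof.
rewrite (_ : [set x | _] = ~` (\bigcup_(y in ~` G) ball y r)); last first.
  apply/seteqP; split=> [x xG [y Gy yx]|x xG y xy]; first by apply: Gy; apply: xG; exact: ball_sym.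
  by apply: contrapT => Gy; apply: xG; exists y => //; exact: ball_sym.
by rewrite closedC; apply: bigcup_open => y _; exact: ball_open.
Qed.

(* Near each point of K some ball of radius 1/N lies in one of the first N sets,
   and compactness makes N uniform: this cuts K into finitely many compact pieces. *)
Lemma inner_content_bigcup (G : (set 'rV[R]_n) ^nat) : (forall i, open (G i)) ->
  inner_content (\bigcup_i G i) <= \sum_(0 <= i <oo) inner_content (G i).
Proof.
move=> oG; apply: ge_ereal_sup => _ [K [cK KG] <-].
pose P (N : nat) (x : 'rV[R]_n) := exists2 i, (i < N)%N & ball x N.+1%:R^-1 `<=` G i.
have : \forall N \near \oo, K `<=` P N.
  apply: (iffLR (compact_near_coveringP K) cK) => x Kx.
  have [i _ Gix] := KG x Kx.
  have /nbhs_ballP[e /= e0 eG] : nbhs x (G i) by exact: open_nbhs_nbhs.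
  exists (ball x (e / 2), [set N | (i < N)%N /\ N.+1%:R^-1 < e / 2]%R) => /=.
    split; first by apply: nbhsx_ballx; rewrite divr_gt0.
    near=> N; split; first by near: N; exists i.+1.
    by near: N; exact: (near_infty_natSinv_lt (PosNum (divr_gt0 e0 (ltr0n R 2)))).
  move=> [y N]/= [xy [iN Ne]]; exists i => // z yz; apply: eG.
  by rewrite (splitr e); apply: ball_triangle xy _; apply: le_ball yz; exact: ltW.
case=> N _ /(_ N (leqnn N)) KP.
pose L i : set 'rV[R]_n := K `&` [set x | ball x N.+1%:R^-1 `<=` G i].
have cL i : compact (L i).
  apply: compact_closedI => //; exact: ball_inside_closed.
have LG i : L i `<=` G i by move=> x [_]; apply; apply: ballxx; rewrite invr_gt0.
have KL : K `<=` \bigcup_(i < N) L i.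
  by move=> x Kx; have [i iN xG] := KP x Kx; exists i.
apply: (@le_trans _ _ (\sum_(i < N) M (L i))%R%:E).
  rewrite lee_fin; apply: le_trans (M_subadd N cL); apply: M_le => //.
  - exact: compact_borel.
  - by apply: bigcup_measurable => i _; exact: compact_borel.
rewrite -sumEFin; apply: (@le_trans _ _ (\sum_(i < N) inner_content (G i))).
  by apply: lee_sum => i _; exact: inner_content_ge.
rewrite -(big_mkord xpredT (fun i => inner_content (G i))).
by apply: nneseries_lim_ge => i _ _; exact: inner_content_ge0.
Unshelve. all: by end_near. Qed.

Lemma outer_of_content_sigma_subadditive : sigma_subadditive outer_of_content.
Proof.
move=> E; apply/lee_addgt0Pr => e e0.
have H i : exists G, [/\ open G, E i `<=` G &
    inner_content G <= outer_of_content (E i) + (e / (2 ^ i.+1)%:R)%:E].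
  have e2 : (0 < e / (2 ^ i.+1)%:R)%R by rewrite divr_gt0// ltr0n expn_gt0.
  have [fin|] := boolP (outer_of_content (E i) \is a fin_num).
    have [_ [G [oG EG] <-] lt] := lb_ereal_inf_adherent e2 fin.
    by exists G; split => //; exact: ltW.
  rewrite ge0_fin_numE ?outer_of_content_ge0// -leNgt leye_eq => /eqP ->.
  by exists setT; split => //; [exact: openT|rewrite addye// leey].
have [G GP] := choice H.
apply: (@le_trans _ _ (\sum_(0 <= i <oo) inner_content (G i))).
  apply: le_trans (inner_content_bigcup _); last by move=> i; have [] := GP i.
  apply: ereal_inf_lbound; exists (\bigcup_i G i) => //; split.
    by apply: bigcup_open => i _; have [] := GP i.
  by apply: subset_bigcup => i _; have [] := GP i.
apply: le_trans (epsilon_trick xpredT _ (ltW e0)).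
  by apply: lee_nneseries => [i *|i *]; [exact: inner_content_ge0|have [] := GP i].
by move=> i; exact: outer_of_content_ge0.
Qed.

HB.instance Definition _ := isOuterMeasure.Build R 'rV[R]_n outer_of_content
  outer_of_content0 outer_of_content_ge0 le_outer_of_content
  outer_of_content_sigma_subadditive.

(** Given an open H containing E, exhaust [H] inside G by a compact K, and then the open set H minus
    K, which contains H minus G, by a compact L. As K and L are disjoint compact subsets of H,
    additivity of [M] bounds the sum. Since [M] is real-valued, all terms are finite and can be
    moved across the inequality. *)
Lemma open_caratheodory (G : set 'rV[R]_n) : open G ->
  caratheodory_measurable outer_of_content G.
Proof.
move=> oG; apply: le_caratheodory_measurable => E.
apply: le_ereal_inf_tmp => _ [H [oH EH] <-].
apply: (@le_trans _ _ (inner_content (H `&` G) + outer_of_content (H `&` ~` G))).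
  apply: leeD; last by apply: le_outer_of_content; exact: setSI.
  rewrite -outer_of_open; last exact: openI.
  by apply: le_outer_of_content; exact: setSI.
have fin E' : outer_of_content E' \is a fin_num.
  rewrite ge0_fin_numE ?outer_of_content_ge0//; apply: le_lt_trans (ltry (M setT)).
  apply: (@le_trans _ _ (inner_content setT)).
    by apply: ereal_inf_lbound; exists setT => //; split => //; exact: openT.
  by apply: ge_ereal_sup => _ [K [cK _] <-]; rewrite lee_fin M_le//; exact: compact_borel.
rewrite -leeBrDr//; apply: ge_ereal_sup => _ [K [cK KHG] <-].
rewrite leeBrDr//.
have oHK : open (H `\` K).
  by apply: openI => //; rewrite openC; apply: compact_closed => //; exact: norm_hausdorff.
apply: (@le_trans _ _ ((M K)%:E + inner_content (H `\` K))).
  rewrite leeD2l// -outer_of_open//; apply: le_outer_of_content => x [Hx nGx]; split => //.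
  by move=> /KHG[].
rewrite -leeBrDl//; apply: ge_ereal_sup => _ [L [cL LHK] <-]; rewrite leeBrDl// -EFinD -M_D.
- apply: inner_content_ge; first exact: compactU.
  by rewrite subUset; split => [x /KHG[]//|x /LHK[]].
- exact: compact_borel.
- exact: compact_borel.
- by apply/seteqP; split => // x [Kx /LHK[]].
Qed.

Lemma borel_caratheodory (E : set (borelRV R n)) : measurable E ->
  caratheodory_measurable outer_of_content E.
Proof.
apply: smallest_sub; last exact: open_caratheodory.
split.
- exact: caratheodory_measurable_set0.
- by move=> A cA; rewrite setTD; exact: caratheodory_measurable_setC.
- exact: caratheodory_measurable_bigcup.
Qed.

Definition measure_of_content (E : set (borelRV R n)) : \bar R := outer_of_content E.

Let measure_of_content_semi_sigma_additive : semi_sigma_additive measure_of_content.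
Proof.
move=> F mF tF mUF.
have cF i := borel_caratheodory (mF i).
exact: (@caratheodory_measure_sigma_additive R 'rV[R]_n outer_of_content F cF tF
  (borel_caratheodory mUF)).
Qed.

HB.instance Definition _ := isMeasure.Build _ (borelRV R n) R measure_of_content
  outer_of_content0 outer_of_content_ge0 measure_of_content_semi_sigma_additive.

Lemma ex_inner_measure : exists m : {measure set (borelRV R n) -> \bar R},
  forall G : set 'rV[R]_n, open G -> m G = inner_content G.
Proof. by exists measure_of_content => G oG; exact: outer_of_open. Qed.

End inner_regularization.

Lemma fmap_ultra {T S : Type} (f : T -> S) (U : set_system T) :
  UltraFilter U -> UltraFilter (f @ U).
Proof.
move=> UU; split; first exact: fmap_proper_filter.
move=> G FG UG; apply/seteqP; split => // A GA.
have [//|/(UG (~` A)) GnA] := in_ultra_setVsetC (f @^-1` A) UU.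
exfalso; apply: (@filter_not_empty _ G FG); rewrite -(setICr A); exact: filterI.
Qed.

Lemma cvg_ultra_bounded {R : realType} {I : Type} (U : set_system I) {UU : UltraFilter U}
    (f : I -> R) (a b : R) :
  (forall i, a <= f i <= b) -> cvg (f i @[i --> U]).
Proof.
move=> fab; have := @segment_compact R a b; rewrite compact_ultra.
have fU : (f @ U) `[a, b]%classic.
  by apply: nearW => i /=; rewrite in_itv/=.
by move=> /(_ (f @ U) (fmap_ultra f UU) fU)[p [_ fp]]; apply/cvg_ex; exists p.
Qed.

Lemma ler_cvg_filter {R : realFieldType} {I : Type} (U : set_system I) {UU : ProperFilter U}
    (f g : I -> R) (a b : R) : f i @[i --> U] --> a -> g i @[i --> U] --> b ->
  (\forall i \near U, f i <= g i) -> a <= b.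
Proof.
move=> fa gb fg; rewrite leNgt; apply/negP => ba.
have [h1 h2] : a > (a + b) / 2 /\ (a + b) / 2 > b by lra.
have : \forall i \near U, False; last by move/filter_ex => [].
near=> i.
have : f i <= g i by near: i.
rewrite leNgt => /negP; apply; apply: (@lt_trans _ _ ((a + b) / 2)).
  by near: i; exact: (cvgr_lt _ gb).
by near: i; exact: (cvgr_gt _ fa).
Unshelve. all: by end_near. Qed.

Section weak_limit.
Context {R : realType} {n : nat} {I : Type} (U : set_system I) {UU : UltraFilter U}.
Variable m : I -> {measure set (borelRV R n) -> \bar R}.
Hypothesis m1 : forall i, (m i setT <= 1)%E.
Local Open Scope ereal_scope.

Let m_le1 i A : measurable A -> m i A <= 1.
Proof. by move=> mA; apply: le_trans (m1 i); apply: le_measure; rewrite ?inE. Qed.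

Let m_fin i A : measurable A -> m i A \is a fin_num.
Proof. by move=> mA; rewrite ge0_fin_numE// (le_lt_trans (m_le1 i mA))// ltry. Qed.

(** An ultrafilter makes the limit exist on all Borel sets at once, but the resulting set function
    is only finitely additive. *)
Definition ultra_content (A : set (borelRV R n)) : R := lim (fine (m i A) @[i --> U]).

Let cvg_content A : measurable A -> fine (m i A) @[i --> U] --> ultra_content A.
Proof.
move=> mA; apply: (@cvg_ultra_bounded R I U _ _ 0%R 1%R) => i.
by rewrite fine_ge0//= -lee_fin fineK ?m_fin// m_le1.
Qed.

(** Regularising [ultra_content] from inside may lose mass. On open sets this leaves one-sided weak
    convergence, and the last conclusion says that mass kept on a fixed compact set is not lost. *)
Lemma ex_weak_limit : exists lambda : {measure set (borelRV R n) -> \bar R},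
  [/\ (forall G : set 'rV[R]_n, open G -> liminf_ge U (lambda G) (fun i => m i G)),
      lambda setT <= 1 &
      forall (K : set 'rV[R]_n) (s : R), compact K ->
        (\forall i \near U, s%:E <= m i K) -> s%:E <= lambda setT].
Proof.
have C0 : ultra_content set0 = 0%R.
  apply/cvg_lim => //; under eq_fun do rewrite measure0; exact: cvg_cst.
have Cle A B : measurable A -> measurable B -> A `<=` B ->
    (ultra_content A <= ultra_content B)%R.
  move=> mA mB AB; apply: (ler_cvg_filter (cvg_content mA) (cvg_content mB)).
  apply: (@nearW _ U) => i; apply: fine_le; rewrite ?m_fin//.
  by apply: le_measure; rewrite ?inE.
have CD A B : measurable A -> measurable B -> A `&` B = set0 ->
    ultra_content (A `|` B) = (ultra_content A + ultra_content B)%R.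
  move=> mA mB AB; apply/cvg_lim => //.
  under eq_fun => i do rewrite measureU// fineD ?m_fin//.
  exact: cvgD (cvg_content mA) (cvg_content mB).
have [l lE] := ex_inner_measure C0 Cle CD.
exists l; split.
- move=> G oG s; rewrite lE// => /ereal_sup_gt[_ [K [cK KG] <-]]; rewrite lte_fin => sK.
  have : \forall i \near U, (s < fine (m i K))%R.
    apply: (cvgr_gt (ultra_content K)) sK; apply: cvg_content; exact: compact_borel.
  apply: filterS => i; rewrite -lte_fin fineK ?m_fin//; last exact: compact_borel.
  by move=> /lt_le_trans; apply; apply: le_measure; rewrite ?inE//;
    [exact: compact_borel|exact: open_borel].
- rewrite lE; last exact: openT.
  apply: ge_ereal_sup => _ [K [cK _] <-]; rewrite lee_fin.
  apply: (ler_cvg_filter (cvg_content (compact_borel cK)) (cvg_cst _)).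
  by apply: (@nearW _ U) => i; rewrite -lee_fin fineK ?m_fin ?m_le1//; exact: compact_borel.
- move=> K s cK sK; rewrite lE; last exact: openT.
  apply: le_trans (inner_content_ge _ cK (@subsetT _ _)); rewrite lee_fin.
  apply: (ler_cvg_filter (cvg_cst _) (cvg_content (compact_borel cK))).
  by apply: filterS sK => i; rewrite -lee_fin fineK// m_fin//; exact: compact_borel.
Qed.

End weak_limit.

Lemma measurable_fun_superlevel {R : realType} d (T : measurableType d) (D : set T)
    (f : T -> \bar R) : measurable D ->
  (forall a : R, measurable (D `&` [set x | a%:E < f x]%E)) -> measurable_fun D f.
Proof.
move=> mD H _; apply: (measurability _ (ErealGenOInfty.measurableE R)) => //.
by move=> /= _ [_ [a ->]] <-; rewrite preimage_itvoy; exact: H.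
Qed.

(** * The shifted Riesz kernel and its potentials *)

Section enorm_theory.
Context {R : realType} {n : nat}.
Implicit Types x y z : 'rV[R]_n.

Lemma enorm_ge0 x : 0 <= enorm x. Proof. exact: sqrtr_ge0. Qed.

Lemma sqr_enorm x : enorm x ^+ 2 = \sum_(i < n) x ord0 i ^+ 2.
Proof. by rewrite sqr_sqrtr// sumr_ge0// => i _; exact: sqr_ge0. Qed.

Lemma enorm0 : enorm (0 : 'rV[R]_n) = 0.
Proof. by rewrite /enorm big1 ?sqrtr0// => i _; rewrite mxE expr0n. Qed.

Lemma enormN x : enorm (- x) = enorm x.
Proof. by congr Num.sqrt; apply: eq_bigr => i _; rewrite mxE sqrrN. Qed.

Lemma enormC x y : enorm (x - y) = enorm (y - x).
Proof. by rewrite -enormN opprB. Qed.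

Lemma le_coord_enorm x i : `|x ord0 i| <= enorm x.
Proof.
rewrite -sqrtr_sqr ler_wsqrtr// (bigD1 i)//= lerDl.
by apply: sumr_ge0 => j _; exact: sqr_ge0.
Qed.

Lemma enorm_eq0 x : (enorm x == 0) = (x == 0).
Proof.
apply/eqP/eqP => [x0|->]; last exact: enorm0.
apply/rowP => i; rewrite mxE; apply/normr0_eq0/eqP.
by rewrite eq_le normr_ge0 andbT -x0 le_coord_enorm.
Qed.

(** Cauchy-Schwarz: sum ab <= (t a^2 + b^2 / t) / 2 over the coordinates with t = |y| / |x|. *)
Lemma coord_sum_mul x y : \sum_(i < n) x ord0 i * y ord0 i <= enorm x * enorm y.
Proof.
have [/eqP|x0] := eqVneq (enorm x) 0.
  by rewrite enorm_eq0 => /eqP ->; rewrite enorm0 mul0r big1// => i _; rewrite mxE mul0r.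
have [/eqP|y0] := eqVneq (enorm y) 0.
  by rewrite enorm_eq0 => /eqP ->; rewrite enorm0 mulr0 big1// => i _; rewrite mxE mulr0.
have xp : 0 < enorm x by rewrite lt0r x0 enorm_ge0.
have yp : 0 < enorm y by rewrite lt0r y0 enorm_ge0.
have H i : x ord0 i * y ord0 i <=
    (enorm y / enorm x) / 2 * x ord0 i ^+ 2 + (enorm x / enorm y) / 2 * y ord0 i ^+ 2.
  rewrite -subr_ge0.
  have -> : (enorm y / enorm x) / 2 * x ord0 i ^+ 2 + (enorm x / enorm y) / 2 * y ord0 i ^+ 2
      - x ord0 i * y ord0 i =
      (enorm y * x ord0 i - enorm x * y ord0 i) ^+ 2 / (2 * enorm x * enorm y).
    by field; apply/andP.
  by rewrite divr_ge0 ?sqr_ge0// !mulr_ge0// enorm_ge0.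
apply: (le_trans (ler_sum _ (fun i _ => H i))).
rewrite big_split/= -!mulr_sumr -!sqr_enorm le_eqVlt; apply/orP; left; apply/eqP.
by field; apply/andP.
Qed.

Lemma enorm_triangle x y : enorm (x + y) <= enorm x + enorm y.
Proof.
rewrite -(ler_pXn2r (_ : 0 < 2)%N) ?nnegrE ?addr_ge0 ?enorm_ge0//.
rewrite sqr_enorm sqrrD !sqr_enorm.
under eq_bigr => i _ do rewrite mxE sqrrD.
rewrite !big_split/= lerD2r lerD2l -mulr2n lerMn2r/=.
exact: coord_sum_mul.
Qed.

Lemma enorm_dist x y z : enorm (x - z) <= enorm (x - y) + enorm (y - z).
Proof. by rewrite (le_trans _ (enorm_triangle _ _))// subrKA. Qed.

Lemma norm_le_enorm x : `|x| <= enorm x.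
Proof.
have [|] := boolP (`|x| == 0); first by move/eqP ->; exact: enorm_ge0.
by move=> /mx_norm_neq0[[i j] /= E]; rewrite [ `|x| ]E (ord1 i) le_coord_enorm.
Qed.

Lemma measurable_enorm d (T : measurableType d) (f : T -> 'rV[R]_n) :
  (forall i, measurable_fun setT (fun t => f t ord0 i)) ->
  measurable_fun setT (fun t => enorm (f t)).
Proof.
move=> mf; rewrite (_ : (fun t => _) = Num.sqrt \o (fun t => \sum_(i < n) f t ord0 i ^+ 2))//.
apply: measurableT_comp.
  by apply: continuous_measurable_fun; exact: sqrt_continuous.
by apply: measurable_sum => i; apply: measurable_funX.
Qed.

Lemma measurable_coord (i : 'I_n) :
  measurable_fun setT (fun x : borelRV R n => (x : 'rV[R]_n) ord0 i).
Proof.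
apply/measurable_EFinP/measurable_fun_superlevel => // a; rewrite setTI.
apply: open_borel.
rewrite (_ : [set x | _] = (fun x : 'rV[R]_n => x ord0 i) @^-1` [set t | a < t])//.
by apply: open_comp; [move=> x _; exact: coord_continuous|exact: open_gt].
Qed.

Lemma enorm_continuous : continuous (enorm : 'rV[R]_n -> R).
Proof.
move=> x; rewrite /enorm; apply: (@continuous_comp _ _ _ _ Num.sqrt).
  apply: (@cvg_big R 'I_n +%R 0 xpredT (@add_continuous R) _ (nbhs x) _ _ _ (nbhs_filter x)) => i _.
  by rewrite expr2; under eq_fun do rewrite expr2; apply: cvgM; exact: coord_continuous.
exact: sqrt_continuous.
Qed.

Lemma near_enorm x (e : R) : 0 < e -> \forall y \near x, enorm (x - y) < e.
Proof.
move=> e0; have : (enorm \o (fun y => x - y)) y @[y --> x] --> (0 : R).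
  rewrite -[X in _ --> X]enorm0 -(subrr x).
  apply: (@continuous_comp _ _ _ (fun y => x - y) enorm); last exact: enorm_continuous.
  by apply: continuousB => //; exact: cst_continuous.
by move/cvgr_lt => /(_ _ e0).
Qed.

Lemma enorm_ball_compact x (r : R) : compact [set y | enorm (x - y) <= r].
Proof.
apply: bounded_closed_compact.
  exists (`|x| + r); split; first exact: num_real.
  move=> M Mr y /= xyr; apply: le_trans (ltW Mr).
  rewrite -[y](subKr x) (le_trans (ler_normB _ _))// lerD2l.
  exact: le_trans (norm_le_enorm _) xyr.
rewrite (_ : [set y | _] = (enorm \o (fun y => x - y)) @^-1` [set t | t <= r])//.
apply: closed_comp; last exact: closed_le.
move=> y _; apply: (@continuous_comp _ _ _ (fun y => x - y) enorm); last exact: enorm_continuous.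
by apply: continuousB => //; exact: cst_continuous.
Qed.

End enorm_theory.

Section riesz_profile.
Context {R : realType}.
Local Open Scope ereal_scope.

Definition riesz_profile (p t : R) : \bar R := if t == 0%R then +oo else (t `^ p)%:E.

Lemma riesz_profile_ge0 p t : 0 <= riesz_profile p t.
Proof. by rewrite /riesz_profile; case: eqP => // _; rewrite lee_fin powR_ge0. Qed.

Variable p : R.
Hypothesis p0 : (p < 0)%R.

(** The threshold is l = a^(1/p), written with a positive exponent. The strict equivalence gives
    open superlevel sets; the non-strict one gives open sets where the kernel is small, as needed in
    [cokern_superlevel_open]. *)
Lemma riesz_profile_levels (a : R) : (0 < a)%R -> exists2 l : R, (0 < l)%R &
  forall t, (0 <= t)%R ->
    (a%:E < riesz_profile p t) = (t < l)%R /\ (a%:E <= riesz_profile p t) = (t <= l)%R.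
Proof.
move=> a0; exists (a^-1 `^ (- p)^-1)%R; first by rewrite powR_gt0// invr_gt0.
move=> t t0; rewrite /riesz_profile; case: eqP => [->|/eqP tn0].
  by rewrite ltry leey powR_gt0 ?powR_ge0// invr_gt0.
have tp : (0 < t)%R by rewrite lt_neqAle eq_sym tn0.
set q := (- p)%R; have q0 : (0 < q)%R by rewrite oppr_gt0.
have -> : (t `^ p = (t `^ q)^-1)%R by rewrite -powRN opprK.
have tq : (0 < t `^ q)%R by exact: powR_gt0.
have ai : (0 < a^-1)%R by rewrite invr_gt0.
have -> : (a%:E < ((t `^ q)^-1)%:E) = (t `^ q < a^-1)%R.
  by rewrite lte_fin -[a in LHS]invrK; apply: ltf_pV2.
have -> : (a%:E <= ((t `^ q)^-1)%:E) = (t `^ q <= a^-1)%R.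
  by rewrite lee_fin -[a in LHS]invrK; apply: lef_pV2.
have E : ((a^-1 `^ q^-1) `^ q = a^-1)%R by rewrite -powRrM mulVf ?powRr1 ?gt_eqF// invr_ge0 ltW.
have lt_mono x y : (0 <= x)%R -> (0 <= y)%R -> (x < y)%R -> (x `^ q < y `^ q)%R.
  by move=> x0 y0; apply: gt0_ltr_powR.
set l := (a^-1 `^ q^-1)%R in E *; rewrite -E {E ai a0}; have l0 : (0 <= l)%R by exact: powR_ge0.
have [tl|lt|tl] := ltgtP t l; last by rewrite tl ltxx lexx.
- have h := lt_mono _ _ t0 l0 tl; by rewrite h (ltW h).
- have h := lt_mono _ _ l0 t0 lt; by rewrite ltNge (ltW h) leNgt h.
Qed.

Lemma riesz_profile_gtP (a : R) : (0 < a)%R -> exists2 l : R, (0 < l)%R &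
  forall t, (0 <= t)%R -> (a%:E < riesz_profile p t) = (t < l)%R.
Proof.
move=> /riesz_profile_levels[l l0 H]; exists l => // t t0; by have [] := H t t0.
Qed.

Lemma riesz_profile_gt0 t : (0 <= t)%R -> 0 < riesz_profile p t.
Proof.
move=> t0; rewrite /riesz_profile; case: eqP => [//|/eqP tn0].
by rewrite lte_fin powR_gt0// lt_neqAle eq_sym tn0.
Qed.

Lemma le_riesz_profile t u : (0 <= t)%R -> (t <= u)%R -> riesz_profile p u <= riesz_profile p t.
Proof.
move=> t0 tu; apply: lee_of_lt_fin => a.
have u0 := le_trans t0 tu.
have [a0|a0] := ltP 0%R a; last by move=> _; rewrite (le_trans _ (riesz_profile_ge0 _ _)).
have [l l0 lE] := riesz_profile_gtP a0.
by rewrite lE// => ul; apply/ltW; rewrite lE//; exact: le_lt_trans tu ul.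
Qed.

Lemma measurable_riesz_profile : measurable_fun setT (riesz_profile p).
Proof.
apply: measurable_fun_ifT => //.
- by apply: measurable_fun_eqr.
- by apply/measurable_EFinP; exact: measurable_powR.
Qed.

End riesz_profile.

Section shifted_kernel.
Context {R : realType} {n : nat} (p : R).
Hypothesis p0 : (p < 0)%R.
Local Open Scope ereal_scope.
Implicit Types x y : 'rV[R]_n.

(* The shift r > 0 makes the kernel bounded, and moving x by at most r is
   absorbed by an increase of the shift by r (kern_shift). *)
Definition kern (r : R) x y : \bar R := riesz_profile p (r + enorm (x - y)).

Lemma kern_ge0 r x y : 0 <= kern r x y. Proof. exact: riesz_profile_ge0. Qed.

Lemma kernC r x y : kern r x y = kern r y x.
Proof. by rewrite /kern enormC. Qed.

Lemma le_kern (r r' : R) x y : (0 <= r)%R -> (r <= r')%R -> kern r' x y <= kern r x y.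
Proof.
by move=> r0 rr'; apply: le_riesz_profile => //; rewrite ?lerD2r// addr_ge0// enorm_ge0.
Qed.

Lemma kern_shift (r : R) x x' y : (0 <= r)%R ->
  kern (r + enorm (x - x')) x' y <= kern r x y.
Proof.
move=> r0; apply: le_riesz_profile => //; first by rewrite addr_ge0// enorm_ge0.
by rewrite -addrA lerD2l enorm_dist.
Qed.

Lemma kern_le_profile (r : R) x y : (0 <= r)%R -> kern r x y <= riesz_profile p r.
Proof. by move=> r0; apply: le_riesz_profile => //; rewrite lerDl enorm_ge0. Qed.

Lemma kern_superlevel_open r x (a : R) : (0 <= r)%R -> open [set y | a%:E < kern r x y].
Proof.
move=> r0.
have H y : (0 <= r + enorm (x - y))%R by rewrite addr_ge0// enorm_ge0.
have [a0|a0] := ltP 0%R a; last first.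
  rewrite (_ : [set y | _] = setT); first exact: openT.
  by apply/seteqP; split=> // y _ /=; apply: le_lt_trans (riesz_profile_gt0 _ (H y)).
have [l l0 lE] := riesz_profile_gtP p0 a0.
rewrite openE => y /=; rewrite /kern (lE _ (H y)) => yl.
have e0 : (0 < l - (r + enorm (x - y)))%R by rewrite subr_gt0.
apply: filterS (near_enorm y e0) => z /= yz; rewrite lE//.
by have := enorm_dist x y z; lra.
Qed.

Lemma kern_cvg r x y : (0 <= r)%R ->
  kern (r + j.+1%:R^-1) x y @[j --> \oo] --> kern r x y.
Proof.
move=> r0; have H j : (0 <= r + j.+1%:R^-1 + enorm (x - y))%R.
  by rewrite !addr_ge0// ?enorm_ge0// invr_ge0.
have nd : nondecreasing_seq (fun j => kern (r + j.+1%:R^-1) x y).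
  apply/nondecreasing_seqP => j; apply: le_kern; first by rewrite addr_ge0// invr_ge0.
  by rewrite lerD2l lef_pV2 ?posrE// ler_nat.
rewrite (_ : kern r x y = ereal_sup (range (fun j => kern (r + j.+1%:R^-1) x y))).
  exact: ereal_nondecreasing_cvgn.
apply/eqP; rewrite eq_le; apply/andP; split; last first.
  by apply: ge_ereal_sup => _ [j _ <-]; apply: le_kern => //; rewrite lerDl invr_ge0.
apply: lee_of_lt_fin => a.
have [a0|a0 _] := ltP 0%R a; last first.
  apply: (@le_trans _ _ (kern (r + 0.+1%:R^-1) x y)); first exact: le_trans (riesz_profile_ge0 _ _).
  by apply: ereal_sup_ubound; exists 0%N.
have [l l0 lE] := riesz_profile_gtP p0 a0.
rewrite /kern lE ?addr_ge0// ?enorm_ge0// => rl.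
have e0 : (0 < l - (r + enorm (x - y)))%R by rewrite subr_gt0.
have [j _ /(_ j (leqnn j)) /= jl] := near_infty_natSinv_lt (PosNum e0).
apply: (@le_trans _ _ (kern (r + j.+1%:R^-1) x y)); last by apply: ereal_sup_ubound; exists j.
have {}jl : (j.+1%:R^-1 < l - (r + enorm (x - y)))%R := jl.
by apply/ltW; rewrite /kern lE//; move: jl; set u := (_ ^-1)%R; lra.
Qed.

Lemma kern_nd x y (r : R) : (0 <= r)%R ->
  {homo (fun j => kern (r + j.+1%:R^-1) x y) : i j / (i <= j)%N >-> i <= j}.
Proof.
move=> r0 i j ij; apply: le_kern; first by rewrite addr_ge0// invr_ge0.
by rewrite lerD2l lef_pV2 ?posrE// ler_nat.
Qed.

Lemma measurable_kern d (T : measurableType d) (f g : T -> 'rV[R]_n) (r : R) :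
  (forall i, measurable_fun setT (fun t => f t ord0 i)) ->
  (forall i, measurable_fun setT (fun t => g t ord0 i)) ->
  measurable_fun setT (fun t => kern r (f t) (g t)).
Proof.
move=> mf mg; apply: (measurableT_comp (measurable_riesz_profile p)).
apply: measurable_funD => //; apply: measurable_enorm => i.
under eq_fun do rewrite !mxE.
by apply: measurable_funB.
Qed.

Lemma measurable_kernr r x : measurable_fun [set: borelRV R n] (kern r x).
Proof.
by apply: measurable_kern => i; [exact: measurable_cst|exact: measurable_coord].
Qed.

Lemma measurable_kern_prod r :
  measurable_fun [set: borelRV R n * borelRV R n] (fun z => kern r z.1 z.2).
Proof.
apply: measurable_kern => i; apply: (measurableT_comp (measurable_coord i)).
- exact: measurable_fst.
- exact: measurable_snd.
Qed.

Definition pot (nu : {measure set (borelRV R n) -> \bar R}) (r : R) x : \bar R :=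
  \int[nu]_y kern r x y.

Implicit Types nu : {measure set (borelRV R n) -> \bar R}.

Lemma pot_ge0 nu r x : 0 <= pot nu r x.
Proof. by apply: integral_ge0 => y _; exact: kern_ge0. Qed.

Lemma le_pot_kern nu r r' x x' : (forall y, kern r x y <= kern r' x' y) ->
  pot nu r x <= pot nu r' x'.
Proof.
move=> H; apply: ge0_le_integral => //.
- by move=> y _; exact: kern_ge0.
- exact: measurable_kernr.
- exact: measurable_kernr.
Qed.

Lemma le_pot nu r r' x : (0 <= r)%R -> (r <= r')%R -> pot nu r' x <= pot nu r x.
Proof. by move=> r0 rr'; apply: le_pot_kern => y; exact: le_kern. Qed.

Lemma pot_shift nu (r : R) x x' : (0 <= r)%R -> pot nu (r + enorm (x - x')) x' <= pot nu r x.
Proof. by move=> r0; apply: le_pot_kern => y; exact: kern_shift. Qed.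

Lemma pot_cvg nu r x : (0 <= r)%R ->
  pot nu (r + j.+1%:R^-1) x @[j --> \oo] --> pot nu r x.
Proof.
move=> r0.
have -> : pot nu r x = \int[nu]_y limn (fun j => kern (r + j.+1%:R^-1) x y).
  by apply: eq_integral => y _; apply/esym/cvg_lim => //; exact: kern_cvg.
apply: (@cvg_monotone_convergence _ _ R nu setT measurableT
  (fun j y => kern (r + j.+1%:R^-1) x y)).
- by move=> j; exact: measurable_kernr.
- by move=> j y _; exact: kern_ge0.
- by move=> y _; exact: kern_nd.
Qed.

(** Some additional shift s > 0 still leaves the potential at x above a, and by [pot_shift] that
    shifted value is a lower bound for the unshifted potential at every point within s of x. *)
Lemma pot_superlevel_open nu r (a : R) : (0 <= r)%R -> open [set x | a%:E < pot nu r x].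
Proof.
move=> r0; rewrite openE => x /= ax.
have N : nbhs (pot nu r x) [set y | a%:E < y].
  by apply: open_nbhs_nbhs; split => //; exact: open_ereal_gt_ereal.
have [j _ /(_ j (leqnn j)) /= aj] := @pot_cvg nu r x r0 _ N.
have j0 : (0 < j.+1%:R^-1 :> R)%R by rewrite invr_gt0.
apply: filterS (near_enorm x j0) => y xy; apply: lt_le_trans aj _.
apply: le_trans (@pot_shift nu r y x r0); apply: le_pot; first by rewrite addr_ge0// enorm_ge0.
by rewrite lerD2l enormC ltW.
Qed.

Lemma measurable_pot nu r : (0 <= r)%R -> measurable_fun [set: borelRV R n] (pot nu r).
Proof.
move=> r0; apply: measurable_fun_superlevel => // a; rewrite setTI.
by apply: open_borel; exact: pot_superlevel_open.
Qed.

Definition energy2 (mu nu : {measure set (borelRV R n) -> \bar R}) (r : R) : \bar R :=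
  \int[mu]_x pot nu r x.

Lemma energy2_cvg mu nu r : (0 <= r)%R ->
  energy2 mu nu (r + j.+1%:R^-1) @[j --> \oo] --> energy2 mu nu r.
Proof.
move=> r0; have rj j : (0 <= r + j.+1%:R^-1)%R by rewrite addr_ge0// invr_ge0.
have -> : energy2 mu nu r = \int[mu]_x limn (fun j => pot nu (r + j.+1%:R^-1) x).
  by apply: eq_integral => y _; apply/esym/cvg_lim => //; exact: pot_cvg.
apply: (@cvg_monotone_convergence _ _ R mu setT measurableT
  (fun j x => pot nu (r + j.+1%:R^-1) x)).
- by move=> j; exact: measurable_pot.
- by move=> j y _; exact: pot_ge0.
- move=> x _ i j ij; apply: le_pot => //.
  by rewrite lerD2l lef_pV2 ?posrE// ler_nat.
Qed.

End shifted_kernel.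

Lemma fine_sub_lt {R : realType} (a b : \bar R) (e : R) : a \is a fin_num ->
  ((fine a - e)%:E < b)%E -> (a <= b + e%:E)%E.
Proof.
by case: a => // a _; case: b => [b||]//= h; rewrite ?addye ?leey// lee_fin -lerBlDr ltW.
Qed.

Section weak_liminf.
Context {R : realType} {n : nat} {I : Type} (U : set_system I) {FU : ProperFilter U}.
Variables (m : I -> {measure set (borelRV R n) -> \bar R})
  (lambda : {measure set (borelRV R n) -> \bar R}).
Local Open Scope ereal_scope.
Hypothesis m1 : forall i, m i setT <= 1.
Hypothesis lambda1 : lambda setT <= 1.
Hypothesis weak : forall G : set 'rV[R]_n, open G -> liminf_ge U (lambda G) (fun i => m i G).

Lemma measurable_lsc (f : 'rV[R]_n -> \bar R) :
  (forall t : R, open [set x | t%:E < f x]) -> measurable_fun [set: borelRV R n] f.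
Proof.
move=> of_; apply: measurable_fun_superlevel => // a; rewrite setTI.
by apply: open_borel; exact: of_.
Qed.

Lemma portmanteau_lsc (f : 'rV[R]_n -> \bar R) :
  (forall x, 0 <= f x) -> (forall t : R, open [set x | t%:E < f x]) ->
  liminf_ge U (\int[lambda]_x f x) (fun i => \int[m i]_x f x).
Proof.
move=> f0 of_; have mf := measurable_lsc of_.
apply: (@liminf_integral R _ _ (borelRV R n) (borelRV R n) I U _ lambda m f (fun=> f)) => //.
by move=> t t0; apply: weak.
Qed.

Lemma integral_bounded_fin (mu : {measure set (borelRV R n) -> \bar R}) (f : 'rV[R]_n -> \bar R) (b : R) :
  mu setT <= 1 -> (0 <= b)%R -> (forall x, 0 <= f x <= b%:E) ->
  measurable_fun [set: borelRV R n] f -> \int[mu]_x f x <= b%:E.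
Proof.
move=> mu1 b0 fb mf.
apply: (@le_trans _ _ (\int[mu]_x (cst b%:E x))).
  by apply: ge0_le_integral => // x _; have /andP[] := fb x.
rewrite integral_cst// -[leRHS]mule1; apply: lee_pmul => //.
Qed.

Variable p : R.
Hypothesis p0 : (p < 0)%R.

Lemma pot_bounded (mu : {measure set (borelRV R n) -> \bar R}) (r : R) x :
  mu setT <= 1 -> (0 < r)%R -> pot p mu r x <= (r `^ p)%:E.
Proof.
move=> mu1 r0; apply: integral_bounded_fin => //; first exact: powR_ge0.
- move=> y; rewrite kern_ge0 /=.
  by apply: (le_trans (kern_le_profile p0 _ _ (ltW r0))); rewrite /riesz_profile gt_eqF.
- exact: measurable_kernr.
Qed.

(* By kern_shift, pot (m i) 0 near x is controlled by the value of pot (m i) (r / 2)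
   at x, where the weak limit applies; compactness makes i uniform over K. *)
Lemma near_pot_gt (K : set 'rV[R]_n) (r e : R) : compact K -> (0 < r)%R -> (0 < e)%R ->
  \forall i \near U, forall x, K x -> pot p lambda r x <= pot p (m i) 0 x + e%:E.
Proof.
move=> cK r0 e0; have r20 : (0 < r / 2)%R by rewrite divr_gt0.
have : \forall i \near U, K `<=` (fun x => pot p lambda r x <= pot p (m i) 0 x + e%:E).
  apply: (iffLR (compact_near_coveringP K) cK) => x Kx.
  have fin : pot p lambda (r / 2) x \is a fin_num.
    by rewrite ge0_fin_numE ?pot_ge0// (le_lt_trans (pot_bounded _ lambda1 r20))// ltry.
  have lsc : \forall i \near U, (fine (pot p lambda (r / 2) x) - e)%:E < pot p (m i) (r / 2) x.
    apply: portmanteau_lsc.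
    - by move=> y; exact: kern_ge0.
    - by move=> t; apply: kern_superlevel_open => //; exact: ltW.
    - by rewrite EFinB fineK// lteBlDr// lteDl// lte_fin.
  exists ([set x' | enorm (x - x') < r / 2]%R,
      [set i | (fine (pot p lambda (r / 2) x) - e)%:E < pot p (m i) (r / 2) x]).
    by split => //=; exact: near_enorm.
  move=> [x' i] /= [xx' H].
  apply: (@le_trans _ _ (pot p lambda (r / 2) x)); last first.
    apply: (le_trans (fine_sub_lt fin H)); apply: leeD2r.
    apply: le_trans (@pot_shift _ _ _ p0 (m i) 0%R x' x (lexx _)).
    by apply: le_pot; rewrite ?add0r ?enorm_ge0// enormC ltW.
  apply: le_trans (@pot_shift _ _ _ p0 lambda (r / 2)%R x x' (ltW r20)).
  apply: le_pot => //; first by rewrite addr_ge0// ?enorm_ge0// ltW.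
  by move: xx'; lra.
by move=> H; exact: H.
Qed.

Hypothesis tight : forall e : R, (0 < e)%R -> exists2 K : set 'rV[R]_n, compact K &
  forall i, m i (~` K) <= e%:E.

(** Weak convergence of product measures is avoided. A positive shift makes [pot p lambda r] bounded
    by r^p and lower semicontinuous, so it can be integrated against the weak limit; on a compact K
    its inner measure is then exchanged for [m i] by [near_pot_gt], and off K boundedness and
    tightness suffice. *)
Lemma energy_liminf :
  liminf_ge U (energy2 p lambda lambda 0) (fun i => energy2 p (m i) (m i) 0).
Proof.
move=> s sE.
have N : nbhs (energy2 p lambda lambda 0) [set y | s%:E < y].
  by apply: open_nbhs_nbhs; split => //; exact: open_ereal_gt_ereal.
have [j _ /(_ j (leqnn j)) /= sj] := @energy2_cvg _ _ _ p0 lambda lambda 0%R (lexx _) _ N.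
move: sj; rewrite add0r; set r : R := (_ ^-1)%R => sr.
have r0 : (0 < r)%R by rewrite invr_gt0.
set b : R := (r `^ p)%R.
have b0 : (0 <= b)%R by exact: powR_ge0.
(* One e pays for the exchange of measures on K, the other for the part off K. *)
have [e e0 se] : exists2 e : R, (0 < e)%R & (s + e + e)%:E < energy2 p lambda lambda r.
  case: (energy2 p lambda lambda r) sr => [a|_|//]; last by exists 1%R => //; rewrite ltry.
  rewrite lte_fin => sa; exists ((a - s) / 4)%R; first by rewrite divr_gt0// subr_gt0.
  by rewrite lte_fin; lra.
have [K cK Ke] := tight (divr_gt0 e0 (ltr_pwDr ltr01 b0)).
have L : \forall i \near U, (s + e + e)%:E < \int[m i]_x pot p lambda r x.
  apply: portmanteau_lsc se => [x|t]; first exact: pot_ge0.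
  by apply: pot_superlevel_open => //; exact: ltW.
near=> i.
have H1 : (s + e + e)%:E < \int[m i]_x pot p lambda r x by near: i; exact: L.
have H2 : forall x, K x -> pot p lambda r x <= pot p (m i) 0 x + e%:E.
  by near: i; exact: near_pot_gt.
have mK : measurable (K : set (borelRV R n)) by exact: compact_borel.
have H3 : \int[m i]_x pot p lambda r x <= energy2 p (m i) (m i) 0 + e%:E + e%:E.
  apply: (@le_trans _ _ (\int[m i]_x (pot p (m i) 0 x + (e + b * \1_(~` K) x)%:E))).
    have mI : measurable_fun [set: borelRV R n] (fun x => (e + b * \1_(~` K) x)%:E).
      apply/measurable_EFinP; apply: measurable_funD => //; apply: measurable_funM => //.
      by apply: measurable_indic; exact: measurableC.
    apply: ge0_le_integral => //.
    - by move=> x _; exact: pot_ge0.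
    - by apply: measurable_pot => //; exact: ltW.
    - by apply: emeasurable_funD => //; exact: measurable_pot.
    - move=> x _; have [xK|xK] := pselect (K x).
        apply: (le_trans (H2 x xK)); rewrite leeD2l// lee_fin lerDl.
        by rewrite mulr_ge0.
      apply: (le_trans (pot_bounded x lambda1 r0)).
      rewrite indicE mem_set// mulr1 -[leLHS]add0e leeD ?pot_ge0// lee_fin.
      by rewrite lerDr ltW.
  have mI1 : measurable_fun [set: borelRV R n] (fun x => (\1_(~` K) x)%:E : \bar R).
    by apply/measurable_EFinP/measurable_indic; exact: measurableC.
  have mI : measurable_fun [set: borelRV R n] (fun x => b%:E * (\1_(~` K) x)%:E).
    exact: measurable_funeM.
  rewrite ge0_integralD//; first last.
  - by apply/measurable_EFinP; apply: measurable_funD => //; apply/measurable_EFinP; exact: mI.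
  - by move=> x _; rewrite lee_fin addr_ge0 ?mulr_ge0// ltW.
  - exact: measurable_pot.
  - by move=> x _; exact: pot_ge0.
  rewrite -[leRHS]addeA. apply: leeD; first by rewrite /energy2.
  under eq_integral do rewrite EFinD EFinM.
  rewrite ge0_integralD//; last 2 first.
  - by move=> x _; rewrite lee_fin ltW.
  - by move=> x _; rewrite mule_ge0// lee_fin.
  rewrite integral_cst// ge0_integralZl//.
  rewrite integral_indic ?setIT//; last exact: measurableC.
  apply: leeD.
    by rewrite -[leRHS]mule1; apply: lee_pmul => //; rewrite lee_fin ltW.
  apply: (@le_trans _ _ (b%:E * (e / (b + 1))%:E)); first by apply: lee_pmul.
  rewrite -EFinM lee_fin mulrCA ler_piMr ?(ltW e0)// ler_pdivrMr ?mul1r ?lerDl//.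
  by rewrite ltr_pwDr.
rewrite -(@lteD2rE _ (e + e)%:E)// -EFinD addrA.
by apply: (lt_le_trans H1); rewrite EFinD addeA.
Unshelve. all: by end_near. Qed.

End weak_liminf.

(** * Mutual energies bounded by energies *)

Section product_fibers.
Context {R : realType} {d : measure_display} {T : measurableType d}.
Local Open Scope ereal_scope.
Implicit Types mu nu : {sigma_finite_measure set T -> \bar R}.

Lemma product_fiber_measurable (P Q : T -> nat) :
  (forall j, measurable [set x | P x = j]) -> (forall j, measurable [set x | Q x = j]) ->
  measurable [set z : T * T | P z.1 = Q z.2].
Proof.
move=> mP mQ; rewrite (_ : [set z | _] = \bigcup_j ([set x | P x = j] `*` [set x | Q x = j])).
  by apply: bigcupT_measurable => j; exact: measurableX.
by apply/seteqP; split => [z /= PQ|z [j _ [/= -> ->]]//]; exists (Q z.2).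
Qed.

Lemma product_fiberE mu nu (P Q : T -> nat) :
  (forall j, measurable [set x | P x = j]) -> (forall j, measurable [set x | Q x = j]) ->
  (mu \x nu) [set z : T * T | P z.1 = Q z.2] =
  \sum_(0 <= j <oo) mu [set x | P x = j] * nu [set x | Q x = j].
Proof.
move=> mP mQ; rewrite (_ : [set z | _] = \bigcup_j ([set x | P x = j] `*` [set x | Q x = j])).
  rewrite measure_semi_bigcup.
  - by apply: eq_eseriesr => j _; exact: product_measure1E.
  - by move=> j; exact: measurableX.
  - by apply/trivIsetP => i j _ _ ij; apply/seteqP; split => // z [[Pi _] [Pj _]]; case/eqP: ij; rewrite -Pi -Pj.
  - by apply: bigcupT_measurable => j; exact: measurableX.
by apply/seteqP; split => [z /= PQ|z [j _ [/= -> ->]]//]; exists (Q z.2).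
Qed.

Lemma mule_le_sqr (e : R) (a b : \bar R) : (0 < e)%R -> 0 <= a -> 0 <= b ->
  a * b <= e%:E * (a * a) + e^-1%:E * (b * b).
Proof.
move=> e0; have ei0 : (0 < e^-1)%R by rewrite invr_gt0.
case: a b => [a||] [b||]// a0 b0.
- rewrite -!EFinM -EFinD lee_fin -subr_ge0.
  have -> : (e * (a * a) + e^-1 * (b * b) - a * b =
    ((e * a - b) ^+ 2 + (e * a) ^+ 2 + b ^+ 2) / (2 * e) )%R by field; rewrite lt0r_neq0.
  by apply: divr_ge0; [rewrite !addr_ge0 ?sqr_ge0|rewrite mulr_ge0 ?(ltW e0)].
- by rewrite -!EFinM mulyy (gt0_muley (x := e^-1%:E)) ?lte_fin// addey ?leey.
- by rewrite -!EFinM mulyy (gt0_muley (x := e%:E)) ?lte_fin// addye ?leey.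
- by rewrite mulyy !gt0_muley ?lte_fin.
Qed.

(** Both sides are series over the common fiber index, so the scalar inequality [mule_le_sqr]
    applies term by term. This is the only place where a product of two different measures is
    split. *)
Lemma product_fiber_le (e : R) mu nu (P Q : T -> nat) : (0 < e)%R ->
  (forall j, measurable [set x | P x = j]) -> (forall j, measurable [set x | Q x = j]) ->
  (mu \x nu) [set z : T * T | P z.1 = Q z.2] <=
  e%:E * (mu \x mu) [set z : T * T | P z.1 = P z.2] +
  e^-1%:E * (nu \x nu) [set z : T * T | Q z.1 = Q z.2].
Proof.
move=> e0 mP mQ; rewrite !product_fiberE// -!nneseriesZl; last 2 first.
  by move=> j _; exact: mule_ge0.
  by move=> j _; exact: mule_ge0.
rewrite -nneseriesD; last 2 first.
- by move=> j _ _; rewrite !mule_ge0// lee_fin ltW.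
- by move=> j _ _; rewrite !mule_ge0// lee_fin invr_ge0 ltW.
by apply: lee_nneseries => *; [exact: mule_ge0|exact: mule_le_sqr].
Qed.

End product_fibers.

Section grid.
Context {R : realType} {n : nat}.
Implicit Types x y : 'rV[R]_n.

(* With h = l / (n + 1), two points of one cell are at distance less than l. *)
Definition cell (h : R) x : {ffun 'I_n -> int} := [ffun i => Num.floor (x ord0 i / h)].

(** Shifting before encoding turns the pairs whose cells differ by v into a set {P z.1 = Q z.2} with
    natural-valued P and Q, the form required by [product_fiber_le]. *)
Definition cell_code (h : R) (v : {ffun 'I_n -> int}) x : nat := pickle (cell h x - v).

(* Points at distance less than (n + 1) h lie in cells whose indices differ by at
   most n + 1 in each coordinate. *)
Definition offset (e : {ffun 'I_n -> 'I_(2 * n.+1).+1}) : {ffun 'I_n -> int} :=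
  [ffun i => (e i)%:Z - (n.+1)%:Z].

Lemma measurable_cell h q : measurable [set x : borelRV R n | cell h x = q].
Proof.
rewrite (_ : [set x | _] = \bigcap_(i in [set: 'I_n])
    [set x : borelRV R n | Num.floor ((x : 'rV[R]_n) ord0 i / h) = q i]); last first.
  apply/seteqP; split => [x <- i _ /=|x H]; first by rewrite ffunE.
  by apply/ffunP => i; rewrite ffunE; exact: H.
apply: fin_bigcap_measurable => // i _.
rewrite (_ : [set x | _] = (fun x : borelRV R n => (x : 'rV[R]_n) ord0 i / h) @^-1` `[(q i)%:~R, (q i + 1)%:~R[%classic); last first.
  by apply/seteqP; split => x /=; rewrite in_itv /= -floor_eq => /eqP.
rewrite -[X in measurable X]setTI.
have mf : measurable_fun setT (fun x : borelRV R n => (x : 'rV[R]_n) ord0 i / h).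
  by apply: measurable_funM => //; exact: measurable_coord.
exact: mf.
Qed.

Lemma measurable_cell_code h v j : measurable [set x : borelRV R n | cell_code h v x = j].
Proof.
have [[x0 x0j]|H] := pselect (exists x0, cell_code h v x0 = j).
  rewrite (_ : [set x | _] = [set x : borelRV R n | cell h x = cell h x0]).
    exact: measurable_cell.
  apply/seteqP; split => x /=; rewrite -x0j /cell_code; last by move->.
  by move=> /(pcan_inj pickleK)/addIr.
rewrite (_ : [set x | _] = set0)//.
by apply/seteqP; split => // x xj; apply: H; exists x.
Qed.

(** Each coordinate differs by at most h, and n h^2 < (n + 1)^2 h^2 = l^2. *)
Lemma cell_eq_dist (l : R) x y : 0 < l ->
  cell (l / n.+1%:R) x = cell (l / n.+1%:R) y -> enorm (x - y) < l.
Proof.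
move=> l0 /ffunP E; set h := l / n.+1%:R in E.
have h0 : 0 < h by rewrite divr_gt0.
rewrite -(ltr_pXn2r (_ : 0 < 2)%N) ?nnegrE ?enorm_ge0// ?ltW// sqr_enorm.
apply: (@le_lt_trans _ _ (\sum_(i < n) h ^+ 2)).
  apply: ler_sum => i _; rewrite !mxE.
  have := E i; rewrite !ffunE => Ei.
  have /andP[a1 a2] := floor_itv (x ord0 i / h).
  have /andP[b1 b2] := floor_itv (y ord0 i / h).
  rewrite -Ei in b1 b2; move: a1 a2 b1 b2.
  rewrite ler_pdivlMr// ltr_pdivrMr// ler_pdivlMr// ltr_pdivrMr// intrD mulrDl mul1r.
  move=> a1 a2 b1 b2; rewrite -[leLHS]real_normK ?num_real// ler_pXn2r ?nnegrE ?(ltW h0)//.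
  by rewrite ler_norml; apply/andP; split; lra.
rewrite sumr_const card_ord.
have -> : l ^+ 2 = h ^+ 2 *+ (n.+1 * n.+1)%N.
  by rewrite -mulr_natr natrM /h; field; rewrite ?natr1 ?nat1r pnatr_eq0.
by rewrite ltr_pMn2l ?exprn_gt0// (leq_trans (ltnSn n))// leq_pmulr.
Qed.

Lemma dist_offset (l : R) x y : 0 < l -> enorm (x - y) < l ->
  exists e, cell_code (l / n.+1%:R) (offset e) x = cell_code (l / n.+1%:R) 0 y.
Proof.
move=> l0 xyl; set h := l / n.+1%:R; have h0 : 0 < h by rewrite divr_gt0.
pose D i : int := Num.floor (x ord0 i / h) - Num.floor (y ord0 i / h) + n.+1%:Z.
have DP i : 0 <= D i <= (2 * n.+1)%N%:Z.
  have xyi : `|x ord0 i / h - y ord0 i / h| < n.+1%:R.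
    rewrite -mulrBl normrM [ `|h^-1| ]ger0_norm ?invr_ge0 ?ltW// ltr_pdivrMr//.
    rewrite mulrC /h divfK// (le_lt_trans _ xyl)//.
    by have := le_coord_enorm (x - y) i; rewrite !mxE.
  move: xyi; rewrite ltr_norml => /andP[u v].
  have /andP[a1 a2] := floor_itv (x ord0 i / h).
  have /andP[b1 b2] := floor_itv (y ord0 i / h).
  rewrite /D; set a := Num.floor _ in a1 a2 *; set b := Num.floor _ in b1 b2 *.
  rewrite intrD in a2; rewrite intrD in b2.
  (* The quotients differ by less than n + 1, so their floors differ by less than n + 2, hence by at
     most n + 1. *)
  have c1 : (a - b)%:~R < (n.+2%:Z)%:~R :> R.
    by rewrite intrB -[(n.+2%:Z)%:~R]/(n.+2%:R : R) -[n.+2%:R]natr1; lra.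
  have c2 : (b - a)%:~R < (n.+2%:Z)%:~R :> R.
    by rewrite intrB -[(n.+2%:Z)%:~R]/(n.+2%:R : R) -[n.+2%:R]natr1; lra.
  rewrite ltr_int in c1; rewrite ltr_int in c2.
  lia.
exists [ffun i => inord `|D i|%N].
rewrite /cell_code; congr pickle; rewrite subr0; apply/ffunP => i.
rewrite !ffunE inordK; last by have := DP i; lia.
by have := DP i; rewrite /D; lia.
Qed.

End grid.

Lemma measure_big_setU_le {R : realType} d (T : measurableType d)
    (m : {measure set T -> \bar R}) (J : Type) (s : seq J) (S : J -> set T) :
  (forall j, measurable (S j)) ->
  (m (\big[setU/set0]_(j <- s) S j) <= \sum_(j <- s) m (S j))%E.
Proof.
move=> mS; elim: s => [|j s IH]; first by rewrite !big_nil measure0.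
rewrite !big_cons; apply: (@le_trans _ _ (m (S j) + m (\big[setU/set0]_(j <- s) S j))%E).
  by apply: measureU2 => //; exact: bigsetU_measurable.
exact: leeD2l.
Qed.

Section amgm.
Context {R : realType} {n : nat}.
Local Open Scope ereal_scope.
Implicit Types mu nu : {sigma_finite_measure set (borelRV R n) -> \bar R}.

Definition strip (l : R) : set (borelRV R n * borelRV R n) :=
  [set z | (enorm (z.1 - z.2 : 'rV[R]_n) < l)%R].

Lemma measurable_enorm_sub :
  measurable_fun setT (fun z : borelRV R n * borelRV R n => enorm (z.1 - z.2 : 'rV[R]_n)).
Proof.
apply: measurable_enorm => i; under eq_fun do rewrite !mxE.
apply: measurable_funB; apply: (measurableT_comp (measurable_coord i)).
- exact: measurable_fst.
- exact: measurable_snd.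
Qed.

Lemma measurable_strip l : measurable (strip l).
Proof.
have := measurable_enorm_sub measurableT (measurable_itv `]-oo, l[).
rewrite setTI; congr measurable; apply/seteqP; by split => z /=; rewrite in_itv.
Qed.

Definition grid_size : nat := #|{ffun 'I_n -> 'I_(2 * n.+1).+1}|.

(** Pairs closer than l realise only [grid_size] offsets between cells, and pairs in a common cell
    are again closer than l. That the same l returns on the right is what allows integration over
    the levels of a kernel. *)
Lemma strip_le (e l : R) mu nu : (0 < e)%R -> (0 < l)%R ->
  (mu \x nu) (strip l) <= grid_size%:R%:E *
    (e%:E * (mu \x mu) (strip l) + e^-1%:E * (nu \x nu) (strip l)).
Proof.
move=> e0 l0; set h := (l / n.+1%:R)%R.
pose S (v : {ffun 'I_n -> 'I_(2 * n.+1).+1}) : set (borelRV R n * borelRV R n) :=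
  [set z | cell_code h (offset v) z.1 = cell_code h 0%R z.2].
have mS v : measurable (S v).
  by apply: product_fiber_measurable => j; exact: measurable_cell_code.
(* Equal codes with one and the same shift v mean equal cells, whatever v is. *)
have cell_strip v (m : {measure set (borelRV R n * borelRV R n) -> \bar R}) :
    m [set z | cell_code h v z.1 = cell_code h v z.2] <= m (strip l).
  apply: le_measure; rewrite ?inE; last first.
  - move=> z /= /(pcan_inj pickleK)/addIr; exact: cell_eq_dist.
  - exact: measurable_strip.
  - by apply: product_fiber_measurable => j; exact: measurable_cell_code.
have sub : strip l `<=` \big[setU/set0]_(v <- index_enum _) S v.
  move=> z /(dist_offset l0)[v vE]; rewrite -bigcup_seq/=; exists v => //=.
  by rewrite mem_index_enum.
apply: (@le_trans _ _ ((mu \x nu) (\big[setU/set0]_(v <- index_enum _) S v))).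
  apply: le_measure => //; rewrite inE; first exact: measurable_strip.
  exact: bigsetU_measurable.
apply: (le_trans (measure_big_setU_le _ _ mS)).
apply: (@le_trans _ _ (\sum_(v : {ffun 'I_n -> 'I_(2 * n.+1).+1})
    (e%:E * (mu \x mu) (strip l) + e^-1%:E * (nu \x nu) (strip l)))).
  apply: lee_sum => v _; apply: (le_trans (product_fiber_le mu nu e0 _ _)).
  - by move=> j; exact: measurable_cell_code.
  - by move=> j; exact: measurable_cell_code.
  - apply: leeD; apply: lee_pmul => //; rewrite ?lee_fin ?invr_ge0 ?(ltW e0)//.
    + exact: cell_strip.
    + exact: cell_strip.
by rewrite sumr_const -/grid_size mule_natl.
Qed.

(** The substitute for the Cauchy-Schwarz inequality of a positive definite kernel; all that is
    asked of the kernel is that its superlevel sets are strips. *)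
Lemma integral_amgm (e : R) mu nu (g : borelRV R n * borelRV R n -> \bar R) : (0 < e)%R ->
  measurable_fun setT g -> (forall z, 0 <= g z) ->
  (forall t : R, (0 < t)%R -> exists2 l : R, (0 < l)%R & [set z | t%:E < g z] = strip l) ->
  \int[mu \x nu]_z g z <= grid_size%:R%:E *
    (e%:E * \int[mu \x mu]_z g z + e^-1%:E * \int[nu \x nu]_z g z).
Proof.
move=> e0 mg g0 gl.
have N0 : (0 <= grid_size%:R :> R)%R by [].
pose N := NngNum N0; pose E := NngNum (ltW e0).
have ei0 : (0 <= e^-1)%R by rewrite invr_ge0 ltW.
pose EI := NngNum ei0.
(* The right-hand side becomes the integral of g against a single measure, so that superlevel sets
   can be compared one at a time. *)
pose m' := mscale N (measure_add (mscale E (mu \x mu)) (mscale EI (nu \x nu))).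
have -> : grid_size%:R%:E *
    (e%:E * \int[mu \x mu]_z g z + e^-1%:E * \int[nu \x nu]_z g z) = \int[m']_z g z.
  rewrite ge0_integral_mscale//= ge0_integral_measure_add//=.
  by rewrite !ge0_integral_mscale.
apply: le_integral_superlevel => // t t0; have [l l0 ->] := gl t t0.
apply: (le_trans (strip_le mu nu e0 l0)); rewrite le_eqVlt; apply/orP; left; apply/eqP.
transitivity (grid_size%:R%:E *
  measure_add (mscale E (mu \x mu)) (mscale EI (nu \x nu)) (strip l)) => //.
by rewrite measure_addE.
Qed.

End amgm.

(** * Upper semicontinuity of mutual energies *)

Section integral_mrestr.
Context {R : realType} {d : measure_display} {T : measurableType d}.
Local Open Scope ereal_scope.

Lemma ge0_integral_mrestr (nu : {measure set T -> \bar R}) (D : set T) (mD : measurable D)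
    (f : T -> \bar R) : measurable_fun setT f -> (forall x, 0 <= f x) ->
  \int[mrestr nu mD]_x f x = \int[nu]_(x in D) f x.
Proof.
move=> mf f0; rewrite [RHS]integral_mkcond.
have mfD : measurable_fun setT (f \_ D).
  by apply/(measurable_restrictT _ mD); exact: measurable_funS mf.
have f0D x : 0 <= (f \_ D) x by apply: erestrict_ge0 => y _; exact: f0.
have E t : (0 < t)%R -> mrestr nu mD [set x | t%:E < f x] = nu [set x | t%:E < (f \_ D) x].
  move=> t0; rewrite /mrestr; congr (nu _); apply/seteqP; split => x /=.
    by move=> [tf Dx]; rewrite patchE mem_set.
  rewrite patchE; case: ifPn => [|_]; first by rewrite inE.
  by rewrite lte_fin ltNge (ltW t0).
apply/eqP; rewrite eq_le; apply/andP; split;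
  apply: le_integral_superlevel => // t t0; rewrite le_eqVlt; apply/orP; left; apply/eqP.
- exact: E.
- by apply/esym; exact: E.
Qed.

Lemma ex_sigma_finite_mrestr (nu : {sigma_finite_measure set T -> \bar R}) (D : set T)
    (mD : measurable D) :
  exists nu' : {sigma_finite_measure set T -> \bar R}, nu' = mrestr nu mD :> (set T -> \bar R).
Proof.
have sf : sigma_finite setT (mrestr nu mD).
  have [F F1 F2] := sigma_finiteT nu; exists F => // i; have [mF oF] := F2 i; split => //.
  apply: le_lt_trans oF; apply: le_measure; rewrite ?inE//; exact: measurableI.
pose r : {measure set T -> \bar R} := mrestr nu mD.
pose M := Measure_isSigmaFinite.Build d T R r sf.
pose nu' : {sigma_finite_measure set T -> \bar R} := HB.pack (Measure.sort r) M.
by exists nu'.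
Qed.

End integral_mrestr.

Section lsc_integral.
Context {R : realType} {n : nat} {d : measure_display} {T : measurableType d}.
Local Open Scope ereal_scope.

Lemma le_limn_einf (u : (\bar R)^nat) (a : \bar R) :
  (forall s : R, s%:E < a -> \forall j \near \oo, s%:E <= u j) -> a <= limn_einf u.
Proof.
move=> H; apply: lee_of_lt_fin => s /H[N _ sN].
apply: (@le_trans _ _ (einfs u N)).
  by apply: le_ereal_inf_tmp => _ [j /= Nj <-]; exact: sN.
rewrite limn_einf_lim; apply: lime_ge; first exact: is_cvg_einfs.
by exists N => // j /= Nj; exact: nondecreasing_einfs.
Qed.

Lemma limn_einf_le (u : (\bar R)^nat) (a : \bar R) : (forall j, u j <= a) -> limn_einf u <= a.
Proof.
move=> H; rewrite limn_einf_lim; apply: lime_le; first exact: is_cvg_einfs.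
by apply: nearW => j; apply: le_trans (H j); apply: ereal_inf_lbound; exists j => /=.
Qed.

(** Otherwise some sequence tending to x keeps the integrals at most a, and Fatou's lemma together
    with lower semicontinuity in the first variable forces the integral at x to be at most a. *)
Lemma integral_superlevel_open (nu : {measure set T -> \bar R}) (f : 'rV[R]_n -> T -> \bar R) (a : R) :
  (forall x y, 0 <= f x y) -> (forall x, measurable_fun setT (f x)) ->
  (forall y (t : R), open [set x | t%:E < f x y]) ->
  open [set x | a%:E < \int[nu]_y f x y].
Proof.
move=> f0 mf of_; rewrite openE => x /= ax; apply: contrapT => nx.
have H (j : nat) : exists x', ball x (j.+1%:R^-1)%R x' /\ \int[nu]_y f x' y <= a%:E.
  apply: contrapT => h; apply: nx; apply/nbhs_ballP.
  exists (j.+1%:R^-1)%R => /=; first by rewrite invr_gt0.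
  by move=> x' xx'; rewrite /= ltNge; apply/negP => h'; apply: h; exists x'.
have [X XP] := choice H.
have cX : X j @[j --> \oo] --> x.
  apply/cvg_ballP => e e0; near=> j; apply: le_ball (proj1 (XP j)).
  by apply: ltW; near: j; exact: (near_infty_natSinv_lt (PosNum e0)).
have := fatou nu measurableT (fun j => mf (X j)) (fun j y _ => f0 (X j) y).
apply/negP; rewrite -ltNge; apply: (@le_lt_trans _ _ a%:E).
  by apply: limn_einf_le => j; have [] := XP j.
apply: (lt_le_trans ax); apply: ge0_le_integral => //.
  rewrite (_ : (fun y => _) = (fun y => - limn_esup (fun j => - f (X j) y))).
    apply: measurableT_comp => //; apply: measurable_fun_limn_esup => j.
    by apply: measurableT_comp.
  apply/funext => y; rewrite -limn_einfN; congr limn_einf; apply/funext => j /=.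
  by rewrite oppeK.
move=> y _; apply: le_limn_einf => s sf.
have : \forall x' \near x, s%:E < f x' y.
  by apply: open_nbhs_nbhs; split; [exact: of_|].
move=> /cX h; have {}h : \forall j \near \oo, s%:E < f (X j) y by exact: h.
by apply: filterS h => j; exact: ltW.
Unshelve. all: by end_near. Qed.

End lsc_integral.

(** * Truncated kernels and potentials of finite measures *)

Section truncated_kernel.
Context {R : realType} {n : nat} (p : R).
Hypothesis p0 : (p < 0)%R.
Local Open Scope ereal_scope.
Implicit Types x y : 'rV[R]_n.

(** The kernel is continuous with values in (0, +oo], so the truncation and its complement to M are
    both nonnegative and lower semicontinuous. An upper estimate for one is a lower estimate for the
    other. *)
Definition tkern (M : R) x y : \bar R := mine (kern p 0 x y) M%:E.
Definition cokern (M : R) x y : \bar R := M%:E - tkern M x y.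

Variable M : R.
Hypothesis M0 : (0 <= M)%R.

Lemma tkern_ge0 x y : 0 <= tkern M x y.
Proof. by rewrite /tkern le_min kern_ge0 lee_fin. Qed.

Lemma tkern_le x y : tkern M x y <= M%:E.
Proof. by rewrite /tkern ge_min lexx orbT. Qed.

Lemma tkern_fin x y : tkern M x y \is a fin_num.
Proof. by rewrite ge0_fin_numE ?tkern_ge0// (le_lt_trans (tkern_le x y))// ltry. Qed.

Lemma tkernC x y : tkern M x y = tkern M y x.
Proof. by rewrite /tkern kernC. Qed.

Lemma cokern_ge0 x y : 0 <= cokern M x y.
Proof. by rewrite /cokern sube_ge0 ?tkern_le// tkern_fin. Qed.

Lemma tkernDcokern x y : tkern M x y + cokern M x y = M%:E.
Proof. by rewrite /cokern addeC subeK// tkern_fin. Qed.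

Lemma tkern_superlevel_open x (t : R) : open [set y | t%:E < tkern M x y].
Proof.
rewrite (_ : [set y | _] = [set y | t%:E < kern p 0 x y] `&` [set y | (t < M)%R]).
  apply: openI; first exact: kern_superlevel_open.
  have [tM|tM] := ltP t M.
    by rewrite (_ : [set _ | _] = setT); [exact: openT|apply/seteqP; split].
  rewrite (_ : [set _ | _] = set0); first exact: open0.
  by apply/seteqP; split => // y /=; rewrite ltNge tM.
apply/seteqP; split => y /=; rewrite /tkern lt_min lte_fin.
  by move=> /andP[].
by move=> [-> ->].
Qed.

Lemma cokern_superlevel_open x (t : R) : open [set y | t%:E < cokern M x y].
Proof.
have [t0|t0] := ltP t 0%R.
  rewrite (_ : [set y | _] = setT); first exact: openT.
  apply/seteqP; split => // y _; rewrite /=.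
  by apply: (@lt_le_trans _ _ 0); [rewrite lte_fin|exact: cokern_ge0].
have E y : (t%:E < cokern M x y) = (kern p 0 x y < (M - t)%:E).
  rewrite /cokern lteBrDr ?tkern_fin// addeC -lteBrDr// -EFinB /tkern gt_min.
  have -> : (M%:E < (M - t)%:E) = false by rewrite lte_fin; apply/negbTE; rewrite -leNgt; lra.
  by rewrite orbF.
under eq_set do rewrite E.
have [b0|b0] := ltP 0%R (M - t)%R; last first.
  rewrite (_ : [set y | _] = set0); first exact: open0.
  apply/seteqP; split => // y /=; rewrite ltNge => /negP; apply.
  by apply: (@le_trans _ _ 0); [rewrite lee_fin|exact: kern_ge0].
have [l l0 H] := riesz_profile_levels p0 b0.
rewrite openE => y; rewrite /= /kern add0r ltNge (proj2 (H _ (enorm_ge0 _))) -ltNge => ly.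
have e0 : (0 < enorm (x - y) - l)%R by rewrite subr_gt0.
apply: filterS (near_enorm y e0) => z /= yz.
rewrite add0r ltNge (proj2 (H _ (enorm_ge0 _))) -ltNge.
by have := enorm_dist x z y; rewrite (enormC z y); lra.
Qed.

Lemma measurable_tkern x : measurable_fun [set: borelRV R n] (tkern M x).
Proof. by apply: measurable_lsc => t; exact: tkern_superlevel_open. Qed.

Lemma measurable_cokern x : measurable_fun [set: borelRV R n] (cokern M x).
Proof. by apply: measurable_lsc => t; exact: cokern_superlevel_open. Qed.

Variable nu : {measure set (borelRV R n) -> \bar R}.
Hypothesis nu_fin : nu setT < +oo.

Definition tpot x : \bar R := \int[nu]_y tkern M x y.
Definition copot x : \bar R := \int[nu]_y cokern M x y.

Lemma tpot_ge0 x : 0 <= tpot x.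
Proof. by apply: integral_ge0 => y _; exact: tkern_ge0. Qed.

Lemma copot_ge0 x : 0 <= copot x.
Proof. by apply: integral_ge0 => y _; exact: cokern_ge0. Qed.

Lemma tpotDcopot x : tpot x + copot x = M%:E * nu setT.
Proof.
rewrite -integral_cst//= -ge0_integralD//.
- by apply: eq_integral => y _; exact: tkernDcokern.
- by move=> y _; exact: tkern_ge0.
- exact: measurable_tkern.
- by move=> y _; exact: cokern_ge0.
- exact: measurable_cokern.
Qed.

Lemma tpot_superlevel_open (t : R) : open [set x | t%:E < tpot x].
Proof.
apply: (@integral_superlevel_open R n _ (borelRV R n)).
- by move=> x y; exact: tkern_ge0.
- exact: measurable_tkern.
- by move=> y s; under eq_set do rewrite tkernC; exact: tkern_superlevel_open.
Qed.

Lemma copot_superlevel_open (t : R) : open [set x | t%:E < copot x].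
Proof.
apply: (@integral_superlevel_open R n _ (borelRV R n)).
- by move=> x y; exact: cokern_ge0.
- exact: measurable_cokern.
- move=> y s; under eq_set do rewrite /cokern tkernC; exact: cokern_superlevel_open.
Qed.

Lemma integral_tpotDcopot (mu : {measure set (borelRV R n) -> \bar R}) : mu setT = 1 ->
  \int[mu]_x tpot x + \int[mu]_x copot x = M%:E * nu setT.
Proof.
move=> mu1; rewrite -[RHS]mule1 -mu1 -integral_cst//= -ge0_integralD//.
- by apply: eq_integral => y _; exact: tpotDcopot.
- by move=> y _; exact: tpot_ge0.
- by apply: measurable_lsc => t; exact: tpot_superlevel_open.
- by move=> y _; exact: copot_ge0.
- by apply: measurable_lsc => t; exact: copot_superlevel_open.
Qed.

(** For every measure of mass 1 the integrals of [tpot] and [copot] add up to the same number M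
    nu(R^n); the claim is therefore lower semicontinuity for [copot]. Preservation of mass in the
    limit is essential here. *)
Lemma tpot_limsup {I : Type} (U : set_system I) {FU : ProperFilter U}
    (m : I -> {measure set (borelRV R n) -> \bar R})
    (lambda : {measure set (borelRV R n) -> \bar R}) (a : R) :
  (forall i, m i setT = 1) -> lambda setT = 1 ->
  (forall G : set 'rV[R]_n, open G -> liminf_ge U (lambda G) (fun i => m i G)) ->
  \int[lambda]_x tpot x < a%:E -> \forall i \near U, \int[m i]_x tpot x < a%:E.
Proof.
move=> m1 l1 weak la.
have [b bE] : exists b : R, M%:E * nu setT = b%:E.
  exists (fine (M%:E * nu setT)); rewrite fineK//.
  rewrite ge0_fin_numE ?mule_ge0//; apply: lte_mul_pinfty => //; exact: nu_fin.
have H (mu : {measure set (borelRV R n) -> \bar R}) : mu setT = 1 -> (\int[mu]_x tpot x < a%:E) = ((b - a)%:E < \int[mu]_x copot x).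
  move=> /integral_tpotDcopot; rewrite bE.
  have : 0 <= \int[mu]_x tpot x by apply: integral_ge0 => x _; exact: tpot_ge0.
  have : 0 <= \int[mu]_x copot x by apply: integral_ge0 => x _; exact: copot_ge0.
  move: (\int[mu]_x tpot x) (\int[mu]_x copot x) => [u||] [v||]//= _ _.
  rewrite -EFinD => -[uv]; rewrite !lte_fin -uv; apply/idP/idP; lra.
rewrite H// in la.
have : \forall i \near U, (b - a)%:E < \int[m i]_x copot x.
  apply: portmanteau_lsc la => //; first exact: copot_ge0.
  exact: copot_superlevel_open.
by apply: filterS => i; rewrite H.
Qed.

End truncated_kernel.

(** Dominated convergence with f itself as the bound. Points where f = +oo may stay in all S j, but
    they form a null set. *)
Lemma cvg_integral_patch0 {R : realType} d (T : measurableType d)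
    (m : {measure set T -> \bar R}) (f : T -> \bar R) (S : (set T)^nat) :
  measurable_fun setT f -> (forall x, 0 <= f x)%E -> (\int[m]_x f x < +oo)%E ->
  (forall j, measurable (S j)) ->
  (forall x, (f x < +oo)%E -> \forall j \near \oo, ~ S j x) ->
  (\int[m]_x (f \_ (S j)) x)%E @[j --> \oo] --> 0%E.
Proof.
move=> mf f0 If mS fS.
have intf : m.-integrable setT f.
  by apply/integrableP; split => //; under eq_integral do rewrite gee0_abs//.
have mfS j : measurable_fun setT (f \_ (S j)).
  by apply/(measurable_restrictT _ (mS j)); exact: measurable_funS mf.
have [] := @dominated_convergence _ T R m setT measurableT (fun j => f \_ (S j)) (cst 0%E) f mfS.
- exact: measurable_cst.
- have := integrable_ae measurableT intf; apply: filterS => x /(_ I) fx _.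
  have : \forall j \near \oo, (f \_ (S j)) x = 0%E.
    have := fS x; rewrite -ge0_fin_numE// => /(_ fx); apply: filterS => j Sj.
    by rewrite patchE memNset.
  move=> h; apply: cvg_near_cst; exact: h.
- exact: intf.
- apply: aeW => x j _; rewrite patchE; case: ifPn => _; first by rewrite gee0_abs.
  by rewrite abse0.
- by move=> _ _; rewrite integral0.
Qed.

Section cross_energy.
Context {R : realType} {n : nat} (p : R).
Hypothesis p0 : (p < 0)%R.
Local Open Scope ereal_scope.
Implicit Types mu nu : {sigma_finite_measure set (borelRV R n) -> \bar R}.

Definition kernz (z : borelRV R n * borelRV R n) : \bar R := kern p 0 z.1 z.2.

Lemma measurable_kernz : measurable_fun setT kernz.
Proof. exact: measurable_kern_prod. Qed.

Lemma kernz_ge0 z : 0 <= kernz z. Proof. exact: kern_ge0. Qed.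

(* The kernel where it exceeds M: unlike kern - M, it is again a function whose
   superlevel sets are strips. *)
Definition kappa (M : R) : borelRV R n * borelRV R n -> \bar R :=
  kernz \_ [set z | M%:E < kernz z].

Lemma measurable_kappa M : measurable_fun setT (kappa M).
Proof.
have mS := measurable_superlevel M%:E measurable_kernz.
by apply/(measurable_restrictT _ mS); exact: measurable_funS measurable_kernz.
Qed.

Lemma kappa_ge0 M z : 0 <= kappa M z.
Proof. by apply: erestrict_ge0 => y _; exact: kernz_ge0. Qed.

Lemma kernz_superlevel (t : R) : (0 < t)%R ->
  exists2 l : R, (0 < l)%R & [set z | t%:E < kernz z] = strip l.
Proof.
move=> t0; have [l l0 H] := riesz_profile_gtP p0 t0; exists l => //.
by apply/seteqP; split => z; rewrite /strip /kernz /kern/= add0r H// enorm_ge0.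
Qed.

Lemma kappa_superlevel (M t : R) : (0 < t)%R ->
  exists2 l : R, (0 < l)%R & [set z | t%:E < kappa M z] = strip l.
Proof.
move=> t0; have : (0 < Num.max t M)%R by rewrite lt_max t0.
move=> /kernz_superlevel[l l0 lE]; exists l => //; rewrite -lE.
apply/seteqP; split => z; rewrite /= /kappa patchE EFin_max gt_max.
  case: ifPn => [|_]; first by rewrite inE /= => -> ->.
  by move=> /lt_trans /(_ _); have := t0; rewrite -lte_fin => h /(_ _ h); rewrite ltxx.
by move=> /andP[tz Mz]; rewrite mem_set.
Qed.

Lemma kernz_le x y M : (0 <= M)%R -> kernz (x, y) <= tkern p M x y + kappa M (x, y).
Proof.
move=> M0; rewrite /kappa patchE; case: ifPn => [_|]; first by rewrite leeDr// tkern_ge0.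
rewrite notin_setE /= => /negP; rewrite -leNgt => h.
by rewrite adde0 /tkern le_min lexx.
Qed.

Lemma energy2E mu nu : energy2 p mu nu 0 = \int[mu \x nu]_z kernz z.
Proof.
rewrite fubini_tonelli1//; first exact: measurable_kernz.
exact: kernz_ge0.
Qed.

Lemma energy2_ge0 (mu nu : {measure set (borelRV R n) -> \bar R}) r : 0 <= energy2 p mu nu r.
Proof. by apply: integral_ge0 => x _; exact: pot_ge0. Qed.

Lemma energy2_amgm (e : R) mu nu : (0 < e)%R ->
  energy2 p mu nu 0 <= (@grid_size n)%:R%:E *
    (e%:E * energy2 p mu mu 0 + e^-1%:E * energy2 p nu nu 0).
Proof.
move=> e0; rewrite !energy2E; apply: integral_amgm => //.
- exact: measurable_kernz.
- exact: kernz_ge0.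
- exact: kernz_superlevel.
Qed.

(** On the side of mu the full energy is kept, being bounded along the sequence in question; only
    the side of nu has to become small as M grows. *)
Lemma kappa_amgm (e M : R) mu nu : (0 < e)%R ->
  \int[mu \x nu]_z kappa M z <= (@grid_size n)%:R%:E *
    (e%:E * energy2 p mu mu 0 + e^-1%:E * \int[nu \x nu]_z kappa M z).
Proof.
move=> e0; apply: (le_trans (@integral_amgm R n e mu nu (kappa M) e0 _ _ _)).
- exact: measurable_kappa.
- exact: kappa_ge0.
- exact: kappa_superlevel.
- apply: lee_pmul => //.
    apply: adde_ge0; apply: mule_ge0; rewrite ?lee_fin ?invr_ge0 ?(ltW e0)//.
    - by apply: integral_ge0 => z _; exact: kappa_ge0.
    - by apply: integral_ge0 => z _; exact: kappa_ge0.
  apply: leeD2r; apply: lee_pmul => //.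
  - by rewrite lee_fin ltW.
  - by apply: integral_ge0 => z _; exact: kappa_ge0.
  rewrite energy2E; apply: ge0_le_integral => //.
  - by move=> z _; exact: kappa_ge0.
  - exact: measurable_kappa.
  - exact: measurable_kernz.
  - move=> z _; rewrite /kappa patchE; case: ifPn => // _; exact: kernz_ge0.
Qed.

End cross_energy.

Section cross_limsup.
Context {R : realType} {n : nat} (p : R).
Hypothesis p0 : (p < 0)%R.
Local Open Scope ereal_scope.
Implicit Types mu nu : {sigma_finite_measure set (borelRV R n) -> \bar R}.

Definition eball (r : R) : set 'rV[R]_n := [set y | (enorm y <= r)%R].

Lemma eball_compact r : compact (eball r).
Proof.
have := @enorm_ball_compact R n 0 r; congr compact.
by apply/seteqP; split => y /=; rewrite /eball /= sub0r enormN.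
Qed.

Lemma measurable_eball r : measurable (eball r : set (borelRV R n)).
Proof. by apply: compact_borel; exact: eball_compact. Qed.

Lemma energy2_mrestr_le nu (D : set (borelRV R n)) (mD : measurable D) :
  energy2 p (mrestr nu mD) (mrestr nu mD) 0 <=
  \int[nu \x nu]_z ((kernz p) \_ (D `*` D)) z.
Proof.
have mDD : measurable (D `*` D) by exact: measurableX.
have mk : measurable_fun setT ((kernz p) \_ (D `*` D)).
  by apply/(measurable_restrictT _ mDD); apply: measurable_funS (measurable_kernz p).
have k0 z : 0 <= ((kernz p) \_ (D `*` D)) z.
  by apply: erestrict_ge0 => y _; exact: kernz_ge0.
rewrite fubini_tonelli1// /energy2 ge0_integral_mrestr; first last.
- by move=> x; exact: pot_ge0.
- exact: measurable_pot.
rewrite integral_mkcond; apply: ge0_le_integral => //.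
- by move=> x _; apply: erestrict_ge0 => y _; exact: pot_ge0.
- by apply/(measurable_restrictT _ mD); apply: measurable_funS (measurable_pot p0 _ (lexx _)).
- exact: measurable_fun_fubini_tonelli_F.
move=> x _; rewrite patchE; case: ifPn => [|_]; last by apply: integral_ge0 => y _; exact: k0.
rewrite inE => Dx; rewrite /pot ge0_integral_mrestr; first last.
- by move=> y; exact: kern_ge0.
- exact: measurable_kernr.
rewrite integral_mkcond le_eqVlt; apply/orP; left; apply/eqP; apply: eq_integral => y _.
rewrite !patchE /kernz /=; congr (if _ then _ else _).
by apply/idP/idP; rewrite !inE => // -[].
Qed.

Lemma eq_pot (mu mu' : {measure set (borelRV R n) -> \bar R}) r x :
  mu = mu' :> (set (borelRV R n) -> \bar R) -> pot p mu r x = pot p mu' r x.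
Proof. by rewrite /pot => ->. Qed.

Lemma eq_energy2 (mu mu' nu nu' : {measure set (borelRV R n) -> \bar R}) r :
  mu = mu' :> (set (borelRV R n) -> \bar R) -> nu = nu' :> (set (borelRV R n) -> \bar R) ->
  energy2 p mu nu r = energy2 p mu' nu' r.
Proof. by rewrite /energy2 /pot => -> ->. Qed.

(** A truncated kernel on a ball, the large values of the kernel, and the full kernel off the ball.
    The first has upper limits under weak convergence, the other two are small uniformly by
    [kappa_amgm] and [energy2_amgm]. *)
Lemma pot_split_le nu (M r : R) x : (0 <= M)%R ->
  pot p nu 0 x <= tpot p M (mrestr nu (measurable_eball r)) x +
    fubini_F nu (kappa p M) x +
    pot p (mrestr nu (measurableC (measurable_eball r))) 0 x.
Proof.
move=> M0.
have mk : measurable_fun [set: borelRV R n] (kern p 0 x) by exact: measurable_kernr.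
have mkap : measurable_fun [set: borelRV R n] (fun y => kappa p M (x, y)).
  have := @measurable_fun_pair2 _ _ _ (borelRV R n) (borelRV R n) _ 
    (kappa p M) x (measurable_kappa p M); exact.
have mtk : measurable_fun [set: borelRV R n] (tkern p M x) by exact: measurable_tkern.
have k0 y : 0 <= kern p 0 x y by exact: kern_ge0.
have t0 y : 0 <= tkern p M x y by exact: tkern_ge0.
have kap0 y : 0 <= kappa p M (x, y) by exact: kappa_ge0.
rewrite /pot (ge0_integral_mrestr _ _ mk)// -(setUv (eball r)) ge0_integral_setU//; last 3 first.
- by apply: measurableC; exact: measurable_eball.
- by rewrite setUv.
- by rewrite /disj_set setICr.
apply: leeD2r; rewrite /tpot (ge0_integral_mrestr _ _ mtk)//.
have mB := measurable_eball r.
apply: (@le_trans _ _ (\int[nu]_(y in eball r) (tkern p M x y + kappa p M (x, y)))).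
  apply: ge0_le_integral => //.
  - exact: measurable_funS mk.
  - by apply: emeasurable_funD; [exact: measurable_funS mtk|exact: measurable_funS mkap].
  - by move=> y _; exact: kernz_le.
have mtkB : measurable_fun (eball r : set (borelRV R n)) (tkern p M x) by exact: measurable_funS mtk.
have mkapB : measurable_fun (eball r : set (borelRV R n)) (fun y => kappa p M (x, y)).
  exact: measurable_funS mkap.
rewrite ge0_integralD//; last by move=> y _; exact: kap0.
by apply: leeD2l; apply: ge0_subset_integral => // y _; exact: kap0.
exact: measurable_eball.
Qed.

Lemma cross_limsup {I : Type} (U : set_system I) {FU : ProperFilter U}
    (m : I -> {sigma_finite_measure set (borelRV R n) -> \bar R})
    (lambda : {measure set (borelRV R n) -> \bar R}) nu (C a : R) :
  (forall i, m i setT = 1) -> lambda setT = 1 ->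
  (forall G : set 'rV[R]_n, open G -> liminf_ge U (lambda G) (fun i => m i G)) ->
  (forall i, energy2 p (m i) (m i) 0 <= C%:E) ->
  (forall K : set 'rV[R]_n, compact K -> nu K < +oo) ->
  energy2 p nu nu 0 < +oo ->
  energy2 p lambda nu 0 < a%:E -> \forall i \near U, energy2 p (m i) nu 0 < a%:E.
Proof.
move=> m1 l1 weak mC nuK nuE.
have := energy2_ge0 p lambda nu 0.
case E : (energy2 p lambda nu 0) => [c||]//; rewrite lee_fin lte_fin => c0 ca.
set N : R := (@grid_size n)%:R; have N0 : (0 <= N)%R by [].
(* The truncated part loses one eps and each of the two error terms two: c + 5 eps < c + 6 eps =
   a. *)
pose eps := ((a - c) / 6)%R; have eps0 : (0 < eps)%R by rewrite divr_gt0// subr_gt0.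
(* Energies are nonnegative, so C can be negative only if there is no index at all. *)
have C0 : (0 <= C \/ forall i : I, False)%R.
  have [C0|C0] := leP 0%R C; [by left|right => i].
  by have := le_trans (energy2_ge0 p (m i) (m i) 0) (mC i); rewrite lee_fin leNgt C0.
case: C0 => [C0|C0]; last by apply: (@nearW _ U) => i; case: (C0 i).
have NC0 : (0 < N * C + 1)%R by rewrite ltr_wpDl// mulr_ge0.
(* First e makes the energies of [m i] contribute at most eps; then [dl], which depends on e, does
   the same for the part of nu, whose weight is 1/e. *)
pose e := (eps / (N * C + 1))%R; have e0 : (0 < e)%R by rewrite divr_gt0.
have NeC : (N * (e * C) <= eps)%R.
  rewrite mulrCA /e mulrAC ler_pdivrMr// ler_wpM2l ?(ltW eps0)//; lra.
pose dl := (eps * e / (N + 1))%R; have N1 : (0 < N + 1)%R by rewrite ltr_wpDl.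
have dl0 : (0 < dl)%R by apply: divr_gt0 => //; exact: mulr_gt0.
have Ned : (N * (e^-1 * dl) <= eps)%R.
  have -> : (N * (e^-1 * dl) = eps * (N / (N + 1)))%R.
    by rewrite /dl; field; rewrite !lt0r_neq0.
  by rewrite ler_piMr ?(ltW eps0)// ler_pdivrMr ?mul1r ?lerDl.
have err (X Y : \bar R) : 0 <= X -> 0 <= Y -> X <= C%:E -> Y <= dl%:E ->
    N%:E * (e%:E * X + e^-1%:E * Y) <= (eps + eps)%:E.
  move=> X0 Y0 XC Yd.
  apply: (@le_trans _ _ (N%:E * (e%:E * C%:E + e^-1%:E * dl%:E))).
    apply: lee_pmul => //.
      by apply: adde_ge0; apply: mule_ge0; rewrite // lee_fin ?invr_ge0 ltW.
    by apply: leeD; apply: lee_pmul; rewrite // lee_fin ?invr_ge0 ltW.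
  by rewrite -(EFinM e C) -(EFinM e^-1 dl) -EFinD -EFinM lee_fin mulrDr lerD.
(* One family serves both error terms: large values of the kernel, and pairs with both points off
   the ball, since the restriction of nu to that complement is paired with itself. Each pair with a
   finite kernel leaves S j eventually. *)
pose S (j : nat) : set (borelRV R n * borelRV R n) :=
  [set z | j%:R%:E < kernz p z] `|` (~` eball j%:R : set (borelRV R n)) `*` (~` eball j%:R : set (borelRV R n)).
have mS1 j : measurable [set z | j%:R%:E < kernz p z].
  exact: measurable_superlevel (measurable_kernz p).
have mB j : measurable (~` eball j%:R : set (borelRV R n)) by apply: measurableC; exact: measurable_eball.
have mS2 j : measurable ((~` eball j%:R : set (borelRV R n)) `*` (~` eball j%:R : set (borelRV R n))) by exact: measurableX.
have mS j : measurable (S j) by exact: measurableU.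
have Scvg : \int[nu \x nu]_z ((kernz p) \_ (S j)) z @[j --> \oo] --> 0.
  apply: cvg_integral_patch0 => //.
  - exact: measurable_kernz.
  - exact: kernz_ge0.
  - by rewrite -energy2E.
  - move=> z zoo.
    have zf : kernz p z \is a fin_num by rewrite ge0_fin_numE// kernz_ge0.
    near=> j; move=> [/=|[/= h _]].
      apply/negP; rewrite -leNgt -(fineK zf) lee_fin ltW//.
      near: j; exact: nbhs_infty_gtr.
    apply: h; rewrite /eball /= ltW//; near: j; exact: nbhs_infty_gtr.
have [j jd] : exists j, \int[nu \x nu]_z ((kernz p) \_ (S j)) z <= dl%:E.
  have Nb : nbhs (0 : \bar R) [set y | y < dl%:E].
    by apply: open_nbhs_nbhs; split; [exact: open_ereal_lt_ereal|rewrite /= lte_fin].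
  by have [j _ /(_ j (leqnn j)) /= /ltW jd] := Scvg _ Nb; exists j.
set M : R := j%:R in jd; have M0 : (0 <= M)%R by [].
have kapS : \int[nu \x nu]_z kappa p M z <= dl%:E.
  apply: le_trans jd; apply: ge0_le_integral => //.
  - by move=> z _; exact: kappa_ge0.
  - exact: measurable_kappa.
  - by apply/(measurable_restrictT _ (mS j)); apply: measurable_funS (measurable_kernz p).
  - move=> z _; rewrite /kappa patchE; case: ifPn => [|_].
      by rewrite inE /= => zM; rewrite patchE mem_set//; left.
    by apply: erestrict_ge0 => y _; exact: kernz_ge0.
have mBc := measurableC (measurable_eball M).
have tailS : energy2 p (mrestr nu mBc) (mrestr nu mBc) 0 <= dl%:E.
  apply: le_trans (energy2_mrestr_le _ _) _; apply: le_trans jd; apply: ge0_le_integral => //.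
  - by move=> z _; apply: erestrict_ge0 => y _; exact: kernz_ge0.
  - by apply/(measurable_restrictT _ (mS2 j)); apply: measurable_funS (measurable_kernz p).
  - by apply/(measurable_restrictT _ (mS j)); apply: measurable_funS (measurable_kernz p).
  - move=> z _; rewrite patchE; case: ifPn => [|_].
      by rewrite inE /= => zM; rewrite patchE mem_set//; right.
    by apply: erestrict_ge0 => y _; exact: kernz_ge0.
have fin1 : mrestr nu (measurable_eball M) setT < +oo.
  by rewrite /mrestr setTI; apply: nuK; exact: eball_compact.
have tl : \int[lambda]_x tpot p M (mrestr nu (measurable_eball M)) x < (c + eps)%:E.
  apply: (@le_lt_trans _ _ (energy2 p lambda nu 0)); last by rewrite E lte_fin ltrDl.
  apply: ge0_le_integral => //.
  - by move=> x _; exact: tpot_ge0.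
  - by apply: measurable_lsc => t; exact: tpot_superlevel_open.
  - exact: measurable_pot.
  - move=> x _; rewrite /tpot ge0_integral_mrestr; first last.
    + by move=> y; exact: tkern_ge0.
    + exact: measurable_tkern.
    apply: (@le_trans _ _ (\int[nu]_(y in eball M) kern p 0 x y)).
      apply: ge0_le_integral => //.
      * exact: measurable_eball.
      * by move=> y _; exact: tkern_ge0.
      * have mt : measurable_fun [set: borelRV R n] (tkern p M x) by exact: measurable_tkern.
        exact: measurable_funS mt.
      * have mk : measurable_fun [set: borelRV R n] (kern p 0 x) by exact: measurable_kernr.
        exact: measurable_funS mk.
      * by move=> y _; rewrite /tkern ge_min lexx.
    apply: ge0_subset_integral => //.
    + exact: measurable_eball.
    + exact: measurable_kernr.
    + by move=> y _; exact: kern_ge0.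
have [nu2 nu2E] := ex_sigma_finite_mrestr nu mBc.
have pot2 x : pot p (mrestr nu mBc) 0 x = pot p nu2 0 x by exact/esym/eq_pot.
have tail2 : energy2 p nu2 nu2 0 <= dl%:E.
  by rewrite (eq_energy2 0 nu2E nu2E).
near=> i.
have ti : \int[m i]_x tpot p M (mrestr nu (measurable_eball M)) x < (c + eps)%:E.
  by near: i; apply: (@tpot_limsup R n p p0 M M0 (mrestr nu (measurable_eball M)) fin1 I U _ (fun i => m i) lambda).
apply: (@le_lt_trans _ _ (\int[m i]_x tpot p M (mrestr nu (measurable_eball M)) x +
    \int[m i]_x fubini_F nu (kappa p M) x + energy2 p (m i) nu2 0)).
  have f0 x : 0 <= fubini_F nu (kappa p M) x by apply: integral_ge0 => y _; exact: kappa_ge0.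
  have mf : measurable_fun setT (fubini_F nu (kappa p M)).
    by apply: measurable_fun_fubini_tonelli_F; [exact: measurable_kappa|exact: kappa_ge0].
  have mt : measurable_fun [set: borelRV R n] (tpot p M (mrestr nu (measurable_eball M))).
    by apply: measurable_lsc => t; exact: tpot_superlevel_open.
  have mp : measurable_fun [set: borelRV R n] (pot p nu2 0) by exact: measurable_pot.
  have t0 x : 0 <= tpot p M (mrestr nu (measurable_eball M)) x by exact: tpot_ge0.
  have p0' x : 0 <= pot p nu2 0 x by exact: pot_ge0.
  rewrite -ge0_integralD// /energy2 -ge0_integralD//; last 2 first.
  - by move=> x _; exact: adde_ge0.
  - exact: emeasurable_funD.
  apply: ge0_le_integral => //.
  - by move=> x _; exact: pot_ge0.
  - exact: measurable_pot.
  - by apply: emeasurable_funD => //; exact: emeasurable_funD.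
  - by move=> x _; rewrite -pot2; exact: pot_split_le.
have k1 : \int[m i]_x fubini_F nu (kappa p M) x <= (eps + eps)%:E.
  rewrite -fubini_tonelli1; [|exact: measurable_kappa|exact: kappa_ge0].
  apply: (le_trans (kappa_amgm p0 M (m i) nu e0)); apply: err => //.
  - exact: energy2_ge0.
  - by apply: integral_ge0 => z _; exact: kappa_ge0.
have k2 : energy2 p (m i) nu2 0 <= (eps + eps)%:E.
  by apply: (le_trans (energy2_amgm p0 (m i) nu2 e0)); apply: err => //; exact: energy2_ge0.
apply: (@le_lt_trans _ _ ((c + eps)%:E + (eps + eps)%:E + (eps + eps)%:E)).
  by apply: leeD => //; apply: leeD => //; exact: ltW.
by rewrite -!EFinD lte_fin /eps; lra.
Unshelve. all: by end_near. Qed.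

End cross_limsup.

(** * Measures of finite energy carried by A *)

Lemma measure_sigma_finite {R : realType} d (T : measurableType d) (m : {measure set T -> \bar R}) :
  sigma_finite setT m ->
  exists m' : {sigma_finite_measure set T -> \bar R}, m' = m :> (set T -> \bar R).
Proof.
move=> sf; pose r : {measure set T -> \bar R} := mrestr m measurableT.
have rE : r = m :> (set T -> \bar R) by apply/funext => B; rewrite /= /mrestr setIT.
have sr : sigma_finite setT r by rewrite rE.
pose S := Measure_isSigmaFinite.Build d T R r sr.
pose m' : {sigma_finite_measure set T -> \bar R} := HB.pack (Measure.sort r) S.
by exists m'.
Qed.

Section admissible_measures.
Context {R : realType} {n : nat} (alpha : R).
Hypothesis alpha_ltn : (alpha < n%:R)%R.
Local Open Scope ereal_scope.
Local Notation p := (alpha - n%:R)%R.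
Local Notation M := {measure set (borelRV R n) -> \bar R}.

Let p0 : (p < 0)%R. Proof. by rewrite subr_lt0. Qed.

Lemma radon_sigma_finite (nu : M) :
  (forall K : set 'rV[R]_n, compact K -> nu K < +oo) ->
  exists nu' : {sigma_finite_measure set (borelRV R n) -> \bar R},
    nu' = nu :> (set (borelRV R n) -> \bar R).
Proof.
move=> nuK; have sf : sigma_finite setT nu.
  exists (fun j : nat => eball j%:R).
    apply/esym/seteqP; split => // x _; exists (Num.Def.trunc (enorm (x : 'rV[R]_n))).+1 => //.
    by rewrite /eball /=; apply/ltW/Num.Theory.truncnS_gt.
  move=> j; split; first exact: measurable_eball.
  by apply: nuK; exact: eball_compact.
exact: measure_sigma_finite.
Qed.

Lemma riesz_kernelE (x y : 'rV[R]_n) : riesz_kernel alpha x y = kern p 0 x y.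
Proof.
by rewrite /riesz_kernel /kern /riesz_profile add0r enorm_eq0 subr_eq0.
Qed.

Lemma mutual_energyE (m1 m2 : M) : mutual_energy alpha m1 m2 = energy2 p m1 m2 0.
Proof.
apply: eq_integral => x _; apply: eq_integral => y _; exact: riesz_kernelE.
Qed.

Lemma potentialE (mu : signed_radon R n) x :
  potential alpha mu x = pot p (rpos mu) 0 x - pot p (rneg mu) 0 x.
Proof.
by rewrite /potential /sintegral /pot; congr (_ - _); apply: eq_integral => y _;
  exact: riesz_kernelE.
Qed.

(** The class [unitE alpha A] read on the positive part; [unitE_rpos] and [unitE_pos_radon] are the
    two translations. *)
Definition admissible (A : set 'rV[R]_n) (m : M) : Prop :=
  [/\ m setT = 1, energy2 p m m 0 < +oo & m.-negligible (~` A)].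

Section positive.
Variable mu : signed_radon R n.
Hypothesis neg0 : rneg mu setT = 0.

Lemma rneg_eq0 D : measurable D -> rneg mu D = 0.
Proof.
move=> mD; apply/eqP; rewrite eq_le measure_ge0 andbT -neg0.
by apply: le_measure; rewrite ?inE.
Qed.

Lemma integral_rneg D (f : borelRV R n -> \bar R) : \int[rneg mu]_(x in D) f x = 0.
Proof.
rewrite (eq_measure_integral (mzero : M)); first exact: integral_measure_zero.
by move=> B mB _; rewrite rneg_eq0.
Qed.

Lemma tvar_rpos D : measurable D -> tvar mu D = rpos mu D.
Proof.
move=> mD; transitivity (measure_add (rpos mu) (rneg mu) D) => //.
by rewrite measure_addE rneg_eq0// adde0.
Qed.

Lemma sintegral_pos D f : sintegral mu D f = \int[rpos mu]_(x in D) f x.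
Proof. by rewrite /sintegral integral_rneg sube0. Qed.

Lemma mass_pos : mass mu = rpos mu setT.
Proof. by rewrite /mass neg0 sube0. Qed.

Lemma energy_pos : energy alpha mu = energy2 p (rpos mu) (rpos mu) 0.
Proof.
have Z (m : M) : mutual_energy alpha (rneg mu) m = 0 by exact: integral_rneg.
have Z' (m : M) : mutual_energy alpha m (rneg mu) = 0.
  by rewrite /mutual_energy; under eq_integral do rewrite integral_rneg; exact: integral0.
by rewrite /energy !Z !Z' !adde0 sube0 mutual_energyE.
Qed.

Lemma integrable_pos D f : measurable D ->
  (tvar mu).-integrable D f <-> (rpos mu).-integrable D f.
Proof.
move=> mD; split=> /integrableP[mf fi]; apply/integrableP; split => //.
  rewrite (eq_measure_integral (tvar mu))// => B mB _; by rewrite tvar_rpos.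
by rewrite (eq_measure_integral (rpos mu))// => B mB _; rewrite tvar_rpos.
Qed.

Lemma negligible_pos B : (tvar mu).-negligible B <-> (rpos mu).-negligible B.
Proof.
split=> -[C [mC C0 BC]]; exists C; split => //; first by rewrite -tvar_rpos.
by rewrite tvar_rpos.
Qed.

End positive.

Lemma unitE_rpos A mu : unitE alpha A mu -> rneg mu setT = 0 /\ admissible A (rpos mu).
Proof.
move=> [[[_ eE] [_ neg0] cA] m1]; split => //; split.
- by rewrite -mass_pos.
- by move: eE; rewrite energy_pos// ge0_fin_numE ?energy2_ge0.
- exact/negligible_pos.
Qed.

Section pos_radon.
Variable m : M.
Hypothesis m_fin : m setT < +oo.

Let m_compact (K : set 'rV[R]_n) : compact K -> m K < +oo.
Proof.
move=> cK; apply: le_lt_trans m_fin; apply: le_measure; rewrite ?inE//.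
exact: compact_borel.
Qed.

Let m_singular : exists P : set (borelRV R n),
  [/\ measurable P, m (~` P) = 0 & (mzero : M) P = 0].
Proof. by exists setT; split => //; rewrite setCT measure0. Qed.

Definition pos_radon : signed_radon R n :=
  @SignedRadon R n m (mzero : M) m_compact (fun K _ => ltry 0%R) m_singular.

End pos_radon.

Lemma unitE_pos_radon A (m : M) (m_fin : m setT < +oo) : admissible A m ->
  unitE alpha A (pos_radon m_fin).
Proof.
move=> [m1 mE mA]; have neg0 : rneg (pos_radon m_fin) setT = 0 by [].
have sM : spaceM alpha (pos_radon m_fin).
  rewrite /spaceM /= (eq_measure_integral m); last first.
    by move=> B mB _; exact: (tvar_rpos neg0).
  have mD : measurable [set y : borelRV R n | (1 < enorm (y : 'rV[R]_n))%R].
    rewrite (_ : [set y | _] = ~` eball 1); first by apply: measurableC; exact: measurable_eball.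
    by apply/seteqP; split => y /=; rewrite /eball /= ltNge => /negP.
  have mf : measurable_fun [set: borelRV R n] (fun y => (enorm (y : 'rV[R]_n) `^ p)%:E).
    apply/measurable_EFinP; apply: (measurableT_comp (measurable_powR _)).
    by apply: measurable_enorm => i; exact: measurable_coord.
  (* As |y| > 1 and p < 0, the integrand of the growth condition is at most 1. *)
  apply: le_lt_trans (ltry 1%R).
  apply: (@le_trans _ _ (\int[m]_(x in [set y : borelRV R n | (1 < enorm (y : 'rV[R]_n))%R]) cst 1 x)).
    apply: ge0_le_integral => //.
    - by move=> x _; rewrite lee_fin powR_ge0.
    - exact: measurable_funS mf.
    - move=> x /= x1; rewrite lee_fin.
      have := @le_riesz_profile R p p0 1%R (enorm (x : 'rV[R]_n)) ler01 (ltW x1).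
      by rewrite /riesz_profile gt_eqF ?(lt_trans ltr01)// gt_eqF// lee_fin powR1.
  rewrite integral_cst// mul1e -m1; apply: le_measure; rewrite ?inE//.
split; last by rewrite mass_pos.
split; [split => // | by [] |exact/negligible_pos].
by rewrite energy_pos// ge0_fin_numE ?energy2_ge0.
Qed.

(** The normalised restriction of m to D. It supplies the competitor in the capacity estimate and,
    later, a measure against which the field is integrable. *)
Lemma admissible_restrict A (m : M) (D : set (borelRV R n)) (mD : measurable D) :
  admissible A m -> 0 < m D ->
  exists m' : M, [/\ admissible A m', m' (~` D) = 0 &
    energy2 p m' m' 0 <= ((fine (m D) ^+ 2)^-1)%:E * energy2 p m m 0].
Proof.
move=> [m1 mE mA] D0.
have Dfin : m D \is a fin_num.
  by rewrite ge0_fin_numE// (le_lt_trans _ (ltry 1%R))// -m1; apply: le_measure; rewrite ?inE.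
set t := fine (m D); have t0 : (0 < t)%R by rewrite fine_gt0// D0 -ge0_fin_numE.
have ti0 : (0 <= t^-1)%R by rewrite invr_ge0 ltW.
pose c := NngNum ti0.
pose m' : M := mscale c (mrestr m mD).
have m'E B : m' B = t^-1%:E * m (B `&` D) by [].
have EE : energy2 p m' m' 0 <= ((t ^+ 2)^-1)%:E * energy2 p m m 0.
  have Hpot x : pot p m' 0 x <= t^-1%:E * pot p m 0 x.
    rewrite {1}/pot ge0_integral_mscale//=; [|exact: measurable_kernr|by move=> y _; exact: kern_ge0].
    apply: lee_pmul => //; first by apply: integral_ge0 => y _; exact: kern_ge0.
    rewrite ge0_integral_mrestr; [|exact: measurable_kernr|by move=> y; exact: kern_ge0].
    apply: ge0_subset_integral => //; first exact: measurable_kernr.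
    by move=> y _; exact: kern_ge0.
  have mp : measurable_fun [set: borelRV R n] (pot p m 0) by exact: measurable_pot.
  rewrite {1}/energy2 ge0_integral_mscale//=; [|exact: measurable_pot|by move=> y _; exact: pot_ge0].
  rewrite ge0_integral_mrestr; [|exact: measurable_pot|by move=> y; exact: pot_ge0].
  apply: (@le_trans _ _ (t^-1%:E * \int[m]_x (t^-1%:E * pot p m 0 x))).
    apply: lee_pmul => //; first by apply: integral_ge0 => y _; exact: pot_ge0.
    apply: (@le_trans _ _ (\int[m]_x pot p m' 0 x)).
      apply: ge0_subset_integral => //; first exact: measurable_pot.
      by move=> y _; exact: pot_ge0.
    apply: ge0_le_integral => //.
    - by move=> y _; exact: pot_ge0.
    - exact: measurable_pot.
    - exact: measurable_funeM.
  rewrite ge0_integralZl//; last by move=> y _; exact: pot_ge0.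
  by rewrite muleA -EFinM -expr2 exprVn.
exists m'; split => //.
- split.
  + by rewrite m'E setTI -(fineK Dfin) -EFinM mulVf// gt_eqF.
  + apply: le_lt_trans EE _; apply: lte_mul_pinfty => //.
    by rewrite lee_fin invr_ge0 sqr_ge0.
  + have [C [mC C0 AC]] := mA; exists C; split => //.
    rewrite m'E (_ : m (C `&` D) = 0) ?mule0//.
    apply/eqP; rewrite eq_le measure_ge0 andbT -C0; apply: le_measure; rewrite ?inE//.
    exact: measurableI.
- by rewrite m'E setICl measure0 mule0.
Qed.

End admissible_measures.

(** * Capacity, tightness, and limits carried by A *)

Section capacity_bounds.
Context {R : realType} {n : nat} (alpha : R).
Hypothesis alpha_ltn : (alpha < n%:R)%R.
Local Open Scope ereal_scope.
Local Notation p := (alpha - n%:R)%R.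
Local Notation M := {measure set (borelRV R n) -> \bar R}.

(** If m(G) > 0, the normalised restriction of m to G competes in the capacity of G, and its energy
    is at most I(m) / m(G)^2. *)
Lemma measure_sqr_le_cap (A G : set 'rV[R]_n) (m : M) (C d : R) :
  open G -> admissible alpha A m -> energy2 p m m 0 <= C%:E ->
  inner_cap alpha G < d%:E -> (fine (m G) ^+ 2 <= d * C)%R.
Proof.
move=> oG mA mC capG; have mG := open_borel oG.
have [m1 mE _] := mA.
have C0 : (0 <= C)%R by rewrite -lee_fin (le_trans (energy2_ge0 p m m 0)).
rewrite /inner_cap in capG; move: capG; set I := ereal_inf _ => capG.
have I0 : 0 <= I.
  apply: le_ereal_inf_tmp => _ [mu /(unitE_rpos)[neg0 _] <-].
  by rewrite energy_pos// energy2_ge0.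
have [d0 Id] : (0 < d)%R /\ (I < +oo -> (d^-1)%:E < I).
  move: capG I0; move: I => [r||]//.
  rewrite lee_fin => + r0; rewrite inver; case: eqP => [->|/eqP rn0]; first by rewrite ltNge leey.
    have rp : (0 < r)%R by rewrite lt_neqAle eq_sym rn0.
    rewrite !lte_fin => rd; have dp : (0 < d)%R by rewrite (lt_trans _ rd)// invr_gt0.
    by split => // _; rewrite -[ltRHS]invrK ltf_pV2// posrE invr_gt0.
have [->|Gn0] := eqVneq (m G) 0; first by rewrite /= expr0n /= mulr_ge0// ltW.
have G0 : 0 < m G by rewrite lt_neqAle eq_sym Gn0 measure_ge0.
have [m' [[m'1 m'E _] m'G m'le]] := admissible_restrict alpha_ltn mG mA G0.
have m'A : admissible alpha G m' by split => //; exists (~` G); split => //; exact: measurableC.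
have m'fin : m' setT < +oo by rewrite m'1 ltry.
have Ile : I <= energy2 p m' m' 0.
  apply: ereal_inf_lbound; exists (pos_radon m'fin); first exact: unitE_pos_radon.
  by rewrite energy_pos.
have Gf : m G \is a fin_num.
  by rewrite ge0_fin_numE// (le_lt_trans _ (ltry 1%R))// -m1; apply: le_measure; rewrite ?inE.
have t0 : (0 < fine (m G))%R by rewrite fine_gt0// G0 -ge0_fin_numE.
have : (d^-1)%:E <= ((fine (m G) ^+ 2)^-1 * C)%:E.
  apply: le_trans (ltW (Id _)) _; first exact: le_lt_trans Ile m'E.
  apply: (le_trans Ile); apply: (le_trans m'le); rewrite EFinM; apply: lee_pmul => //.
  exact: energy2_ge0.
rewrite lee_fin => h.
have t2 : (0 < fine (m G) ^+ 2)%R by rewrite exprn_gt0.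
by move: h; rewrite mulrC ler_pdivlMr// mulrC ler_pdivrMr// mulrC.
Qed.

Lemma quasicompact_approx (A : set 'rV[R]_n) (d : R) : quasicompact alpha A -> (0 < d)%R ->
  exists K G : set 'rV[R]_n, [/\ compact K, open G, A `+` K `<=` G & inner_cap alpha G < d%:E].
Proof.
move=> qA d0.
have /ereal_inf_lt[_ [K cK <-]] : ereal_inf
   [set outer_cap alpha (A `+` K) | K in [set K | compact K]] < d%:E by rewrite qA lte_fin.
by move=> /ereal_inf_lt[_ [G [oG AKG] <-] Gd]; exists K, G.
Qed.

(* Off the cover G of the symmetric difference, A and the compact K coincide. *)
Lemma quasicompact_tight (A : set 'rV[R]_n) (C e : R) : quasicompact alpha A -> (0 < e)%R ->
  exists K G : set 'rV[R]_n, [/\ compact K, open G, ~` A `<=` ~` K `|` G &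
    forall m : M, admissible alpha A m -> energy2 p m m 0 <= C%:E ->
      m G <= e%:E /\ m (~` K) <= e%:E].
Proof.
move=> qA e0.
have C1 : (0 < `|C| + 1)%R by rewrite ltr_wpDl.
(* This bound d on the capacity gives m(G)^2 <= d C <= e^2, with no assumption on the sign of C. *)
have d0 : (0 < e ^+ 2 / (`|C| + 1))%R by rewrite divr_gt0// exprn_gt0.
have [K [G [cK oG AKG Gd]]] := quasicompact_approx qA d0.
exists K, G; split => //.
  move=> x Ax; have [Kx|Kx] := pselect (K x); last by left.
  by right; apply: AKG; right.
move=> m mA mC; have [m1 _ mAn] := mA.
have mG := open_borel oG; have mK := compact_borel cK.
have fin B : measurable B -> m B \is a fin_num.
  by move=> mB; rewrite ge0_fin_numE// (le_lt_trans _ (ltry 1%R))// -m1; apply: le_measure; rewrite ?inE.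
have Ge : m G <= e%:E.
  have := measure_sqr_le_cap oG mA mC Gd => h.
  rewrite -(fineK (fin _ mG)) lee_fin.
  rewrite -(ler_pXn2r (_ : 0 < 2)%N) ?nnegrE ?fine_ge0 ?(ltW e0)//.
  apply: (le_trans h); rewrite mulrAC ler_pdivrMr// ler_wpM2l ?sqr_ge0//.
  by rewrite (le_trans (ler_norm _))// lerDl.
split => //; apply: le_trans Ge.
have [B [mB B0 AB]] := mAn.
apply: (@le_trans _ _ (m (B `|` G))).
  apply: le_measure; rewrite ?inE; [exact: measurableC|exact: measurableU|].
  move=> x Kx; have [Ax|Ax] := pselect (A x); last by left; exact: AB.
  by right; apply: AKG; left.
by apply: (le_trans (measureU2 _ _ _)) => //; rewrite [X in X + _]B0 add0e.
Qed.

End capacity_bounds.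

Section admissible_limit.
Context {R : realType} {n : nat} (alpha : R).
Hypothesis alpha_ltn : (alpha < n%:R)%R.
Local Open Scope ereal_scope.
Local Notation p := (alpha - n%:R)%R.
Local Notation M := {measure set (borelRV R n) -> \bar R}.

Let p0 : (p < 0)%R. Proof. by rewrite subr_lt0. Qed.

(** [quasicompact_tight] is used twice: its compact sets keep the total mass equal to 1 in the
    limit, and its open sets around the complement of A keep the limit on A, although A need not be
    closed. *)
Lemma ex_admissible_limit (A : set 'rV[R]_n) (m : nat -> M) (C : R) :
  quasicompact alpha A -> (forall k, admissible alpha A (m k)) ->
  (forall k, energy2 p (m k) (m k) 0 <= C%:E) ->
  exists (U : set_system nat) (l : M), [/\ UltraFilter U, \oo `<=` U, admissible alpha A l,
    (forall G : set 'rV[R]_n, open G -> liminf_ge U (l G) (fun k => m k G)) &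
    liminf_ge U (energy2 p l l 0) (fun k => energy2 p (m k) (m k) 0)].
Proof.
move=> qA mA mC.
(* U refines the filter at infinity, so whatever holds for all large k holds along U. *)
have [U [UU ooU]] := @ultraFilterLemma nat \oo _.
have PU : ProperFilter U by exact: ultra_proper.
have m1 k : m k setT = 1 by have [] := mA k.
have m1' k : m k setT <= 1 by rewrite m1.
have [l [weak l1 lK]] := ex_weak_limit m1' (U := U).
have tight e : (0 < e)%R -> exists2 K : set 'rV[R]_n, compact K & forall k, m k (~` K) <= e%:E.
  move=> e0; have [K [G [cK _ _ H]]] := quasicompact_tight alpha_ltn C qA e0.
  by exists K => // k; have [] := H (m k) (mA k) (mC k).
have lT : l setT = 1.
  apply/eqP; rewrite eq_le l1 /=; apply/lee_subgt0Pr => e e0.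
  have [K cK Ke] := tight e e0; rewrite -EFinB; apply: (lK K) => //.
  apply: (@nearW _ U) => k.
  have mK := compact_borel cK.
  have E : m k K + m k (~` K) = 1.
    by rewrite -measureU//; [rewrite setUv; exact: m1|exact: measurableC|rewrite setICr].
  rewrite EFinB leeBlDr// -E; apply: leeD2l; exact: Ke.
have le_weak (G : set 'rV[R]_n) (e : R) : open G -> (forall k, m k G <= e%:E) -> l G <= e%:E.
  move=> oG H; rewrite leNgt; apply/negP => /(weak G oG e) /filter_ex[k].
  by rewrite ltNge H.
have Elim : liminf_ge U (energy2 p l l 0) (fun k => energy2 p (m k) (m k) 0).
  by apply: energy_liminf => //; rewrite lT.
exists U, l; split => //; split => //.
  apply: (@le_lt_trans _ _ C%:E); last exact: ltry.
  by rewrite leNgt; apply/negP => /(Elim C) /filter_ex[k]; rewrite ltNge mC.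
(* Each B is open with uniformly small mass under all [m k], hence under l; the intersection over j
   is a null set containing the complement of A. *)
have H (j : nat) : exists B : set 'rV[R]_n, [/\ measurable (B : set (borelRV R n)), ~` A `<=` B &
    l B <= (j.+1%:R^-1)%:E].
  have e0 : (0 < j.+1%:R^-1 / 2 :> R)%R by rewrite divr_gt0// invr_gt0.
  have [K [G [cK oG AKG KG]]] := quasicompact_tight alpha_ltn C qA e0.
  have oK : open (~` K) by rewrite openC; apply: compact_closed => //; exact: norm_hausdorff.
  have mG := open_borel oG; have mK := open_borel oK.
  exists (~` K `|` G); split => //; first exact: measurableU.
  apply: (le_trans (measureU2 _ mK mG)).
  rewrite [X in X%:E](splitr j.+1%:R^-1) EFinD; apply: leeD; apply: le_weak => // k.
    by have [] := KG (m k) (mA k) (mC k).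
  by have [] := KG (m k) (mA k) (mC k).
have [B BP] := choice H.
have mB : measurable (\bigcap_j (B j : set (borelRV R n))).
  by apply: bigcapT_measurable => j; have [] := BP j.
exists (\bigcap_j B j); split => //; last by move=> x Ax j _; have [_ + _] := BP j; apply.
apply/eqP; rewrite eq_le measure_ge0 andbT; apply/lee_addgt0Pr => e e0; rewrite add0e.
have [j _ /(_ j (leqnn j)) /= je] := near_infty_natSinv_lt (PosNum e0).
have [mBj _ lBj] := BP j.
apply: (@le_trans _ _ (l (B j))).
  by apply: le_measure; rewrite ?inE//; exact: bigcap_inf.
by apply: (le_trans lBj); rewrite lee_fin; exact: ltW.
Qed.

End admissible_limit.

(** * The external field *)

Section lsc_extension.
Context {R : realType} {n : nat}.
Local Open Scope ereal_scope.

Lemma lower_semicontinuous_within (F : set 'rV[R]_n) (psi : 'rV[R]_n -> \bar R) (x : 'rV[R]_n) (a : R) :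
  lower_semicontinuous (psi : subspace F -> \bar R) -> F x -> a%:E < psi x ->
  \forall y \near x, F y -> a%:E < psi y.
Proof.
move=> lsc Fx /(lsc x a)[V xV Va].
have : within F (nbhs x) V by rewrite (nbhs_subspace_in Fx).
by rewrite /within /=; apply: filterS => y /[apply] /Va.
Qed.

Lemma classPhi_lower_bound (F : set 'rV[R]_n) (psi : 'rV[R]_n -> \bar R) :
  classPhi F psi -> exists2 c : R, (0 <= c)%R & forall x, F x -> (- c)%:E <= psi x.
Proof.
move=> [lsc psiNy psi0]; have [cF|/psi0 {}psi0] := pselect (compact F); last first.
  by exists 0%R => // x Fx; rewrite oppr0 psi0.
have : \forall N \near \oo, F `<=` (fun x => F x -> (- (N%:R : R))%:E < psi x).
  apply: (iffLR (compact_near_coveringP F) cF) => x Fx.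
  have [a ax] : exists a : R, a%:E < psi x.
    case E : (psi x) (psiNy x Fx) => [b||]// _; last by exists 0%R; rewrite ltry.
    by exists (b - 1)%R; rewrite lte_fin ltrBlDr ltrDl.
  exists ([set y | F y -> a%:E < psi y], [set N | (- a <= N%:R)%R]).
    split; first exact: lower_semicontinuous_within.
    exact: nbhs_infty_ger.
  move=> [y N]/= [ya aN] Fy; apply: le_lt_trans (ya Fy).
  by rewrite lee_fin lerNl.
case=> N _ /(_ N (leqnn N)) FN; exists N%:R => // x Fx; exact/ltW/FN.
Qed.

(** Add to psi a constant that makes it nonnegative, and put +oo off F. As F is closed, g is lower
    semicontinuous on the whole space; its values off F do not matter for measures carried by F. *)
Lemma ex_lsc_extension (F : set 'rV[R]_n) (psi : 'rV[R]_n -> \bar R) :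
  closed F -> classPhi F psi ->
  exists (c : R) (g : 'rV[R]_n -> \bar R), [/\ forall x, 0 <= g x,
    forall t : R, open [set x | t%:E < g x],
    forall x, F x -> psi x = g x - c%:E & forall x, ~ F x -> g x = +oo].
Proof.
move=> clF psiP; have [c c0 psic] := classPhi_lower_bound psiP.
have [lsc psiNy _] := psiP.
exists c, (patch (cst +oo) F (fun x => psi x + c%:E)); split.
- move=> x; rewrite /patch; case: ifPn => [|_]; last by rewrite leey.
  by rewrite inE => /psic; rewrite EFinN; case: (psi x) => [b||]//=; rewrite ?leey// !lee_fin; lra.
- move=> t; rewrite openE => x; rewrite /= /patch; case: ifPn => [|] xF h.
    rewrite inE in xF.
    have {}h : (t - c)%:E < psi x.
      by move: h; case: (psi x) => [b||]//=; rewrite ?ltry// !lte_fin; lra.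
    apply: filterS (lower_semicontinuous_within lsc xF h) => y yF /=.
    rewrite /patch; case: ifPn => [|_]; last by rewrite ltry.
    rewrite inE => /yF; case: (psi y) => [b||]//=; rewrite ?ltry// !lte_fin; lra.
  have oF : open (~` F) by rewrite openC.
  rewrite notin_setE in xF.
  apply: filterS (open_nbhs_nbhs (conj oF xF)) => y yF /=.
  by rewrite /patch memNset// ltry.
- move=> x Fx; rewrite /patch mem_set// addeK//.
- by move=> x Fx; rewrite /patch memNset.
Qed.

End lsc_extension.

(** * Measures at positive distance *)

Section distant_measures.
Context {R : realType} {n : nat} (p : R).
Hypothesis p0 : (p < 0)%R.
Local Open Scope ereal_scope.
Local Notation M := {measure set (borelRV R n) -> \bar R}.

Lemma open_enorm_ball (x : 'rV[R]_n) (d : R) : open [set y | (enorm (x - y) < d)%R].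
Proof.
rewrite openE => y /= xy; have e0 : (0 < d - enorm (x - y))%R by rewrite subr_gt0.
apply: filterS (near_enorm y e0) => z /= yz.
by have := enorm_dist x y z; lra.
Qed.

(** A locally null open ball is null: it is a countable union of compact balls, and each of these is
    covered by finitely many null open sets. *)
Lemma null_ball (nu : M) x (d : R) :
  (forall y, (enorm (x - y) < d)%R ->
    exists V : set 'rV[R]_n, [/\ open V, V y & nu V = 0]) ->
  nu [set y : borelRV R n | (enorm (x - y : 'rV[R]_n) < d)%R] = 0.
Proof.
move=> H; have nullK (K : set 'rV[R]_n) : compact K -> (forall y, K y -> (enorm (x - y) < d)%R) -> nu K = 0.
  move=> cK Kd.
  have H' y : exists V : set 'rV[R]_n, (enorm (x - y) < d)%R -> [/\ open V, V y & nu V = 0].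
    have [/H[V VP]|yd] := pselect (enorm (x - y) < d)%R; first by exists V.
    by exists set0 => /yd.
  have [V VP] := choice H'.
  have mK : measurable (K : set (borelRV R n)) by exact: compact_borel.
  move: cK; rewrite compact_cover => /(_ _ K V) [|y Ky|D DK KD].
  - by move=> y Ky; have [] := VP y (Kd y Ky).
  - by exists y => //; have [] := VP y (Kd y Ky).
  pose s := finmap.enum_fset D.
  have Dd y : y \in s -> (enorm (x - y) < d)%R by move=> /DK; rewrite inE => /Kd.
  pose W y : set (borelRV R n) := if (enorm (x - y) < d)%R then V y else set0.
  have mW y : measurable (W y).
    by rewrite /W; case: ifPn => // yd; have [oV _ _] := VP y yd; exact: open_borel.
  have W0 y : nu (W y) = 0.
    by rewrite /W; case: ifPn => [yd|_]; [have [] := VP y yd|exact: measure0].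
  apply/eqP; rewrite eq_le measure_ge0 andbT.
  apply: (@le_trans _ _ (nu (\big[setU/set0]_(y <- s) W y))).
    apply: le_measure; rewrite ?inE.
    - exact: mK.
    - exact: bigsetU_measurable.
    - by move=> z /KD[y /= yD Vyz]; rewrite -bigcup_seq/=; exists y => //=; rewrite /W Dd.
  apply: (le_trans (measure_big_setU_le nu s mW)).
  by rewrite big1// => y _; exact: W0.
have E : [set y : borelRV R n | (enorm (x - y : 'rV[R]_n) < d)%R] =
    \bigcup_(j : nat) [set y : borelRV R n | (enorm (x - y : 'rV[R]_n) <= d - j.+1%:R^-1)%R].
  apply/seteqP; split => y /=.
    move=> xyd; have e0 : (0 < d - enorm (x - y : 'rV[R]_n))%R by rewrite subr_gt0.
    have [j _ /(_ j (leqnn j)) /= je] := near_infty_natSinv_lt (PosNum e0).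
    by exists j => //=; move: je => /= /ltW; rewrite lerBrDr lerBrDl addrC.
  move=> [j _ /=] /le_lt_trans; apply; by rewrite ltrBlDr ltrDl invr_gt0.
have cB (j : nat) : compact [set y : 'rV[R]_n | (enorm (x - y) <= d - j.+1%:R^-1)%R].
  exact: enorm_ball_compact.
rewrite E; apply/eqP; rewrite eq_le measure_ge0 andbT.
apply: (le_trans (measure_sigma_subadditive _ _ _ _)).
- by move=> j; apply: compact_borel; exact: cB.
- by rewrite -E; apply: open_borel; apply: open_enorm_ball.
- exact: subset_refl.
rewrite eseries0// => j _ _; apply: nullK; first exact: cB.
by move=> y /le_lt_trans; apply; rewrite ltrBlDr ltrDl invr_gt0.
Qed.

(** At distance at least d the kernel is at most d^p, and closer to x there is no mass. This brings
    the potentials of omega into the truncated form that [tpot_limsup] handles. *)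
Lemma pot_eq_tpot (nu : M) x (d : R) : (0 < d)%R ->
  (forall y, (enorm (x - y) < d)%R ->
    exists V : set 'rV[R]_n, [/\ open V, V y & nu V = 0]) ->
  pot p nu 0 x = tpot p (d `^ p)%R nu x.
Proof.
move=> d0 H; have N0 := null_ball H.
have dp0 : (0 <= d `^ p)%R by exact: powR_ge0.
apply: ge0_ae_eq_integral => //.
- exact: measurable_kernr.
- exact: measurable_tkern.
- by move=> y _; exact: kern_ge0.
- by move=> y _; exact: tkern_ge0.
exists [set y : borelRV R n | (enorm (x - y : 'rV[R]_n) < d)%R]; split => //.
  by apply: open_borel; exact: open_enorm_ball.
move=> y /=; apply: contra_notP => /negP; rewrite -leNgt => dxy _.
rewrite /tkern; apply/esym/min_idPl; rewrite /kern add0r.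
apply: le_trans (le_riesz_profile p0 (ltW d0) dxy) _.
by rewrite /riesz_profile gt_eqF.
Qed.

End distant_measures.

(** * Integrals of the field against admissible measures *)

Section field_functional.
Context {R : realType} {n : nat} (alpha : R).
Hypothesis alpha_ltn : (alpha < n%:R)%R.
Local Open Scope ereal_scope.
Local Notation p := (alpha - n%:R)%R.
Local Notation M := {measure set (borelRV R n) -> \bar R}.

Let p0 : (p < 0)%R. Proof. by rewrite subr_lt0. Qed.

Variable A : set 'rV[R]_n.
Let F : set (borelRV R n) := closure A.

Lemma measurable_closure : measurable F.
Proof. by apply: closed_borel; exact: closed_closure. Qed.

Lemma admissible_closure (m : M) : admissible alpha A m -> m (~` F) = 0.
Proof.
move=> [_ _ [B [mB B0 AB]]]; apply/eqP; rewrite eq_le measure_ge0 andbT -B0.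
apply: le_measure; rewrite ?inE//; first by apply: measurableC; exact: measurable_closure.
by move=> x Fx; apply: AB => Ax; apply: Fx; exact: subset_closure.
Qed.

Lemma admissible_radon (m : M) : admissible alpha A m ->
  forall K : set 'rV[R]_n, compact K -> m K < +oo.
Proof.
move=> [m1 _ _] K cK; apply: (@le_lt_trans _ _ (m setT)); last by rewrite m1 ltry.
by apply: le_measure; rewrite ?inE//; exact: compact_borel.
Qed.

Lemma integral_admissible (m : M) (h : 'rV[R]_n -> \bar R) : admissible alpha A m ->
  measurable_fun [set: borelRV R n] h -> (forall x, 0 <= h x) ->
  \int[m]_(x in F) h x = \int[m]_x h x.
Proof.
move=> mA mh h0.
have mF := measurable_closure.
rewrite -[in RHS](setUv F) ge0_integral_setU//; last 3 first.
- exact: measurableC.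
- by rewrite setUv.
- by rewrite /disj_set setICr.
rewrite [X in _ + X]null_set_integral ?adde0//.
- exact: measurableC.
- exact: measurable_funS mh.
- exact: admissible_closure.
Qed.

Lemma energy2_theta_fin (nu : {sigma_finite_measure set (borelRV R n) -> \bar R}) (m : M) (e : R) :
  (0 < e)%R -> admissible alpha A m ->
  energy2 p m nu 0 <= (@grid_size n)%:R%:E *
    (e%:E * energy2 p m m 0 + e^-1%:E * energy2 p nu nu 0).
Proof.
move=> e0 mA; have [m' m'E] := radon_sigma_finite (admissible_radon mA).
by rewrite -(eq_energy2 p 0 m'E (erefl _)) -(eq_energy2 p 0 m'E m'E); exact: energy2_amgm.
Qed.

Lemma energy2_theta_lty (nu : {sigma_finite_measure set (borelRV R n) -> \bar R}) (m : M) :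
  energy2 p nu nu 0 < +oo -> admissible alpha A m -> energy2 p m nu 0 < +oo.
Proof.
move=> nuE mA; apply: (le_lt_trans (energy2_theta_fin nu ltr01 mA)).
apply: lte_mul_pinfty => //; have [_ mE _] := mA.
by rewrite invr1 !mul1e lte_add_pinfty.
Qed.

Lemma tpot_lty (nu : M) (B : R) (m : M) : (0 <= B)%R -> nu setT < +oo -> m setT = 1 ->
  \int[m]_x tpot p B nu x <= B%:E * nu setT.
Proof.
move=> B0 nu1 m1; rewrite -(integral_tpotDcopot p0 B0 nu m1) leeDl//.
by apply: integral_ge0 => x _; exact: copot_ge0.
Qed.

Variables (g f : 'rV[R]_n -> \bar R) (c : R).
Variables tp tn : {sigma_finite_measure set (borelRV R n) -> \bar R}.
Variables (op on : M) (B : R).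
Hypothesis g0 : forall x, 0 <= g x.
Hypothesis g_open : forall t : R, open [set x | t%:E < g x].
Hypothesis tpE : energy2 p tp tp 0 < +oo.
Hypothesis tnE : energy2 p tn tn 0 < +oo.
Hypothesis op_fin : op setT < +oo.
Hypothesis on_fin : on setT < +oo.
Hypothesis B0 : (0 <= B)%R.
Hypothesis fE : forall x, F x -> f x = (g x - c%:E) + (pot p tp 0 x - pot p tn 0 x) +
  (tpot p B op x - tpot p B on x).

Let mg : measurable_fun [set: borelRV R n] g. Proof. exact: measurable_lsc. Qed.
Let mpot (nu : M) : measurable_fun [set: borelRV R n] (pot p nu 0).
Proof. exact: measurable_pot. Qed.
Let mtpot (nu : M) : measurable_fun [set: borelRV R n] (tpot p B nu).
Proof. by apply: measurable_lsc => t; exact: tpot_superlevel_open. Qed.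

Section one_measure.
Variable m : M.
Hypothesis mA : admissible alpha A m.

Lemma ge0_integrable_F (h : 'rV[R]_n -> \bar R) : measurable_fun [set: borelRV R n] h ->
  (forall x, 0 <= h x) -> \int[m]_x h x < +oo -> m.-integrable F h.
Proof.
move=> mh h0 hoo; apply/integrableP; split; first exact: measurable_funS mh.
under eq_integral => x _ do rewrite gee0_abs//.
by rewrite integral_admissible.
Qed.

(** Finite energy makes the terms in [tp] and [tn] integrable, and boundedness those in [op] and
    [on], so g alone decides integrability of f. *)
Lemma field_integral : \int[m]_x g x < +oo ->
  m.-integrable F f /\
  \int[m]_(x in F) f x = (\int[m]_x g x - c%:E) +
    (energy2 p m tp 0 - energy2 p m tn 0) +
    (\int[m]_x tpot p B op x - \int[m]_x tpot p B on x).
Proof.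
move=> goo; have [m1 mE _] := mA; have mF := measurable_closure.
have ig : m.-integrable F g by exact: ge0_integrable_F.
have itp : m.-integrable F (pot p tp 0).
  apply: ge0_integrable_F => //; first by move=> x; exact: pot_ge0.
  exact: energy2_theta_lty.
have itn : m.-integrable F (pot p tn 0).
  apply: ge0_integrable_F => //; first by move=> x; exact: pot_ge0.
  exact: energy2_theta_lty.
have ot (nu : M) : nu setT < +oo -> m.-integrable F (tpot p B nu).
  move=> nuoo; apply: ge0_integrable_F => //; first by move=> x; exact: tpot_ge0.
  apply: (le_lt_trans (tpot_lty B0 nuoo m1)).
  by apply: lte_mul_pinfty.
have iop := ot op op_fin; have ion := ot on on_fin.
have ic : m.-integrable F (cst c%:E).
  apply/integrableP; split; first exact: measurable_cst.
  rewrite /= integral_cst// lte_mul_pinfty//.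
  apply: (@le_lt_trans _ _ (m setT)); last by rewrite m1 ltry.
  by apply: le_measure; rewrite ?inE.
have i1 := integrableB mF ig ic.
have i2 := integrableB mF itp itn.
have i3 := integrableB mF iop ion.
have i12 := integrableD mF i1 i2.
have i123 := integrableD mF i12 i3.
pose h (x : borelRV R n) : \bar R := (g x - c%:E) + (pot p tp 0 x - pot p tn 0 x) +
  (tpot p B op x - tpot p B on x).
have hf : {in F, h =1 f} by move=> x; rewrite inE => /fE.
split; first by apply: (@eq_integrable _ (borelRV R n) R m F mF h f).
rewrite -(@eq_integral _ (borelRV R n) R m F f h hf) /h.
rewrite (integralD mF i12 i3) (integralD mF i1 i2) (integralB mF ig ic) (integralB mF itp itn)
  (integralB mF iop ion).
have mF1 : m F = 1.
  have Fc := admissible_closure mA.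
  transitivity (m F + m (~` F)); first by rewrite Fc adde0.
  by rewrite -measureU//; [rewrite setUv|exact: measurableC|rewrite setICr].
rewrite integral_cst// mF1 mule1 !integral_admissible//.
all: by move=> x; (exact: pot_ge0 || exact: tpot_ge0).
Qed.

(** The converse of [field_integral]: g is at most |f| plus the sum e of the remaining terms in
    absolute value, and e is integrable for every admissible measure. *)
Lemma field_integrable : m.-integrable F f -> \int[m]_x g x < +oo.
Proof.
move=> fi; have [m1 mE _] := mA; have mF := measurable_closure.
have /integrableP[mf foo] := fi.
pose e x := pot p tp 0 x + pot p tn 0 x + (tpot p B op x + tpot p B on x) + `|c|%:E.
have e0 x : 0 <= e x.
  apply: adde_ge0; last by rewrite lee_fin.
  apply: adde_ge0; apply: adde_ge0; by [exact: pot_ge0|exact: tpot_ge0].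
have me : measurable_fun [set: borelRV R n] e.
  apply: emeasurable_funD => //; apply: emeasurable_funD; exact: emeasurable_funD.
(* The convention oo - oo = -oo only makes |f x| infinite. *)
have key x : F x -> g x <= `|f x| + e x.
  move=> Fx; rewrite fE// /e.
  move: (g x) (g0 x) (pot p tp 0 x) (pot_ge0 p tp 0 x) (pot p tn 0 x) (pot_ge0 p tn 0 x)
    (tpot p B op x) (tpot_ge0 p B0 op x) (tpot p B on x) (tpot_ge0 p B0 on x).
  move=> [y||]// y0 [a||]// a0 [b||]// b0 [u||]// u0 [v||]// v0; rewrite ?leey//.
  rewrite /= !lee_fin; have := ler_norm c; have := ler_norm (y - c + (a - b) + (u - v))%R.
  by move: a0 b0 u0 v0; rewrite !lee_fin; lra.
rewrite -integral_admissible//.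
apply: (@le_lt_trans _ _ (\int[m]_(x in F) (`|f x| + e x))).
  apply: ge0_le_integral => //.
  - exact: measurable_funS mg.
  - by apply: emeasurable_funD; [exact: measurableT_comp|exact: measurable_funS me].
rewrite ge0_integralD//; last 2 first.
- by apply: measurableT_comp.
- exact: measurable_funS me.
rewrite lte_add_pinfty// integral_admissible//.
have D (h h' : 'rV[R]_n -> \bar R) : measurable_fun [set: borelRV R n] h ->
    measurable_fun [set: borelRV R n] h' -> (forall x, 0 <= h x) -> (forall x, 0 <= h' x) ->
    \int[m]_x h x < +oo -> \int[m]_x h' x < +oo -> \int[m]_x (h x + h' x) < +oo.
  by move=> mh mh' h0 h'0 hoo h'oo; rewrite ge0_integralD// lte_add_pinfty.
have pot0 (nu : M) x : 0 <= pot p nu 0 x by exact: pot_ge0.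
have tpot0 (nu : M) x : 0 <= tpot p B nu x by exact: tpot_ge0.
have tpotoo (nu : M) : nu setT < +oo -> \int[m]_x tpot p B nu x < +oo.
  by move=> nuoo; apply: (le_lt_trans (tpot_lty B0 nuoo m1)); exact: lte_mul_pinfty.
apply: (D _ _) => //; [| |apply: (D _ _) => //|].
- by apply: emeasurable_funD; exact: emeasurable_funD.
- by move=> x; apply: adde_ge0; apply: adde_ge0.
- exact: emeasurable_funD.
- exact: emeasurable_funD.
- by move=> x; exact: adde_ge0.
- by move=> x; exact: adde_ge0.
- by apply: (D _ _) => //; exact: energy2_theta_lty.
- by apply: (D _ _) => //; exact: tpotoo.
- by rewrite integral_cst// m1 mule1 ltry.
Qed.

End one_measure.

Definition field_energy (m : M) : \bar R := energy2 p m m 0 + 2%:E * \int[m]_(x in F) f x.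

Lemma field_energyE (m : M) : admissible alpha A m -> \int[m]_x g x < +oo ->
  exists e y a b u v : R, [/\ [/\ (0 <= e)%R, (0 <= y)%R, (0 <= a)%R & (0 <= u)%R],
    [/\ energy2 p m m 0 = e%:E, \int[m]_x g x = y%:E, energy2 p m tp 0 = a%:E & energy2 p m tn 0 = b%:E],
    \int[m]_x tpot p B op x = u%:E, \int[m]_x tpot p B on x = v%:E &
    field_energy m = (e + 2 * (y - c + (a - b) + (u - v)))%:E].
Proof.
move=> mA goo; have [m1 mE _] := mA.
have [_ fI] := field_integral mA goo.
have fin (z : \bar R) : 0 <= z -> z < +oo -> exists2 r : R, (0 <= r)%R & z = r%:E.
  by case: z => [r||]// r0 _; exists r.
have [e e0 eE] := fin _ (energy2_ge0 p m m 0) mE.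
have [y y0 yE] : exists2 r : R, (0 <= r)%R & \int[m]_x g x = r%:E.
  by apply: fin => //; apply: integral_ge0.
have [a a0 aE] := fin _ (energy2_ge0 p m tp 0) (energy2_theta_lty tpE mA).
have [b b0 bE] := fin _ (energy2_ge0 p m tn 0) (energy2_theta_lty tnE mA).
have finO (nu : M) : nu setT < +oo -> exists2 r : R, (0 <= r)%R & \int[m]_x tpot p B nu x = r%:E.
  move=> nuoo; apply: fin; first by apply: integral_ge0 => x _; exact: tpot_ge0.
  by apply: (le_lt_trans (tpot_lty B0 nuoo m1)); exact: lte_mul_pinfty.
have [u u0 uE] := finO op op_fin.
have [v v0 vE] := finO on on_fin.
exists e, y, a, b, u, v; split => //.
by rewrite /field_energy fI eE yE aE bE uE vE.
Qed.

End field_functional.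

(** The infimum w may still be -oo, so the bounds are w + 1/(k+1) or -k accordingly. In both cases
    the first one is the largest and serves as the common bound b. *)
Lemma ex_minimizing_seq {R : realType} {T : Type} (S : set T) (J : T -> \bar R) :
  (ereal_inf [set J x | x in S] < +oo)%E ->
  exists (u : nat -> T) (b : R), [/\ forall k, S (u k), forall k, (J (u k) < b%:E)%E &
    forall s : R, (ereal_inf [set J x | x in S] < s%:E)%E -> \forall k \near \oo, (J (u k) < s%:E)%E].
Proof.
set w := ereal_inf _ => woo.
have [t [tw tb ts]] : exists t : nat -> R, [/\ forall k, (w < (t k)%:E)%E, forall k, t k <= t 0%N &
    forall s : R, (w < s%:E)%E -> \forall k \near \oo, t k <= s].
  case: w woo => [r||]// _.
  - exists (fun k => r + k.+1%:R^-1); split => [k|k|s].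
    + by rewrite lte_fin ltrDl invr_gt0.
    + by rewrite lerD2l invr1 invf_le1// ler1n.
    + rewrite lte_fin => rs; have e0 : 0 < s - r by rewrite subr_gt0.
      apply: filterS (near_infty_natSinv_lt (PosNum e0)) => k /= /ltW.
      by rewrite lerBrDl.
  - exists (fun k => - k%:R); split => [k|k|s _].
    + by rewrite ltNyr.
    + by rewrite lerN2 ler_nat.
    + apply: filterS (nbhs_infty_ger (- s)) => k /=; by rewrite lerNl.
have H k : exists x, S x /\ (J x < (t k)%:E)%E.
  by have [_ [x Sx <-] xk] := ereal_inf_lt (tw k); exists x.
have [u uP] := choice H; exists u, (t 0%N); split => [k|k|s /ts].
- by have [] := uP k.
- by have [_ /lt_le_trans] := uP k; apply; rewrite lee_fin.
- by apply: filterS => k tk; have [_ /lt_le_trans] := uP k; apply; rewrite lee_fin.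
Qed.

(** * Existence of a minimiser *)

Section minimizer.
Context {R : realType} {n : nat} (alpha : R).
Hypothesis alpha_ltn : (alpha < n%:R)%R.
Local Open Scope ereal_scope.
Local Notation p := (alpha - n%:R)%R.
Local Notation M := {measure set (borelRV R n) -> \bar R}.

Let p0 : (p < 0)%R. Proof. by rewrite subr_lt0. Qed.

(** Positive capacity gives a measure of finite energy on {psi < +oo}, which need not integrate g.
    The sets {g <= j} exhaust almost all of its mass, so one of them has positive mass, and
    restricting to it makes g bounded. *)
Lemma ex_admissible_finite (A : set 'rV[R]_n) (psi g : 'rV[R]_n -> \bar R) (c : R) :
  (forall x, 0 <= g x) -> (forall t : R, open [set x | t%:E < g x]) ->
  (forall x, closure A x -> psi x = g x - c%:E) -> 
  0 < inner_cap alpha [set x | A x /\ psi x < +oo] ->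
  exists m : M, admissible alpha A m /\ \int[m]_x g x < +oo.
Proof.
move=> g0 g_open psiE cap0; set A' := [set x | _] in cap0.
have : ereal_inf [set energy alpha mu | mu in unitE alpha A'] < +oo.
  rewrite ltey; apply/eqP => E; move: cap0; rewrite /inner_cap E.
  by rewrite invey ltxx.
move=> /ereal_inf_lt[_ [mu /unitE_rpos[_ mA'] _] _]; set m := rpos mu in mA'.
have mA : admissible alpha A m.
  have [m1 mE [N [mN N0 AN]]] := mA'; split => //; exists N; split => //.
  by move=> x Ax; apply: AN => -[].
have [m1 _ [N [mN N0 AN]]] := mA'.
pose C (j : nat) : set (borelRV R n) := [set x | g x <= j%:R%:E].
have mC j : measurable (C j).
  rewrite (_ : C j = ~` [set x | j%:R%:E < g x]); last first.
    by apply/seteqP; split => x /=; rewrite /C/= leNgt => /negP.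
  by apply: measurableC; exact: open_borel.
have [j Cj] : exists j, 0 < m (C j).
  apply: contrapT => nC.
  have C0 j : m (C j) = 0.
    by apply/eqP; rewrite eq_le measure_ge0 andbT leNgt; apply/negP => h; apply: nC; exists j.
  have : m setT <= 0.
    apply: (@le_trans _ _ (m (N `|` \bigcup_j C j))).
      apply: le_measure; rewrite ?inE//.
        by apply: measurableU => //; exact: bigcupT_measurable.
      move=> x _; have [[Ax psix]|] := pselect (A' x); last by left; exact: AN.
      right; have gx : g x < +oo.
        move: psix; rewrite psiE; last exact: subset_closure.
        by case: (g x) (g0 x) => [r||]//= _ _; rewrite ltry.
      exists (Num.Def.trunc (fine (g x))).+1 => //; rewrite /C /=.
      have gf : g x \is a fin_num by rewrite ge0_fin_numE.
      by rewrite -(fineK gf) lee_fin; apply/ltW/Num.Theory.truncnS_gt.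
    apply: (le_trans (measureU2 _ _ _)) => //; first exact: bigcupT_measurable.
    rewrite [X in X + _]N0 add0e.
    apply: (le_trans (measure_sigma_subadditive _ _ _ (@subset_refl _ _))) => //.
      exact: bigcupT_measurable.
    by rewrite eseries0.
  by rewrite m1 leNgt lte01.
have [m' [m'A m'C _]] := admissible_restrict alpha_ltn (mC j) mA Cj.
exists m'; split => //.
have mg : measurable_fun [set: borelRV R n] g by exact: measurable_lsc.
have [m'1 _ _] := m'A.
apply: (@le_lt_trans _ _ (j%:R%:E)); last exact: ltry.
rewrite -[leRHS]mule1 -m'1 -integral_cst//.
apply: ae_ge0_le_integral => //; first by move=> x _; rewrite /= lee_fin.
exists (~` C j); split => //; first exact: measurableC.
by move=> x h Cx; apply: h.
Qed.

Lemma ex_minimizer (A : set 'rV[R]_n) (g f : 'rV[R]_n -> \bar R) (c : R)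
    (tp tn : {sigma_finite_measure set (borelRV R n) -> \bar R}) (op on : M) (B : R) :
  quasicompact alpha A ->
  (forall x, 0 <= g x) -> (forall t : R, open [set x | t%:E < g x]) ->
  (forall K : set 'rV[R]_n, compact K -> tn K < +oo) ->
  energy2 p tp tp 0 < +oo -> energy2 p tn tn 0 < +oo ->
  op setT < +oo -> on setT < +oo -> (0 <= B)%R ->
  (forall x, closure A x -> f x = (g x - c%:E) + (pot p tp 0 x - pot p tn 0 x) +
    (tpot p B op x - tpot p B on x)) ->
  (exists m : M, admissible alpha A m /\ \int[m]_x g x < +oo) ->
  exists l : M, [/\ admissible alpha A l, \int[l]_x g x < +oo &
    forall m : M, admissible alpha A m -> \int[m]_x g x < +oo ->
      field_energy alpha A f l <= field_energy alpha A f m].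
Proof.
move=> qA g0 g_open tnK tpE tnE op_fin on_fin B0 fE [m0 [m0A m0g]].
have formula := field_energyE alpha_ltn g0 g_open tpE tnE op_fin on_fin B0 fE.
pose S : set M := [set m | admissible alpha A m /\ \int[m]_x g x < +oo].
pose J := field_energy alpha A f.
have infoo : ereal_inf [set J m | m in S] < +oo.
  apply: (@le_lt_trans _ _ (J m0)); first by apply: ereal_inf_lbound; exists m0.
  have [e [y [a [b [u [v [_ _ _ _]]]]]]] := formula m0 m0A m0g.
  by rewrite /J => ->; rewrite ltry.
have [m [b [mS mb minf]]] := ex_minimizing_seq infoo.
have mA k : admissible alpha A (m k) by have [] := mS k.
have mg k : \int[m k]_x g x < +oo by have [] := mS k.
set N : R := (@grid_size n)%:R; have N0 : (0 <= N)%R by [].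
have [tnn tnnE] : exists t : R, energy2 p tn tn 0 = t%:E.
  by exists (fine (energy2 p tn tn 0)); rewrite fineK// ge0_fin_numE// energy2_ge0.
have [ob oE] : exists r : R, B%:E * on setT = r%:E.
  exists (fine (B%:E * on setT)); rewrite fineK// ge0_fin_numE ?mule_ge0//.
  exact: lte_mul_pinfty.
(* With N h <= 1/4, twice the mutual energy with [tn] costs at most half of the energy of [m k],
   which is absorbed on the left; hence the leading factor 2 in C. *)
pose h := (1 / (4 * (N + 1)))%R; have h0 : (0 < h)%R by rewrite divr_gt0// mulr_gt0// ltr_wpDl.
have Nh : (N * h <= 1 / 4)%R.
  rewrite /h mulrA mulr1 ler_pdivrMr ?mulr_gt0 ?ltr_wpDl//.
  have -> : (1 / 4 * (4 * (N + 1)) = N + 1)%R by field.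
  by rewrite lerDl.
pose C := (2 * (b + 2 * c + 2 * (N * (h^-1 * tnn)) + 2 * ob))%R.
have mC k : energy2 p (m k) (m k) 0 <= C%:E.
  have [e [y [a [b' [u [v [[e0 y0 a0 u0] [eE yE aE bE] uE vE JE]]]]]]] := formula (m k) (mA k) (mg k).
  have := mb k; rewrite /J JE lte_fin => Jb.
  have [m1 _ _] := mA k.
  have := energy2_theta_fin alpha_ltn tn h0 (mA k).
  rewrite bE eE tnnE -(EFinM h e) -(EFinM h^-1 tnn) -EFinD -EFinM lee_fin -/N => bb.
  have := tpot_lty alpha_ltn B0 on_fin m1; rewrite vE oE lee_fin => vo.
  have Nhe : (N * (h * e) <= 1 / 4 * e)%R by rewrite mulrA ler_wpM2r.
  rewrite lee_fin /C; move: bb; rewrite mulrDr => bb.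
  move: Nhe bb; set z := (N * (h * e))%R; set z' := (N * (h^-1 * tnn))%R => Nhe bb.
  lra.
have [U [l [UU ooU lA weak Elim]]] := ex_admissible_limit alpha_ltn qA mA mC.
have PU : ProperFilter U by exact: ultra_proper.
have m1 k : m k setT = 1 by have [] := mA k.
have [l1 lE _] := lA.
have [b2 b2E] : exists t : R, energy2 p l tn 0 = t%:E.
  exists (fine (energy2 p l tn 0)); rewrite fineK// ge0_fin_numE ?energy2_ge0//.
  exact: (energy2_theta_lty alpha_ltn tnE lA).
have [v2 v2E] : exists t : R, \int[l]_x tpot p B on x = t%:E.
  exists (fine (\int[l]_x tpot p B on x)); rewrite fineK// ge0_fin_numE.
    by apply: (le_lt_trans (tpot_lty alpha_ltn B0 on_fin l1)); exact: lte_mul_pinfty.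
  by apply: integral_ge0 => x _; exact: tpot_ge0.
(* The nonnegative part of the functional, which is lower semicontinuous along U; the subtracted
   terms in [tn] and [on] need upper limits instead. *)
pose X (m : M) := energy2 p m m 0 + 2%:E * (\int[m]_x g x + energy2 p m tp 0 + \int[m]_x tpot p B op x).
have Xlim : liminf_ge U (X l) (fun k => X (m k)).
  have g0' (m' : M) : 0 <= \int[m']_x g x by exact: integral_ge0.
  have o0' (m' : M) : 0 <= \int[m']_x tpot p B op x by apply: integral_ge0 => x _; exact: tpot_ge0.
  have t0' (m' : M) : 0 <= energy2 p m' tp 0 by exact: energy2_ge0.
  apply: liminf_geD => //; first exact: energy2_ge0.
  - by rewrite mule_ge0// adde_ge0// adde_ge0.
  - by move=> k; exact: energy2_ge0.
  - by move=> k; rewrite mule_ge0// adde_ge0// adde_ge0.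
  apply: liminf_geZ => //; apply: liminf_geD => //.
  - by rewrite adde_ge0.
  - by move=> k; rewrite adde_ge0.
  apply: liminf_geD => //.
  - exact: portmanteau_lsc.
  - apply: portmanteau_lsc => // x; first exact: pot_ge0.
    by apply: pot_superlevel_open.
  - apply: portmanteau_lsc => // x; first exact: tpot_ge0.
    by apply: tpot_superlevel_open.
(* X = J + 2c + 2 (terms in [tn] and [on]), and each of these two terms exceeds its limit by less
   than e; this gives 4e. *)
have bound (s e : R) : ereal_inf [set J m | m in S] < s%:E -> (0 < e)%R ->
    X l <= (s + 2 * c + 2 * b2 + 2 * v2 + 4 * e)%:E.
  move=> ws e0; rewrite leNgt; apply/negP => Xs.
  have H1 := Xlim _ Xs.
  have H2 : \forall k \near U, J (m k) < s%:E by apply: ooU; exact: minf.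
  have H3 : \forall k \near U, energy2 p (m k) tn 0 < (b2 + e)%:E.
    have [m' m'E] := choice (fun k => radon_sigma_finite (admissible_radon (mA k))).
    have : \forall k \near U, energy2 p (m' k) tn 0 < (b2 + e)%:E.
      apply: (@cross_limsup R n p p0 nat U PU m' l tn C) => //.
      - by move=> k; rewrite m'E.
      - by move=> G oG s' s'G; apply: filterS (weak G oG s' s'G) => k; rewrite m'E.
      - by move=> k; rewrite (eq_energy2 p 0 (m'E k) (m'E k)).
      - by rewrite b2E lte_fin ltrDl.
    by apply: filterS => k; rewrite (eq_energy2 p 0 (m'E k) (erefl _)).
  have H4 : \forall k \near U, \int[m k]_x tpot p B on x < (v2 + e)%:E.
    by apply: (tpot_limsup p0 B0 on_fin m1 l1 weak); rewrite v2E lte_fin ltrDl.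
  have : \forall k \near U, False; last by move/filter_ex => [].
  near=> k.
  have h1 : (s + 2 * c + 2 * b2 + 2 * v2 + 4 * e)%:E < X (m k) by near: k.
  have h2 : J (m k) < s%:E by near: k.
  have h3 : energy2 p (m k) tn 0 < (b2 + e)%:E by near: k.
  have h4 : \int[m k]_x tpot p B on x < (v2 + e)%:E by near: k.
  have [e1 [y [a [b' [u [v [_ [eE yE aE bE] uE vE JE]]]]]]] := formula (m k) (mA k) (mg k).
  have XE : X (m k) = (e1 + 2 * (y + a + u))%:E by rewrite /X eE yE aE uE.
  by move: h1 h2 h3 h4; rewrite XE /J JE bE vE !lte_fin; lra.
(* This must come before the formula for the functional can be used at l; it follows from the bound
   on X, where all terms are nonnegative. *)
have lg : \int[l]_x g x < +oo.
  have [s ws] : exists s : R, ereal_inf [set J m | m in S] < s%:E.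
    by move: infoo; case: ereal_inf => [r||]// _; [exists (r + 1)%R; rewrite lte_fin ltrDl ltr01|exists 0%R; rewrite ltNyr].
  apply: (@le_lt_trans _ _ (X l)); last by apply: le_lt_trans (bound s 1%R ws ltr01) _; exact: ltry.
  have G0 : 0 <= \int[l]_x g x by exact: integral_ge0.
  have T0 : 0 <= energy2 p l tp 0 by exact: energy2_ge0.
  have O0 : 0 <= \int[l]_x tpot p B op x by apply: integral_ge0 => x _; exact: tpot_ge0.
  have E0 : 0 <= energy2 p l l 0 by exact: energy2_ge0.
  rewrite /X; apply: (@le_trans _ _ (2%:E * \int[l]_x g x)).
    by rewrite -[leLHS]mul1e; apply: lee_pmul => //; rewrite lee_fin ler1n.
  apply: (@le_trans _ _ (2%:E * (\int[l]_x g x + energy2 p l tp 0 + \int[l]_x tpot p B op x))).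
    apply: lee_pmul => //; rewrite -addeA leeDl// adde_ge0//.
  by rewrite leeDr.
exists l; split => // m' m'A m'g.
have [e [y [a [b' [u [v [_ [eE yE aE bE] uE vE JE]]]]]]] := formula l lA lg.
apply/lee_addgt0Pr => d d0.
have [e' [y' [a' [b3 [u' [v' [_ _ _ _ JE']]]]]]] := formula m' m'A m'g.
move: JE'; set r : R := (_ + _)%R => JE'.
(* The comparison is with the value r at one competitor, so the infimum itself need not be finite.
   The margin d/2 and 4 (d/8) add up to d. *)
have ws : ereal_inf [set J m | m in S] < (r + d / 2)%:E.
  apply: (@le_lt_trans _ _ (J m')); first by apply: ereal_inf_lbound; exists m'.
  by rewrite /J JE' lte_fin ltrDl divr_gt0.
have d8 : (0 < d / 8)%R by rewrite divr_gt0.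
have XE : X l = (e + 2 * (y + a + u))%:E by rewrite /X eE yE aE uE.
have := bound _ _ ws d8; rewrite XE lee_fin => Xle.
rewrite JE JE' -EFinD lee_fin.
have bb : b' = b2 by move: bE; rewrite b2E => -[].
have vv : v = v2 by move: vE; rewrite v2E => -[].
by rewrite bb vv; lra.
Unshelve. all: by end_near. Qed.

End minimizer.

(** Half of the distance to A survives the passage to the closure, where the field lives. An
    infinite infimum means that A or S is empty, and then any positive number will do. *)
Lemma supp_distance {R : realType} {n : nat} (A S : set 'rV[R]_n) :
  (0 < ereal_inf [set (enorm (x - y))%:E | x in S & y in A])%E ->
  exists2 d : R, 0 < d & forall x y, closure A x -> enorm (x - y) < d -> ~ S y.
Proof.
move=> dist0.
have [e e0 eP] : exists2 e : R, 0 < e & forall x y, S x -> A y -> e <= enorm (x - y).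
  have lb x y : S x -> A y ->
      (ereal_inf [set (enorm (x - y))%:E | x in S & y in A] <= (enorm (x - y))%:E)%E.
    by move=> Sx Ay; apply: ereal_inf_lbound; exists x => //; exists y.
  move: dist0 lb; case: ereal_inf => [r||]// r0 lb.
  - by exists r => // x y Sx Ay; rewrite -lee_fin lb.
  - by exists 1 => // x y Sx Ay; have := lb x y Sx Ay.
exists (e / 2) => [|x y clx xy Sy]; first by rewrite divr_gt0.
have e20 : 0 < e / 2 by rewrite divr_gt0.
have [z [Az xz]] := clx _ (near_enorm x e20).
have := eP y z Sy Az; have := enorm_dist y x z; rewrite (enormC y x); move: xz => /=; lra.
Qed.

Lemma off_supp {R : realType} {n : nat} (omega : signed_radon R n) (y : 'rV[R]_n) :
  ~ supp omega y ->
  exists V : set 'rV[R]_n, [/\ open V, V y, rpos omega V = 0%E & rneg omega V = 0%E].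
Proof.
move=> ny; have [V [oV Vy V0]] : exists V : set 'rV[R]_n, [/\ open V, V y & (tvar omega V <= 0)%E].
  apply: contrapT => H; apply: ny => V oV Vy; rewrite ltNge; apply/negP => V0.
  by apply: H; exists V.
have E : tvar omega V = (rpos omega V + rneg omega V)%E.
  by transitivity (measure_add (rpos omega) (rneg omega) V) => //; rewrite measure_addE.
exists V; split => //; apply/eqP; rewrite eq_le measure_ge0 andbT (le_trans _ V0)// E.
- by rewrite leeDl.
- by rewrite leeDr.
Qed.
Theorem corollary2p2 (R : realType) (n : nat) (n_ge2 : (2 <= n)%N)
  (alpha : R) (alpha_gt0 : 0 < alpha) (alpha_ltn : alpha < n%:R)
  (A : set 'rV[R]_n) (qcA : quasicompact alpha A)
  (psi : 'rV[R]_n -> \bar R) (psiP : classPhi (closure A) psi)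
  (theta : signed_radon R n) (thetaE : spaceE alpha theta)
  (omega : signed_radon R n) (omegaM : spaceM alpha omega)
  (omega_bounded : bounded_measure omega)
  (omega_dist : (0 < ereal_inf
     [set (enorm (x - y))%:E | x in supp omega & y in A])%E)
  (psi_cap : (0 < inner_cap alpha [set x | A x /\ psi x < +oo])%E) :
  let f := external_field alpha psi theta omega in
  exists lambda : signed_radon R n,
    unitEf alpha f A lambda /\ energyf alpha f A lambda = wf alpha f A.
Proof.
have p0 : alpha - n%:R < 0 by rewrite subr_lt0.
set F := closure A.
have [c [g [g0 g_open psiE goff]]] := ex_lsc_extension (@closed_closure _ A) psiP.
have [thetaM thetafin] := thetaE.
have [tp tpeq] := radon_sigma_finite (@rpos_compact _ _ theta).
have [tn tneq] := radon_sigma_finite (@rneg_compact _ _ theta).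
have [tpE tnE] : (energy2 (alpha - n%:R) tp tp 0 < +oo)%E /\
    (energy2 (alpha - n%:R) tn tn 0 < +oo)%E.
  rewrite (eq_energy2 _ 0 tpeq tpeq) (eq_energy2 _ 0 tneq tneq) -!mutual_energyE.
  (* A finite sum has finite summands, so finiteness of I(theta) makes the energies of its positive
     and negative parts finite separately. *)
  move: thetafin; rewrite /energy fin_numD => /andP[]; rewrite fin_numD => /andP[h1 h2] _.
  by rewrite !ltey_eq h1 h2.
have tot : tvar omega setT = (rpos omega setT + rneg omega setT)%E.
  by transitivity (measure_add (rpos omega) (rneg omega) setT) => //; rewrite measure_addE.
have op_fin : (rpos omega setT < +oo)%E.
  by apply: le_lt_trans omega_bounded; rewrite tot leeDl.
have on_fin : (rneg omega setT < +oo)%E.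
  by apply: le_lt_trans omega_bounded; rewrite tot leeDr.
have [d d0 dP] := supp_distance omega_dist.
(* This is the value of the kernel at distance d; truncation there does not change the potentials of
   omega on the closure of A. *)
have B0 : 0 <= d `^ (alpha - n%:R) by exact: powR_ge0.
have omegaE x : F x ->
    pot (alpha - n%:R) (rpos omega) 0 x = tpot (alpha - n%:R) (d `^ (alpha - n%:R)) (rpos omega) x /\
    pot (alpha - n%:R) (rneg omega) 0 x = tpot (alpha - n%:R) (d `^ (alpha - n%:R)) (rneg omega) x.
  move=> Fx; split; apply: pot_eq_tpot => // y /(dP x y Fx)/off_supp[V [oV Vy V0 V0']];
    by exists V.
set f := external_field alpha psi theta omega => /=.
have fE x : F x -> f x = ((g x - c%:E) +
    (pot (alpha - n%:R) tp 0 x - pot (alpha - n%:R) tn 0 x) +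
    (tpot (alpha - n%:R) (d `^ (alpha - n%:R)) (rpos omega) x -
     tpot (alpha - n%:R) (d `^ (alpha - n%:R)) (rneg omega) x))%E.
  move=> Fx; have [<- <-] := omegaE x Fx.
  by rewrite /f /external_field !potentialE (eq_pot _ 0 x tpeq) (eq_pot _ 0 x tneq) psiE.
have tnK (K : set 'rV[R]_n) : compact K -> (tn K < +oo)%E.
  by move=> cK; rewrite tneq; exact: rneg_compact.
have finite_g := ex_admissible_finite alpha_ltn g0 g_open psiE psi_cap.
have [l [lA lg lmin]] := ex_minimizer alpha_ltn qcA g0 g_open tnK tpE tnE op_fin on_fin B0 fE finite_g.
have mF := measurable_closure A.
have energyfE mu : rneg mu setT = 0%E -> energyf alpha f A mu = field_energy alpha A f (rpos mu).
  by move=> neg0; rewrite /energyf energy_pos// sintegral_pos.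
have l_fin : (l setT < +oo)%E by have [-> _ _] := lA; rewrite ltry.
have lU : unitEf alpha f A (pos_radon l_fin).
  have lE := unitE_pos_radon alpha_ltn l_fin lA.
  split => //; split; first by case: lE.
  apply/integrable_pos => //.
  by have [] := field_integral alpha_ltn g0 g_open tpE tnE op_fin on_fin B0 fE lA lg.
exists (pos_radon l_fin); split => //.
apply/eqP; rewrite eq_le; apply/andP; split; last first.
  by apply: ereal_inf_lbound; exists (pos_radon l_fin).
(* A competitor has no negative part, so it is compared through [rpos mu], and integrability of f
   supplies the finite integral of g that [lmin] asks for. *)
apply: le_ereal_inf_tmp => _ [mu [[muE muf] /unitE_rpos[neg0 muA]] <-].
rewrite !energyfE//; apply: lmin => //.
apply: (field_integrable alpha_ltn g0 g_open tpE tnE op_fin on_fin B0 fE muA).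
exact/integrable_pos.
Qed.
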